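(* Let $T_0:S^1\to S^1$ satisfy (A0) and (A1) with constant $\alpha<1$, let $L_0$ be its transfer operator acting on $W^{1,1}(S^1,\mathbb{C})$, and let $\lambda_0>\alpha$ be a real, positive, simple eigenvalue of $L_0$, with eigenfunctional $\varphi_0$ of $L_0^*$ and eigenfunction $v_0$ of $L_0$. Define $\mathcal{J}$ on $H^4(S^1,\mathbb{R})$ by $\mathcal{J}(\dot T)=\varphi_0(\dot L(\dot T)v_0)$. If $\mathcal{J}$ is not uniformly vanishing, then there is a unique solution $\dot T$ of the problem of maximising $\mathcal{J}(\dot T)$ over $\dot T\in H^4(S^1,\mathbb{R})$ subject to $\|\dot T\|_{H^4}\le1$.
   Context: $S^1=\mathbb{R}/\mathbb{Z}$. $W^{k,p}$ is the Sobolev space of functions with weak derivatives up to order $k$ in $L^p$; $H^k=W^{k,2}$, and $\|f\|_{H^4}^2=\sum_{k=0}^4\int_{S^1}|f^{(k)}|^2dx$ (so $H^4(S^1)\subset C^3(S^1)$). (A0): $T_0\in C^4(S^1)$. (A1): there is $\alpha<1$ such that $|T_0'(x)|\ge\alpha^{-1}$ for all $x\in S^1$. The transfer operator of $T_0$ is $L_0f(x)=\sum_{y\in T_0^{-1}(x)}f(y)/|T_0'(y)|$. The derivative operator in direction $\dot T$ is $\dot L(\dot T)f:=-L_0\left(\left[f\dot T/T_0'\right]'\right)$. $\varphi_0\in(W^{1,1}(S^1,\mathbb{C}))^*$ satisfies $L_0^*\varphi_0=\lambda_0\varphi_0$ and is scaled so that $\varphi_0(\mathbf 1)=1$, where $\mathbf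 1$ is the constant function $1$; $v_0$ satisfies $L_0v_0=\lambda_0v_0$ and is scaled so that $\varphi_0(v_0)=1$ (it lies in $W^{3,1}(S^1)$). The quantity $\mathcal{J}(\dot T)$ is the derivative at $\delta=0$, written $\dot\lambda(\dot T)$, of the eigenvalue $\lambda_\delta$ continuing $\lambda_0$ for perturbed maps $T_\delta=T_0+\delta\dot T+O_{C^3}(\delta^2)$. *)

(* Defs.v *)
(* The circle S^1 = R/Z is encoded through 1-periodic functions on R, and a
   self-map of the circle through a lift R -> R.  Sobolev functions are genuine
   functions, and equality in a Sobolev space is equality almost everywhere. *)

From HB Require Import structures.
From mathcomp Require Import all_boot all_order all_algebra.
From mathcomp Require Import all_classical all_reals all_analysis.
From mathcomp Require Import complex.

Set Implicit Arguments.
Unset Strict Implicit.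
Unset Printing Implicit Defensive.

Import Order.TTheory GRing.Theory Num.Theory.
Import numFieldNormedType.Exports.

Local Open Scope classical_set_scope.
Local Open Scope ring_scope.
Local Open Scope complex_scope.

Definition is_Ck (R : realType) (k : nat) (f : R -> R) : Prop :=
  (forall (j : nat) (x : R), (j < k)%N -> derivable (derive1n j f) x 1) /\
  continuous (derive1n k f).

Definition is_smooth (R : realType) (f : R -> R) : Prop :=
  forall (j : nat) (x : R), derivable (derive1n j f) x 1.

(* T is the lift of a map S^1 -> S^1 (of degree d). *)
Definition circle_lift (R : realType) (T : R -> R) : Prop :=
  exists d : int, forall x : R, T (x + 1) = T x + d%:~R.

Definition ae_equal (R : realType) (V : Type) (f g : R -> V) : Prop :=
  f = g %[ae (@lebesgue_measure R)].

Definition Lp_circle (R : realType) (p : \bar R) (f : R -> R) : Prop :=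
  periodic f 1 /\ f \_ `[0, 1] \in Lfun (@lebesgue_measure R) p.

Definition is_weak_deriv (R : realType) (k : nat) (f g : R -> R) : Prop :=
  forall h : R -> R, is_smooth h -> periodic h 1 ->
    \int[@lebesgue_measure R]_(x in `[0, 1]) (f x * derive1n k h x) =
    (-1) ^+ k * \int[@lebesgue_measure R]_(x in `[0, 1]) (g x * h x).

Definition sobolev (R : realType) (k : nat) (p : \bar R) (f : R -> R) : Prop :=
  Lp_circle p f /\
  forall j : nat, (j <= k)%N -> exists g, Lp_circle p g /\ is_weak_deriv j f g.

(* A version of the k-th weak derivative of f (unique up to a null set when it
   exists, and the zero function when it does not). *)
Definition weak_deriv (R : realType) (k : nat) (f : R -> R) : R -> R :=
  xget (fun=> 0) [set g | Lp_circle 1%E g /\ is_weak_deriv k f g].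

Definition H4 (R : realType) (f : R -> R) : Prop := sobolev 4 2%:E f.

Definition H4_norm (R : realType) (f : R -> R) : R :=
  Num.sqrt (\sum_(k < 5)
    \int[@lebesgue_measure R]_(x in `[0, 1]) (weak_deriv k f x ^+ 2)).

Definition sobolevC (R : realType) (k : nat) (p : \bar R) (f : R -> R[i]) :
    Prop :=
  sobolev k p (fun x => complex.Re (f x)) /\
  sobolev k p (fun x => complex.Im (f x)).

Definition weak_derivC (R : realType) (k : nat) (f : R -> R[i]) : R -> R[i] :=
  fun x => weak_deriv k (fun y => complex.Re (f y)) x +i*
           weak_deriv k (fun y => complex.Im (f y)) x.

Definition W11 (R : realType) (f : R -> R[i]) : Prop := sobolevC 1 1%E f.

Definition W11_norm (R : realType) (f : R -> R[i]) : R :=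
  \int[@lebesgue_measure R]_(x in `[0, 1]) Normc.normc (f x) +
  \int[@lebesgue_measure R]_(x in `[0, 1]) Normc.normc (weak_derivC 1 f x).

(* phi belongs to the dual of W^{1,1}(S^1, C); its values outside W^{1,1} are
   irrelevant.  Boundedness forces phi f = phi g when f = g almost everywhere. *)
Definition W11_dual (R : realType) (phi : (R -> R[i]) -> R[i]) : Prop :=
  (forall (c : R[i]) (f g : R -> R[i]), W11 f -> W11 g ->
    phi (fun x => c * f x + g x) = c * phi f + phi g) /\
  exists C : R, forall f : R -> R[i], W11 f ->
    Normc.normc (phi f) <= C * W11_norm f.

(* [0, 1[ is a fundamental domain for S^1. *)
Definition circle_preimage (R : realType) (T : R -> R) (x : R) : set R :=
  [set y | 0 <= y < 1 /\ exists m : int, T y = x + m%:~R].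

Definition transfer (R : realType) (T : R -> R) (f : R -> R[i]) : R -> R[i] :=
  fun x => \sum_(y \in circle_preimage T x) f y / (`|derive1 T y|)%:C.

(* f |-> - L ((f Tdot / T')'), with a weak derivative. *)
Definition dot_transfer (R : realType) (T Tdot : R -> R) (f : R -> R[i]) :
    R -> R[i] :=
  fun x => - transfer T
    (weak_derivC 1 (fun y => f y * (Tdot y / derive1 T y)%:C)) x.

Definition W11_eigenfunction (R : realType)
    (L : (R -> R[i]) -> R -> R[i]) (lam : R[i]) (v : R -> R[i]) : Prop :=
  W11 v /\ ae_equal (L v) (fun x => lam * v x).

Definition W11_eigenfunctional (R : realType)
    (L : (R -> R[i]) -> R -> R[i]) (lam : R[i])
    (phi : (R -> R[i]) -> R[i]) : Prop :=
  W11_dual phi /\ forall f : R -> R[i], W11 f -> phi (L f) = lam * phi f.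

Definition W11_range (R : realType)
    (L : (R -> R[i]) -> R -> R[i]) (lam : R[i]) (f : R -> R[i]) : Prop :=
  W11 f /\
  exists g : R -> R[i], W11 g /\ ae_equal f (fun x => L g x - lam * g x).

(* lam is an isolated eigenvalue of algebraic multiplicity one in the sense of
   perturbation theory: ker (L - lam) is a line and
   W^{1,1} = ker (L - lam) (+) range (L - lam).  Equivalently, lam is an isolated
   point of the spectrum whose spectral projection has rank one. *)
Definition W11_simple_eigenvalue (R : realType)
    (L : (R -> R[i]) -> R -> R[i]) (lam : R[i]) : Prop :=
  exists v : R -> R[i],
    [/\ W11_eigenfunction L lam v,
        ~ ae_equal v (fun=> 0),
        (forall w, W11_eigenfunction L lam w ->
           exists c : R[i], ae_equal w (fun x => c * v x)),
        ~ W11_range L lam v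
      & (forall f, W11 f -> exists c : R[i],
           W11_range L lam (fun x => f x - c * v x))].

Definition objective (R : realType) (T : R -> R)
    (phi : (R -> R[i]) -> R[i]) (v : R -> R[i]) (Tdot : R -> R) : R[i] :=
  phi (dot_transfer T Tdot v).

(* The order on R[i] is z <= w iff w - z is a nonnegative real. In particular,
   since J vanishes at 0, a maximiser can only exist if J is real-valued on the
   unit ball. *)
Definition H4_ball_maximiser (R : realType) (J : (R -> R) -> R[i])
    (f : R -> R) : Prop :=
  [/\ H4 f, H4_norm f <= 1
    & forall g : R -> R, H4 g -> H4_norm g <= 1 -> J g <= J f].

(* Main.v *)
Require Import Defs.
From HB Require Import structures.
From mathcomp Require Import all_boot all_order all_algebra.
From mathcomp Require Import all_classical all_reals all_analysis.
From mathcomp Require Import complex.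
From mathcomp Require Import measurable_realfun zify ring lra.

Set Implicit Arguments.
Unset Strict Implicit.
Unset Printing Implicit Defensive.

Import Order.TTheory GRing.Theory Num.Theory.
Import numFieldNormedType.Exports.

Local Open Scope classical_set_scope.
Local Open Scope ring_scope.
Local Open Scope complex_scope.

(** The functional J sends Tdot to - phi0 (L0 F) with F = (v0 Tdot / T0')'.  The
    proof shows that J is a bounded real linear functional on the Hilbert space
    H^4 and then maximises it over the unit ball.

    Boundedness.  Functions of W^{3,1}, in particular v0 and every element of
    H^4, have C^2 representatives whose derivatives up to order 2 are bounded by
    the L^1 norms of the weak derivatives (C2_representative).  As T0' is C^3,
    F is then C^1 with norm at most a constant times the H^4 norm of Tdot.  On
    each fundamental domain L0 is a finite sum over inverse branches of T0, which
    are C^1 with derivative 1 / T0', so it is bounded on C^1 (real_transfer_C1),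
    and C^1 embeds into W^{1,1}, where phi0 is bounded.  Linearity follows from
    the formula J = - phi0 (L0 F), since F is linear in the C^2 representative.

    Reality.  Since L0 commutes with complex conjugation and lambda0 is real,
    the functional F |-> conj (phi0 (conj F)) is again an eigenfunctional.  Both
    vanish on the range of L0 - lambda0, which a line complements because the
    eigenvalue is simple, so they are proportional, and the value at 1 makes them
    equal (eigenform_real).  In the same way conj v0 is a multiple of v0, and the
    value of phi0 shows that v0 is real (eigenfunction_real).

    Maximisation.  H^4 is complete (H4_complete), because each of the five
    derivatives converges in L^2 and the defining identity of weak derivatives
    passes to the limit.  For a nonzero bounded functional on a Hilbert space,
    the parallelogram identity forces two almost optimal points of the ball to
    be close to each other: maximising sequences converge, and maximisers
    coincide (hilbert_ball_maximiser).

    The theory of weak derivatives rests on one fact, that a function orthogonal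
    to all smooth periodic functions vanishes almost everywhere
    (fundamental_lemma). *)

(** * Periodic functions and null sets *)

Definition frac (R : realType) (x : R) : R := x - (Num.floor x)%:~R.

Definition integrable01 (R : realType) (f : R -> R) : Prop :=
  (@lebesgue_measure R).-integrable `[0, 1] (EFin \o f).

Definition int01 (R : realType) (f : R -> R) : R :=
  \int[@lebesgue_measure R]_(x in `[0, 1]) f x.

Section periodic.
Variable R : realType.
Local Notation I01 := (`[0, 1]%classic : set R).
Local Notation mu := (@lebesgue_measure R).
Implicit Types (f g h T : R -> R) (x y c : R).

Lemma periodic_int (V : zmodType) (f : R -> V) : periodic f 1 -> forall x (m : int), f (x + m%:~R) = f x.
Proof.
move=> pf x; case=> n.
  have := @periodicn _ _ _ _ pf n x; by rewrite pmulrn.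
rewrite NegzE mulrNz -pmulrn.
have := @periodicn _ _ _ _ pf n.+1 (x - n.+1%:R).
by rewrite addrNK => ->.
Qed.

Lemma frac_ge0 x : 0 <= frac x.
Proof. by rewrite /frac subr_ge0 Num.Theory.floor_le. Qed.

Lemma frac_lt1 x : frac x < 1.
Proof.
by rewrite /frac ltrBlDl addrC; have := Num.Theory.floorD1_gt x; rewrite intrD addrC.
Qed.

Lemma frac_in x : frac x \in `[0, 1].
Proof. by rewrite in_itv /= frac_ge0 ltW// frac_lt1. Qed.

Lemma fracD1 : periodic (@frac R) 1.
Proof.
move=> x; rewrite /frac floorDrz ?rpred1 ?Num.Theory.int_num1 //.
by rewrite floor1 intrD [in LHS]opprD addrACA subrr addr0.
Qed.

Lemma periodic_frac (V : zmodType) (f : R -> V) : periodic f 1 -> forall x, f (frac x) = f x.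
Proof. by move=> pf x; rewrite /frac -mulrNz periodic_int. Qed.

Lemma measurable_frac : measurable_fun setT (@frac R).
Proof.
apply: measurable_funB => //; apply: nondecreasing_measurable => // x y xy.
by rewrite ler_int le_floor.
Qed.

Lemma periodic_measurable f : periodic f 1 ->
  measurable_fun I01 f -> measurable_fun setT f.
Proof.
move=> pf; rewrite -[X in measurable_fun X _](setTI I01) => mf.
have -> : f = (f \_ I01) \o (@frac R).
  apply/funext => x /=; rewrite patchE mem_set ?periodic_frac//.
  exact: frac_in.
apply: measurableT_comp; last exact: measurable_frac.
by apply/measurable_restrict.
Qed.

(** Centring the covering interval at the image of the right endpoint avoids any
    discussion of monotonicity and only costs a factor 2. *)
Lemma lipschitz_ocitv T K : 0 < K ->
  (forall x y, `|T x - T y| <= K * `|x - y|) ->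
  forall A : set R, ocitv A -> exists G : set R, [/\ measurable G,
    T @` A `<=` G & (mu G <= (K *+ 2)%:E * wlength idfun A)%E].
Proof.
move=> K0 lT _ /ocitvP[->|[[a b] /= ab ->]].
  exists set0; split => //; first by rewrite image_set0.
  by rewrite measure0 wlength0 mule0.
exists `[T b - K * (b - a), T b + K * (b - a)]%classic; split => //.
  move=> _ /= [x + <-]; rewrite !in_itv /= => /andP[ax xb].
  rewrite -ler_distlC distrC; apply: le_trans (lT _ _) _.
  by rewrite ler_pM2l// ler0_norm; lra.
rewrite lebesgue_measure_itv /= wlength_itv /= !lte_fin ab -!EFinB -EFinM.
by case: ifP => _; rewrite lee_fin ?mulr_ge0; lra.
Qed.

(** Cover the null set by half-open intervals of small total length and replace
    each of them by an interval containing its image. *)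
Lemma lipschitz_negligible T K (N : set R) :
  (forall x y, `|T x - T y| <= K * `|x - y|) ->
  mu.-negligible N -> mu.-negligible (T @` N).
Proof.
move=> lT0 /negligible_outer_measure N0; apply/negligible_outer_measure.
(* the constant is made positive, for K is arbitrary *)
pose K' := `|K| + 1.
have K'0 : 0 < K' by rewrite /K' ltr_pwDr.
have lT x y : `|T x - T y| <= K' * `|x - y|.
  apply: le_trans (lT0 x y) _; apply: ler_wpM2r => //.
  by rewrite /K' (le_trans (ler_norm K))// lerDl.
apply/eqP; rewrite eq_le outer_measure_ge0 andbT.
apply/lee_addgt0Pr => e e0; rewrite add0e.
have e'0 : 0 < e / (K' *+ 2) by rewrite divr_gt0// pmulrn_rgt0.
have [|_ [F [mF NF] <-]] := lb_ereal_inf_adherent e'0 (_ : mu_ext (wlength idfun) N \is a fin_num).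
  by rewrite N0.
rewrite -[ereal_inf _]/(mu_ext (wlength idfun) N) N0 add0e => /ltW sF.
have [G GP] := choice (fun k => lipschitz_ocitv K'0 lT (mF k)).
have GG : T @` N `<=` \bigcup_k G k.
  move=> _ [x Nx <-]; have [k _ Fkx] := NF _ Nx.
  by exists k => //; have [_ + _] := GP k; apply; exists x.
apply: le_trans (le_outer_measure (mu_ext (wlength idfun)) _ _ GG) _.
have mG k : measurable (G k) by have [] := GP k.
apply: (@le_trans _ _ (\sum_(k <oo) mu (G k))%E).
  exact: (outer_measure_sigma_subadditive (mu_ext (wlength idfun)) G).
apply: (@le_trans _ _ (\sum_(k <oo) ((K' *+ 2)%:E * wlength idfun (F k)))%E).
  by apply: lee_nneseries => // k _; have [] := GP k.
rewrite nneseriesZl; last by move=> k _; exact: wlength_ge0.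
apply: (@le_trans _ _ ((K' *+ 2)%:E * (e / (K' *+ 2))%:E)%E).
  by apply: lee_wpmul2l => //; rewrite lee_fin pmulrn_rge0// ltW.
by rewrite -EFinM mulrCA divff ?mulr1// gt_eqF// pmulrn_rgt0.
Qed.

Lemma ae_equalP (V : Type) (f g : R -> V) :
  ae_equal f g <-> mu.-negligible [set x | f x <> g x].
Proof.
rewrite /ae_equal /ae_eq /almost_everywhere /=; split; apply: negligibleS => x /=.
  by move=> fg H; apply: fg; apply: H.
by move=> H fg; apply: H.
Qed.

Lemma ae_equal_refl (V : Type) (f : R -> V) : ae_equal f f.
Proof. exact: ae_eq_refl. Qed.

Lemma ae_equal_sym (V : Type) (f g : R -> V) : ae_equal f g -> ae_equal g f.
Proof. exact: ae_eq_sym. Qed.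

Lemma ae_equal_trans (V : Type) (f g h : R -> V) :
  ae_equal f g -> ae_equal g h -> ae_equal f h.
Proof. exact: ae_eq_trans. Qed.

Lemma ae_equal_in (V : Type) (f g : R -> V) (D : set R) :
  ae_equal f g -> f = g %[ae mu in D].
Proof.
by move=> /ae_equalP; apply: negligibleS => x /= ne fg; apply: ne => _.
Qed.

(** With ae_lift2, the way in which pointwise identities are transported to almost
    everywhere identities below. *)
Lemma ae_lift (U V : Type) (f1 f2 : R -> U) (A B : R -> V) : ae_equal f1 f2 ->
  (forall x, f1 x = f2 x -> A x = B x) -> ae_equal A B.
Proof.
move=> /ae_equalP n1 H; apply/ae_equalP; apply: negligibleS n1 => x /= ne E.
by apply: ne; exact: H.
Qed.

Lemma ae_lift2 (U1 U2 V : Type) (f1 f2 : R -> U1) (g1 g2 : R -> U2) (A B : R -> V) :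
  ae_equal f1 f2 -> ae_equal g1 g2 ->
  (forall x, f1 x = f2 x -> g1 x = g2 x -> A x = B x) -> ae_equal A B.
Proof.
move=> /ae_equalP n1 /ae_equalP n2 H; apply/ae_equalP.
apply: negligibleS (negligibleU n1 n2) => x /= ne.
have [E1|] := pselect (f1 x = f2 x); last by left.
by right => E2; apply: ne; exact: H.
Qed.

(** The exceptional set of the composites is contained in the image by T of the
    exceptional set of f and g. *)
Lemma ae_equal_comp (V : Type) (f g : R -> V) (S T : R -> R) K :
  cancel S T -> (forall x y, `|T x - T y| <= K * `|x - y|) ->
  ae_equal f g -> ae_equal (f \o S) (g \o S).
Proof.
move=> ST lT /ae_equalP fg; apply/ae_equalP.
apply: negligibleS (lipschitz_negligible lT fg) => x /= ne.
by exists (S x) => //; rewrite ST.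
Qed.

(** The line is a countable union of translates of [0, 1] by integers. *)
Lemma periodic_ae (V : zmodType) (f g : R -> V) : periodic f 1 -> periodic g 1 ->
  f = g %[ae mu in I01] -> ae_equal f g.
Proof.
move=> pf pg fg; apply/ae_equalP.
pose N := [set x : R | x \in `[0, 1] /\ f x <> g x].
have N0 : mu.-negligible N.
  by move: fg; apply: negligibleS => x /= [x01 ne] H; apply: ne; apply: H.
have H (s : R) k : mu.-negligible ((fun x : R => x + s * k%:R) @` N).
  apply: (@lipschitz_negligible _ 1) N0 => x y.
  by rewrite mul1r opprD addrACA subrr addr0.
apply: negligibleS (negligibleU (negligible_bigcup (H 1)) (negligible_bigcup (H (-1)))) => x /= fgx.
have pfi (V' : zmodType) (h : R -> V') : periodic h 1 -> forall k, h (x + k%:R) = h x.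
  by move=> ph k; apply: periodicn.
have Nx : N (frac x).
  split; first exact: frac_in.
  move: fgx; rewrite -{1 2}[x](subrK (Num.floor x)%:~R) -/(frac x).
  case: (Num.floor x) => n; first by rewrite -[(Posz n)%:~R]/(n%:R) !periodicn.
  rewrite NegzE mulrNz -pmulrn -[f _](@periodicn _ _ f _ pf n.+1) -[g _](@periodicn _ _ g _ pg n.+1).
  by rewrite !subrK.
have xE : x = frac x + (Num.floor x)%:~R by rewrite /frac subrK.
case nE : (Num.floor x) => [n|n].
  by left; exists n => //; exists (frac x) => //; rewrite {2}xE nE mul1r.
by right; exists n.+1 => //; exists (frac x) => //; rewrite {2}xE nE NegzE mulrNz mulN1r.
Qed.

End periodic.

(** * Integrals over one period *)

Section integrals.
Variable R : realType.
Local Notation I01 := (`[0, 1]%classic : set R).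
Local Notation mu := (@lebesgue_measure R).
Implicit Types (f g h : R -> R) (x y c : R).

Lemma measurable_I01 : measurable I01. Proof. by []. Qed.
Hint Resolve measurable_I01 : core.

Lemma mu_I01 : mu I01 = 1%E.
Proof. by rewrite lebesgue_measure_itv /= lte_fin ltr01 -EFinB subr0. Qed.

Lemma integrable01_meas f : integrable01 f -> measurable_fun I01 f.
Proof. by move=> /integrableP[/measurable_EFinP]. Qed.

Lemma integrable01_le f g : measurable_fun I01 f ->
  (forall x, x \in `[0, 1] -> `|f x| <= g x) -> integrable01 g -> integrable01 f.
Proof.
move=> mf fg; apply: le_integrable => //; first exact/measurable_EFinP.
move=> x xI /=; rewrite lee_fin; apply: le_trans (fg x xI) _; exact: ler_norm.
Qed.

Lemma integrable01D f g : integrable01 f -> integrable01 g ->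
  integrable01 (fun x => f x + g x).
Proof. by move=> f1 g1; exact: (@integrableD _ _ _ mu I01 _ _ _ f1 g1). Qed.

Lemma integrable01Z c f : integrable01 f -> integrable01 (fun x => c * f x).
Proof. by move=> f1; exact: (@integrableZl _ _ _ mu I01 _ c _ f1). Qed.

Lemma integrable01N f : integrable01 f -> integrable01 (fun x => - f x).
Proof. by move=> /(integrable01Z (-1)); under eq_fun do rewrite mulN1r. Qed.

Lemma integrable01B f g : integrable01 f -> integrable01 g ->
  integrable01 (fun x => f x - g x).
Proof. by move=> f1 g1; apply: integrable01D => //; exact: integrable01N. Qed.

Lemma integrable01_norm f : integrable01 f -> integrable01 (fun x => `|f x|).
Proof.
move=> f1; have mf := integrable01_meas f1.
exact: (@integrable_norm _ _ _ mu I01 _ f1).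
Qed.

Lemma continuous_integrable01 f : continuous f -> integrable01 f.
Proof.
move=> cf; apply: continuous_compact_integrable; first exact: segment_compact.
exact: continuous_subspaceT.
Qed.

Lemma continuous_meas f (D : set R) : continuous f -> measurable_fun D f.
Proof. by move=> cf; apply: measurable_funTS; exact: continuous_measurable_fun. Qed.

Lemma integrable01_cst c : integrable01 (fun=> c).
Proof. by apply: continuous_integrable01 => x; exact: cvg_cst. Qed.

Lemma continuous_bounded01 f : continuous f ->
  exists M, 0 <= M /\ forall x, x \in `[0, 1] -> `|f x| <= M.
Proof.
move=> cf; have /compact_bounded [M [_ HM]] :=
  continuous_compact (continuous_subspaceT cf) (@segment_compact R 0 1).
exists (`|M| + 1); split; first by rewrite addr_ge0.
move=> x xI; apply: (HM (`|M| + 1)); last by exists x.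
by apply: le_lt_trans (ler_norm M) _; rewrite ltrDl.
Qed.

Lemma integrable01M f h M : integrable01 f -> measurable_fun I01 h ->
  (forall x, x \in `[0, 1] -> `|h x| <= M) -> integrable01 (fun x => f x * h x).
Proof.
move=> f1 mh hM; have mf := integrable01_meas f1.
apply: (@integrable01_le _ (fun x => M * `|f x|)).
- exact: measurable_funM.
- move=> x xI; rewrite normrM mulrC; apply: ler_wpM2r => //; exact: hM.
- by apply: integrable01Z; exact: integrable01_norm.
Qed.

Lemma integrable01Mc f h : integrable01 f -> continuous h ->
  integrable01 (fun x => f x * h x).
Proof.
move=> f1 ch; have [M [_ hM]] := continuous_bounded01 ch.
by apply: integrable01M hM => //; exact: continuous_meas.
Qed.

Lemma int01D f g : integrable01 f -> integrable01 g ->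
  int01 (fun x => f x + g x) = int01 f + int01 g.
Proof. by move=> f1 g1; exact: RintegralD. Qed.

Lemma int01B f g : integrable01 f -> integrable01 g ->
  int01 (fun x => f x - g x) = int01 f - int01 g.
Proof. by move=> f1 g1; exact: RintegralB. Qed.

Lemma int01Z c f : integrable01 f -> int01 (fun x => c * f x) = c * int01 f.
Proof. by move=> f1; exact: RintegralZl. Qed.

Lemma int01_cst c : int01 (fun=> c) = c.
Proof. by have := mu_I01; rewrite /int01 Rintegral_cst//= => ->; rewrite mulr1. Qed.

Lemma int01_ge0 f : (forall x, x \in `[0, 1] -> 0 <= f x) -> 0 <= int01 f.
Proof. by move=> f0; apply: Rintegral_ge0. Qed.

Lemma int01_le f g : integrable01 f -> integrable01 g ->
  (forall x, x \in `[0, 1] -> f x <= g x) -> int01 f <= int01 g.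
Proof. by move=> f1 g1 fg; apply: le_Rintegral. Qed.

Lemma int01_norm f : integrable01 f -> `|int01 f| <= int01 (fun x => `|f x|).
Proof. by move=> f1; exact: le_normr_Rintegral. Qed.

Lemma eq_int01 f g : (forall x, x \in `[0, 1] -> f x = g x) -> int01 f = int01 g.
Proof. by move=> fg; apply: eq_Rintegral => x /set_mem; exact: fg. Qed.

Lemma ae_int01 f g : measurable_fun I01 f -> measurable_fun I01 g ->
  ae_equal f g -> int01 f = int01 g.
Proof.
move=> mf mg fg; rewrite /int01 /Rintegral; congr fine.
apply: ae_eq_integral => //; try exact/measurable_EFinP.
by apply: (@ae_eq_comp _ _ _ mu I01 _ _ EFin); exact: ae_equal_in.
Qed.

Lemma ae_integrable01 f g : measurable_fun I01 g ->
  ae_equal f g -> integrable01 f -> integrable01 g.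
Proof.
move=> mg fg f1; have mf := integrable01_meas f1.
apply/integrableP; split; first exact/measurable_EFinP.
move: f1 => /integrableP[_]; congr (_ < _)%E.
apply: ae_eq_integral => //; try by do 2 apply: measurableT_comp => //.
by apply: (@ae_eq_comp _ _ _ mu I01 _ _ (fun y : R => `|y%:E|%E)); exact: ae_equal_in.
Qed.

Lemma int01_eq0 f : integrable01 f -> (forall x, 0 <= f x) -> int01 f = 0 ->
  f = (fun=> 0) %[ae mu in I01].
Proof.
move=> f1 f0 If; have mf := integrable01_meas f1.
have /ae_eq_integral_abs : (\int[mu]_(x in I01) `|(f x)%:E| = 0)%E.
  under eq_integral do rewrite gee0_abs ?lee_fin//.
  rewrite -[LHS]fineK ?[fine _]If//.
  exact: integrable_fin_num.
move=> /(_ measurable_I01) H.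
have {}H : ae_eq mu I01 (EFin \o f) (cst 0%E) by apply: H; exact/measurable_EFinP.
by move: H; apply: filterS => x /= H /H [].
Qed.

(** This is the Cauchy-Schwarz inequality against 1, obtained by integrating
    (|f| - m)^2 with m the mean of |f|. *)
Lemma sqr_int01_norm f : integrable01 f -> integrable01 (fun x => f x ^+ 2) ->
  int01 (fun x => `|f x|) ^+ 2 <= int01 (fun x => f x ^+ 2).
Proof.
move=> f1 f2; set m := int01 (fun x => `|f x|).
have n1 := integrable01_norm f1.
have : 0 <= int01 (fun x => f x ^+ 2 + (m ^+ 2 - (m *+ 2) * `|f x|)).
  apply: int01_ge0 => x _; rewrite -(@real_normK _ (f x)) ?num_real//.
  suff -> : `|f x| ^+ 2 + (m ^+ 2 - m *+ 2 * `|f x|) = (`|f x| - m) ^+ 2 by apply: sqr_ge0.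
  by rewrite sqrrB mulr2n; ring.
rewrite int01D// ?int01B// ?int01_cst ?int01Z//.
- by rewrite -/m; lra.
- exact: integrable01_cst.
- exact: integrable01Z.
- by apply: integrable01B; [exact: integrable01_cst|exact: integrable01Z].
Qed.

Lemma sqr_int01_cauchy f g : measurable_fun I01 f -> measurable_fun I01 g ->
  integrable01 (fun x => f x ^+ 2) -> integrable01 (fun x => g x ^+ 2) ->
  integrable01 (fun x => f x * g x).
Proof.
move=> mf mg f2 g2.
apply: (@integrable01_le _ (fun x => f x ^+ 2 + g x ^+ 2)).
- exact: measurable_funM.
- move=> x _; rewrite normrM -(@real_normK _ (f x)) ?num_real// -(@real_normK _ (g x)) ?num_real//.
  have := sqr_ge0 (`|f x| - `|g x|); have := sqr_ge0 (`|f x| + `|g x|).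
  by move: (`|f x|) (`|g x|) => a b; nra.
- exact: integrable01D.
Qed.

Lemma sqr_integrable01 f : measurable_fun I01 f ->
  integrable01 (fun x => f x ^+ 2) -> integrable01 f.
Proof.
move=> mf f2; apply: (@integrable01_le _ (fun x => 1 + f x ^+ 2)) => //.
  move=> x _; rewrite -(@real_normK _ (f x)) ?num_real//.
  by have := normr_ge0 (f x); move: `|f x| => a; nra.
by apply: integrable01D => //; exact: integrable01_cst.
Qed.

(** * Lebesgue spaces on the circle *)

Lemma integrable01_mkcond f :
  integrable01 f <-> mu.-integrable setT (EFin \o (f \_ I01)).
Proof. by rewrite /integrable01 -restrict_EFin; exact: integrable_mkcond. Qed.

Lemma Lp1P f : Lp_circle 1%E f <-> periodic f 1 /\ integrable01 f.
Proof.
rewrite /Lp_circle; split=> -[pf]; split=> //.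
  by move: b => /Lfun1_integrable H; exact/integrable01_mkcond.
by apply/Lfun1_integrable; exact/integrable01_mkcond.
Qed.

Lemma Lp_meas p f : Lp_circle p f -> measurable_fun I01 f.
Proof.
case=> pf; rewrite inE => /andP[]; rewrite inE /= => mf _.
by rewrite -[X in measurable_fun X _](setTI I01); apply/measurable_restrict.
Qed.

Lemma Lp_measT p f : Lp_circle p f -> measurable_fun setT f.
Proof. by move=> Lf; apply: periodic_measurable (Lp_meas Lf); case: Lf. Qed.

Lemma Lp2P f : Lp_circle 2%:E f <->
  [/\ periodic f 1, measurable_fun I01 f & integrable01 (fun x => f x ^+ 2)].
Proof.
split=> [Lf|[pf mf f2]].
  split; [by case: Lf|exact: (Lp_meas Lf)|].
  have [_ /Lfun2_integrable_sqr] := Lf.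
  rewrite (_ : (fun x => (f \_ `[0, 1]) x ^+ 2) = (fun x => f x ^+ 2) \_ I01).
    by move=> H; exact/integrable01_mkcond.
  by apply/funext => x; rewrite !patchE; case: ifP => // _; rewrite expr0n.
split=> //; rewrite inE; apply/andP; split; rewrite inE /=.
  by apply/measurable_restrict => //; rewrite setTI.
rewrite /finite_norm unlock /Lnorm poweR_lty//.
move: f2 => /integrable01_mkcond /integrableP[_]; apply: le_lt_trans.
rewrite le_eqVlt; apply/orP; left; apply/eqP; apply: eq_integral => x _ /=.
rewrite !patchE /=; case: ifP => _ /=.
  by rewrite powR_mulrn// normrX.
by rewrite normr0 powR0.
Qed.

Lemma Lp2_Lp1 f : Lp_circle 2%:E f -> Lp_circle 1%E f.
Proof.
by move=> /Lp2P[pf mf f2]; apply/Lp1P; split => //; exact: sqr_integrable01.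
Qed.

Lemma Lp1_ae f g : periodic g 1 -> measurable_fun setT g -> ae_equal f g ->
  Lp_circle 1%E f -> Lp_circle 1%E g.
Proof.
move=> pg mg fg /Lp1P[pf f1]; apply/Lp1P; split => //.
by apply: ae_integrable01 fg f1; exact: measurable_funTS.
Qed.

Lemma Lp1_lin c f g : Lp_circle 1%E f -> Lp_circle 1%E g ->
  Lp_circle 1%E (fun x => c * f x + g x).
Proof.
move=> /Lp1P[pf f1] /Lp1P[pg g1]; apply/Lp1P; split.
  by move=> x; rewrite pf pg.
by apply: integrable01D => //; exact: integrable01Z.
Qed.

Lemma Lp2_lin c f g : Lp_circle 2%:E f -> Lp_circle 2%:E g ->
  Lp_circle 2%:E (fun x => c * f x + g x).
Proof.
move=> /Lp2P[pf mf f1] /Lp2P[pg mg g1]; apply/Lp2P; split.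
- by move=> x; rewrite pf pg.
- by apply: measurable_funD => //; exact: measurable_funM.
rewrite (_ : (fun x => _) = fun x => c ^+ 2 * f x ^+ 2 + ((c *+ 2) * (f x * g x) + g x ^+ 2)).
  apply: integrable01D; first exact: integrable01Z.
  by apply: integrable01D => //; apply: integrable01Z; exact: sqr_int01_cauchy.
by apply/funext => x; rewrite mulr2n; ring.
Qed.

Lemma continuous_Lp1 f : continuous f -> periodic f 1 -> Lp_circle 1%E f.
Proof. by move=> cf pf; apply/Lp1P; split => //; exact: continuous_integrable01. Qed.

Lemma periodic_bounded f : periodic f 1 -> continuous f ->
  exists M, 0 <= M /\ forall x, `|f x| <= M.
Proof.
move=> pf cf; have [M [M0 fM]] := continuous_bounded01 cf.
by exists M; split => // x; rewrite -(periodic_frac pf x); apply: fM; exact: frac_in.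
Qed.

End integrals.
(** * Differentiation on the line *)

Definition has_deriv (R : realType) (f g : R -> R) : Prop :=
  forall x : R, is_derive x (1 : R) f (g x).

Section derivatives.
Variable R : realType.
Implicit Types (f g h : R -> R) (x y c : R).

Lemma has_deriv_derivable f g x : has_deriv f g -> derivable f x 1.
Proof. by move=> fg; have [] := fg x. Qed.

Lemma has_derivE f g : has_deriv f g -> (derive1 f) = g.
Proof. by move=> fg; apply/funext => x; rewrite derive1E; have [] := fg x. Qed.

Lemma has_deriv_continuous f g : has_deriv f g -> continuous f.
Proof.
move=> fg x; apply/differentiable_continuous/derivable1_diffP.
exact: has_deriv_derivable fg.
Qed.

Lemma has_derivD f g f' g' : has_deriv f f' -> has_deriv g g' ->
  has_deriv (fun x => f x + g x) (fun x => f' x + g' x).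
Proof. by move=> df dg x; apply: (is_deriveD (df x) (dg x)). Qed.

Lemma has_derivN f f' : has_deriv f f' -> has_deriv (fun x => - f x) (fun x => - f' x).
Proof. by move=> df x; apply: (is_deriveN (df x)). Qed.

Lemma has_derivB f g f' g' : has_deriv f f' -> has_deriv g g' ->
  has_deriv (fun x => f x - g x) (fun x => f' x - g' x).
Proof. by move=> df dg x; apply: (is_deriveB (df x) (dg x)). Qed.

Lemma has_derivM f g f' g' : has_deriv f f' -> has_deriv g g' ->
  has_deriv (fun x => f x * g x) (fun x => f' x * g x + f x * g' x).
Proof.
move=> df dg x; apply: is_derive_eq (is_deriveM (df x) (dg x)) _.
by rewrite /GRing.scale /= addrC [g x * _]mulrC.
Qed.

Lemma has_deriv_cst c : has_deriv (fun=> c) (fun=> 0).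
Proof. by move=> x; apply: is_derive_cst. Qed.

Lemma has_derivZ c f f' : has_deriv f f' ->
  has_deriv (fun x => c * f x) (fun x => c * f' x).
Proof.
move=> df x; apply: is_derive_eq (has_derivM (has_deriv_cst c) df x) _.
by rewrite mul0r add0r.
Qed.

Lemma has_derivV f f' : (forall x, f x != 0) -> has_deriv f f' ->
  has_deriv (fun x => (f x)^-1) (fun x => - f' x / f x ^+ 2).
Proof.
move=> f0 df x; apply: is_derive_eq (is_deriveV (f0 x) (df x)) _.
by rewrite /GRing.scale /= mulrC mulrN mulNr.
Qed.

Lemma has_deriv_comp f g f' g' : has_deriv f f' -> has_deriv g g' ->
  has_deriv (fun x => f (g x)) (fun x => f' (g x) * g' x).
Proof. by move=> df dg x; apply: (@is_derive1_comp _ f g _ _ _ (df (g x)) (dg x)). Qed.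

Lemma has_deriv_id : has_deriv (fun x => x) (fun=> 1).
Proof. by move=> x; apply: is_derive_id. Qed.

Lemma has_deriv_shift f f' c : has_deriv f f' ->
  has_deriv (fun x => f (x + c)) (fun x => f' (x + c)).
Proof.
move=> df x.
have := has_deriv_comp df (has_derivD has_deriv_id (has_deriv_cst c)) x.
by rewrite addr0 mulr1.
Qed.

Lemma has_deriv_periodic f f' : has_deriv f f' -> periodic f 1 -> periodic f' 1.
Proof.
move=> df pf x; have := has_deriv_shift 1 df => /has_derivE.
rewrite (_ : (fun x => f (x + 1)) = f); last by apply/funext => y; exact: pf.
by rewrite (has_derivE df) => /(congr1 (fun h : R -> R => h x)).
Qed.

Lemma has_deriv_eq f g g' : has_deriv f g -> g =1 g' -> has_deriv f g'.
Proof. by move=> df gg x; rewrite -gg. Qed.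

Lemma has_deriv0_cst f : has_deriv f (fun=> 0) -> forall x y, f x = f y.
Proof. by move=> df x y; apply: is_derive_0_is_cst. Qed.

Lemma derivable_has_deriv f : (forall x, derivable f x 1) -> has_deriv f (derive1 f).
Proof. by move=> df x; rewrite derive1E; exact: derivableP. Qed.

(** * Smooth periodic functions *)

(** Smoothness by coinduction: it suffices to find a class of functions that
    contains f and is stable under differentiation. *)
Lemma smooth_coind (P : (R -> R) -> Prop) :
  (forall f, P f -> exists g, P g /\ has_deriv f g) -> forall f, P f -> is_smooth f.
Proof.
move=> HP f Pf.
suff H j : P ((derive1n j f)).
  by move=> j x; have [g [_ /has_deriv_derivable]] := HP _ (H j); exact.
elim: j => [//|j IH]; rewrite derive1nS.
by have [g [Pg /has_derivE ->]] := HP _ IH.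
Qed.

Lemma smooth_has_deriv f : is_smooth f -> has_deriv f (derive1 f).
Proof. by move=> sf; apply: derivable_has_deriv => x; exact: (sf 0%N x). Qed.

Lemma smooth_derive f : is_smooth f -> is_smooth (derive1 f).
Proof. by move=> sf j x; have := sf j.+1 x; rewrite derive1Sn. Qed.

Lemma smooth_derive1n f n : is_smooth f -> is_smooth (derive1n n f).
Proof.
by move=> sf; elim: n => [//|n IH]; rewrite derive1nS; exact: smooth_derive.
Qed.

Lemma smooth_primitive f g : has_deriv f g -> is_smooth g -> is_smooth f.
Proof.
move=> df sg [x|j x]; first exact: has_deriv_derivable df.
by rewrite derive1Sn (has_derivE df); exact: sg.
Qed.

Lemma smooth_addc f c : is_smooth f -> is_smooth (fun x => f x + c).
Proof.
move=> sf; apply: (@smooth_primitive _ (derive1 f)); last exact: smooth_derive.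
apply: has_deriv_eq (has_derivD (smooth_has_deriv sf) (has_deriv_cst c)) _ => x.
by rewrite addr0.
Qed.

Lemma smooth_continuous f : is_smooth f -> continuous f.
Proof. by move=> /smooth_has_deriv /has_deriv_continuous. Qed.

Lemma smooth_cst c : is_smooth (fun=> c : R).
Proof.
apply: (smooth_coind (P := fun f => exists c, f = fun=> c)); last by exists c.
by move=> _ [d ->]; exists (fun=> 0); split; [exists 0|exact: has_deriv_cst].
Qed.

Lemma periodic_derive f : is_smooth f -> periodic f 1 -> periodic (derive1 f) 1.
Proof. by move=> /smooth_has_deriv; exact: has_deriv_periodic. Qed.

(** A smooth 1-periodic function, positive exactly on the interior of
    [0, b] modulo 1, for 0 < b < 1. *)
Definition arc b x : R := sin (pi * x) * sin (pi * (b - x)).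

(** The logistic function of n times arc b: away from 0 and b modulo 1 these
    functions converge, as n grows, to the indicator function of [0, b]. *)
Definition bump b n x : R := (1 + expR (- arc b x) ^+ n)^-1.

(** The algebra generated by bump b n and by the trigonometric functions of period
    2 is stable under differentiation because the logistic function s satisfies
    s' = s (1 - s). *)
Inductive bump_algebra b n : (R -> R) -> Prop :=
| bump_cst c : bump_algebra b n (fun=> c)
| bump_sin : bump_algebra b n (fun x => sin (pi * x))
| bump_cos : bump_algebra b n (fun x => cos (pi * x))
| bump_bump : bump_algebra b n (bump b n)
| bump_add f g : bump_algebra b n f -> bump_algebra b n g ->
    bump_algebra b n (fun x => f x + g x)
| bump_mul f g : bump_algebra b n f -> bump_algebra b n g ->
    bump_algebra b n (fun x => f x * g x).

Lemma has_deriv_mulpi : has_deriv (fun x : R => pi * x) (fun=> pi).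
Proof.
by apply: has_deriv_eq (has_derivZ pi has_deriv_id) _ => x; rewrite mulr1.
Qed.

Lemma has_deriv_sinpi : has_deriv (fun x : R => sin (pi * x)) (fun x => cos (pi * x) * pi).
Proof. by apply: (has_deriv_comp _ has_deriv_mulpi) => x; exact: is_derive_sin. Qed.

Lemma has_deriv_cospi : has_deriv (fun x : R => cos (pi * x)) (fun x => (- sin (pi * x)) * pi).
Proof. by apply: (has_deriv_comp (f' := fun x : R => - sin x) _ has_deriv_mulpi) => x; exact: is_derive_cos. Qed.

Lemma arcE b x : arc b x = sin (pi * x) *
   (sin (pi * b) * cos (pi * x) + (- cos (pi * b)) * sin (pi * x)).
Proof. by rewrite /arc mulrBr sinB mulNr. Qed.

Lemma arc_deriv b : exists2 g, (forall n, bump_algebra b n g) & has_deriv (arc b) g.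
Proof.
have -> : arc b = (fun x => sin (pi * x) *
   (sin (pi * b) * cos (pi * x) + (- cos (pi * b)) * sin (pi * x))).
  by apply/funext => x; exact: arcE.
eexists; last first.
  apply: has_derivM; first exact: has_deriv_sinpi.
  apply: has_derivD.
    by apply: has_derivM; [exact: has_deriv_cst|exact: has_deriv_cospi].
  by apply: has_derivM; [exact: has_deriv_cst|exact: has_deriv_sinpi].
move=> n; repeat constructor.
have -> : (fun x : R => - sin (pi * x)) = (fun x => (-1) * sin (pi * x)).
  by apply/funext => x; rewrite mulN1r.
by repeat constructor.
Qed.

Lemma bump_den_gt0 b n x : 0 < 1 + expR (- arc b x) ^+ n.
Proof. by rewrite ltr_wpDr// exprn_ge0// expR_ge0. Qed.

Lemma bump_deriv b n g : has_deriv (arc b) g ->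
  has_deriv (bump b n) (fun x => (n%:R * g x) * (bump b n x * (1 + -1 * bump b n x))).
Proof.
move=> dg.
have dE : has_deriv (fun x => 1 + expR (- arc b x) ^+ n)
    (fun x => - (n%:R * g x) * expR (- arc b x) ^+ n).
  have -> : (fun x => 1 + expR (- arc b x) ^+ n) = (fun x => 1 + expR (n%:R * - arc b x)).
    by apply/funext => x; rewrite expRM_natl.
  have de : has_deriv (@expR R) expR by move=> y; exact: is_derive_expR.
  have := has_derivD (has_deriv_cst 1) (has_deriv_comp de (has_derivZ n%:R (has_derivN dg))).
  move=> /has_deriv_eq; apply => x.
  by rewrite expRM_natl add0r mulrC mulrN.
have ne0 x : 1 + expR (- arc b x) ^+ n != 0 by rewrite gt_eqF// bump_den_gt0.
apply: has_deriv_eq (has_derivV ne0 dE) _ => x.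
rewrite /bump; have := ne0 x; move: (expR _ ^+ _) => E E0.
by field.
Qed.

Lemma bump_smooth b n : is_smooth (bump b n).
Proof.
apply: (@smooth_coind (bump_algebra b n)); last exact: bump_bump.
move=> f; elim => {f}.
- by move=> c; exists (fun=> 0); split; [constructor|exact: has_deriv_cst].
- by eexists; split; last exact: has_deriv_sinpi; repeat constructor.
- eexists; split; last exact: has_deriv_cospi.
  have -> : (fun x : R => - sin (pi * x) * pi) = (fun x => (-1) * sin (pi * x) * pi).
    by apply/funext => x; rewrite mulN1r.
  by repeat constructor.
- have [g ag dg] := arc_deriv b.
  eexists; split; last exact: (bump_deriv n dg).
  by repeat constructor.
- move=> f g _ [f' [af df]] _ [g' [ag dg]].
  by eexists; split; last exact: has_derivD df dg; constructor.
- move=> f g Hf [f' [af df]] Hg [g' [ag dg]].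
  by eexists; split; last exact: has_derivM df dg; repeat constructor.
Qed.

Lemma bump_periodic b n : periodic (bump b n) 1.
Proof.
move=> x; rewrite /bump; suff -> : arc b (x + 1) = arc b x by [].
have -> : arc b (x + 1) = sin (pi * x + pi) * - sin (- (pi * (b - x)) + pi).
  rewrite /arc mulrDr mulr1; congr (_ * _); rewrite -sinN; congr sin; ring.
by rewrite !sinDpi sinN opprK mulrN mulNr opprK.
Qed.

Lemma bump_in b n x : 0 <= bump b n x <= 1.
Proof.
rewrite invr_ge0 ltW ?bump_den_gt0//= invf_le1 ?bump_den_gt0//.
by rewrite lerDl exprn_ge0// expR_ge0.
Qed.

Lemma bump_cvg1 b x : b < 1 -> 0 < x < b -> bump b n x @[n --> \oo] --> (1 : R).
Proof.
move=> b1 /andP[x0 xb].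
have : expR (- arc b x) ^+ n @[n --> \oo] --> (0 : R).
  apply: cvg_expr; rewrite ger0_norm ?expR_ge0// expR_lt1 oppr_lt0 mulr_gt0//.
    by apply: sin_gt0_pi; rewrite mulr_gt0 ?pi_gt0//= gtr_pMr ?pi_gt0// (lt_trans xb).
  apply: sin_gt0_pi; rewrite mulr_gt0 ?pi_gt0 ?subr_gt0//= gtr_pMr ?pi_gt0//; lra.
move=> z0; rewrite -[X in _ --> X](_ : (1 + 0)^-1 = 1); last by rewrite addr0 invr1.
apply: cvgV; first by rewrite addr0 oner_neq0.
by apply: cvgD; [exact: cvg_cst|exact: z0].
Qed.

Lemma bump_cvg0 b x : 0 < b -> b < x < 1 -> bump b n x @[n --> \oo] --> (0 : R).
Proof.
move=> b0 /andP[bx x1].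
set z := expR (arc b x).
have z0 n : z ^+ n @[n --> \oo] --> (0 : R).
  apply: cvg_expr; rewrite ger0_norm ?expR_ge0// expR_lt1.
  rewrite /arc -opprB mulrN sinN mulrN oppr_lt0 mulr_gt0//.
    by apply: sin_gt0_pi; rewrite mulr_gt0 ?pi_gt0 ?(lt_trans b0)//= gtr_pMr ?pi_gt0.
  apply: sin_gt0_pi; rewrite mulr_gt0 ?pi_gt0 ?subr_gt0//= gtr_pMr ?pi_gt0//; lra.
have -> : (fun n => bump b n x) = (fun n => z ^+ n * (1 + z ^+ n)^-1).
  apply/funext => n; rewrite /bump expRN -/z exprVn.
  have : 0 < z ^+ n by rewrite exprn_gt0// expR_gt0.
  move: (z ^+ n) => u u0; field.
  by rewrite !gt_eqF// ?addr_gt0.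
rewrite -[X in _ --> X](mul0r (1 + 0)^-1); apply: cvgM; first exact: z0.
by apply: cvgV; [rewrite addr0 oner_neq0|apply: cvgD; [exact: cvg_cst|exact: z0]].
Qed.

End derivatives.

(** * Weak derivatives on the circle *)

Section weak_derivatives.
Variable R : realType.
Local Notation I01 := (`[0, 1]%classic : set R).
Local Notation mu := (@lebesgue_measure R).
Implicit Types (f g h u : R -> R) (x y b c : R).

Lemma int01_EFin f : integrable01 f -> (\int[mu]_(x in I01) (f x)%:E)%E = (int01 f)%:E.
Proof. by move=> f1; rewrite /int01 /Rintegral fineK//; exact: integrable_fin_num. Qed.

(** The smooth functions bump b n converge boundedly to the indicator function of
    [0, b], except at 0, b and 1. *)
Lemma smooth_orthogonal_interval g b : integrable01 g -> 0 < b < 1 ->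
  (forall h, is_smooth h -> periodic h 1 -> int01 (fun x => g x * h x) = 0) ->
  \int[mu]_(x in `[0, b]) g x = 0.
Proof.
move=> g1 /andP[b0 b1] H.
have mg := integrable01_meas g1.
have gb n : integrable01 (fun x => g x * bump b n x).
  by apply: integrable01Mc => //; exact: smooth_continuous (@bump_smooth _ b n).
have mgb : measurable_fun I01 (g \_ `]-oo, b]).
  apply/(@measurable_restrict _ _ _ _ _ I01) => //.
  by apply: measurable_funS mg => // x [].
have [] := @dominated_convergence _ _ _ mu I01 (@measurable_I01 R)
  (fun n x => (g x * bump b n x)%:E) (EFin \o (g \_ `]-oo, b])) (fun x => `|g x|%:E).
- by move=> n; apply/measurable_EFinP; exact: integrable01_meas.
- exact/measurable_EFinP.
- apply: (@negligibleS _ _ _ mu ([set 0] `|` [set b] `|` [set 1])); last first.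
    by repeat apply: negligibleU; apply/negligibleP => //; exact: lebesgue_measure_set1.
  move=> x /= ne; apply: contrapT => nx; apply: ne.
  have [x0 xb x1] : [/\ x <> 0, x <> b & x <> 1].
    by split=> xE; apply: nx; [left; left|left; right|right].
  rewrite in_itv /= => /andP[x0' x1']; apply: cvg_EFin; first exact: nearW.
  have {}x0' : 0 < x by rewrite lt_neqAle x0' andbT eq_sym; apply/eqP.
  have {}x1' : x < 1 by rewrite lt_neqAle x1' andbT; apply/eqP.
  rewrite patchE; case: ifPn => [/set_mem|/negP xb'] /=.
    rewrite in_itv /= le_eqVlt => /orP[/eqP//|{}xb].
    rewrite -[X in _ --> X]mulr1; apply: cvgM; first exact: cvg_cst.
    by apply: bump_cvg1 => //; rewrite x0'.
  rewrite -[X in _ --> X](mulr0 (g x)); apply: cvgM; first exact: cvg_cst.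
  apply: bump_cvg0 => //; rewrite x1' andbT ltNge; apply/negP => xb''; apply: xb'.
  by apply/mem_set; rewrite /= in_itv.
- exact: integrable01_norm.
- apply: aeW => x n _ /=; rewrite lee_fin normrM ler_piMr//.
  by have /andP[h0 h1] := bump_in b n x; rewrite ger0_norm.
move=> ib _ /=.
under eq_cvg => n.
  rewrite int01_EFin// H; [over|exact: bump_smooth|exact: bump_periodic].
move=> /cvg_lim -/(_ (@ereal_hausdorff R)); rewrite lim_cst; last exact: ereal_hausdorff.
move=> /esym; rewrite (_ : (fun x => _) = EFin \o (g \_ `]-oo, b])) // => E0.
transitivity (\int[mu]_(x in I01 `&` `]-oo, b]) g x).
  congr (Rintegral _ _ _); apply/seteqP; split => x /=; rewrite !in_itv /=.
    by move=> /andP[-> xb]; rewrite xb (le_trans xb)// ltW.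
  by move=> [/andP[-> _] ->].
by rewrite Rintegral_mkcondr /Rintegral; rewrite [X in fine X](_ : _ = 0%E).
Qed.

(** A function orthogonal to every smooth test function has vanishing integral
    on each [0, b], so its indefinite integral is constant; by Lebesgue's
    differentiation theorem it vanishes almost everywhere. *)
Lemma fundamental_lemma g : Lp_circle 1%E g ->
  (forall h, is_smooth h -> periodic h 1 -> int01 (fun x => g x * h x) = 0) ->
  ae_equal g (fun=> 0).
Proof.
move=> /Lp1P[pg g1] H; apply: periodic_ae => //.
pose G := g \_ I01.
have G1 : mu.-integrable setT (EFin \o G) by exact/integrable01_mkcond.
have G1' (D : set R) : measurable D -> mu.-integrable D (EFin \o G).
  by move=> mD; apply: integrableS G1.
have := @FTC1 R G (BLeft 0) (fun y => G1' _ (measurable_itv _)).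
move=> /(_ (integrable_locally (@measurable_I01 R) g1)) /=.
set F := fun x0 : R => Rintegral _ _ _.
have F0 x : 0 < x < 1 -> F x = 0.
  move=> x01; rewrite -(smooth_orthogonal_interval g1 x01 H) /F.
  apply: eq_Rintegral => y /set_mem; rewrite /= in_itv /= => /andP[y0 yx].
  rewrite /G patchE mem_set//= in_itv /= y0 (le_trans yx)//.
  by case/andP: x01 => _ /ltW.
move=> HF.
have H01 : mu.-negligible ([set 0] `|` [set 1] : set R).
  by apply: negligibleU; apply/negligibleP => //; exact: lebesgue_measure_set1.
apply: negligibleS (negligibleU HF H01) => x /= ne.
have [xI gx] : x \in `[0, 1] /\ g x <> 0.
  by apply: contrapT => nn; apply: ne => xI; apply: contrapT => gx; apply: nn.
have [->|/eqP x0] := eqVneq x 0; first by right; left.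
have [->|/eqP x1] := eqVneq x 1; first by right; right.
left => HH; move: xI; rewrite in_itv /= => /andP[x0' x1'].
have {}x0' : 0 < x by rewrite lt_neqAle x0' andbT eq_sym; apply/eqP.
have {}x1' : x < 1 by rewrite lt_neqAle x1' andbT; apply/eqP.
have [|_] := HH; first by rewrite lte_fin.
apply/eqP; rewrite eq_sym /G patchE mem_set//=; last by rewrite in_itv /= !ltW.
rewrite (_ : derive1 F x = 0); first exact/eqP.
have : is_derive x (1 : R) F 0.
  apply: near_eq_is_derive (@has_deriv_cst R 0 x).
  near=> y; rewrite F0//; apply/andP; split; last first.
    by near: y; exact: lt_nbhsl.
  by near: y; exact: lt_nbhsr.
by case=> _; rewrite derive1E.
Unshelve. all: by end_near. Qed.

Lemma weak_deriv_unique k f g g' : Lp_circle 1%E g -> Lp_circle 1%E g' ->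
  is_weak_deriv k f g -> is_weak_deriv k f g' -> ae_equal g g'.
Proof.
move=> Lg Lg' wg wg'.
have /Lp1P[_ g1] := Lg; have /Lp1P[_ g1'] := Lg'.
have : ae_equal (fun x => -1 * g' x + g x) (fun=> 0).
  apply: fundamental_lemma; first exact: Lp1_lin.
  move=> h sh ph; have ch := smooth_continuous sh.
  transitivity (int01 (fun x => g x * h x - g' x * h x)).
    by congr int01; apply/funext => x; ring.
  rewrite int01B; [|exact: integrable01Mc..].
  have := wg h sh ph; rewrite (wg' h sh ph).
  move=> /(mulfI (_ : (-1) ^+ k != 0)) E.
  by rewrite /int01 E ?subrr// signr_eq0.
move=> /ae_equalP ne; apply/ae_equalP; apply: negligibleS ne => x /= ne E.
by apply: ne; apply/eqP; rewrite -subr_eq0; apply/eqP; rewrite -E; ring.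
Qed.

Lemma weak_derivP k f : (exists g, Lp_circle 1%E g /\ is_weak_deriv k f g) ->
  Lp_circle 1%E (weak_deriv k f) /\ is_weak_deriv k f (weak_deriv k f).
Proof. by move=> [g [Lg wg]]; rewrite /weak_deriv; case: xgetP => [_ -> //|/(_ g)[]]. Qed.

Lemma weak_deriv_ae k f g : Lp_circle 1%E g -> is_weak_deriv k f g ->
  ae_equal (weak_deriv k f) g.
Proof.
move=> Lg wg; have [|Lw ww] := @weak_derivP k f; first by exists g.
exact: weak_deriv_unique ww wg.
Qed.

Lemma is_weak_deriv_ae k f f' g : Lp_circle 1%E f -> Lp_circle 1%E f' ->
  ae_equal f f' -> is_weak_deriv k f g -> is_weak_deriv k f' g.
Proof.
move=> Lf Lf' ff wg h sh ph; rewrite -(wg h sh ph); symmetry.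
have mh D : measurable_fun D (derive1n k h).
  apply: continuous_meas; apply: smooth_continuous; exact: smooth_derive1n.
have mf := Lp_meas Lf; have mf' := Lp_meas Lf'.
apply: ae_int01; [exact: measurable_funM|exact: measurable_funM|].
by apply: ae_lift ff _ => x E; rewrite E.
Qed.

Lemma is_weak_deriv_aer k f g g' : Lp_circle 1%E g -> Lp_circle 1%E g' ->
  ae_equal g g' -> is_weak_deriv k f g -> is_weak_deriv k f g'.
Proof.
move=> Lf Lf' ff wg h sh ph; rewrite (wg h sh ph); congr (_ * _).
have mh D : measurable_fun D h by apply: continuous_meas; apply: smooth_continuous.
have mf := Lp_meas Lf; have mf' := Lp_meas Lf'.
apply: ae_int01; [exact: measurable_funM|exact: measurable_funM|].
by apply: ae_lift ff _ => x E; rewrite E.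
Qed.

Lemma is_weak_deriv_lin k c f f' g g' :
  Lp_circle 1%E f -> Lp_circle 1%E f' -> Lp_circle 1%E g -> Lp_circle 1%E g' ->
  is_weak_deriv k f g -> is_weak_deriv k f' g' ->
  is_weak_deriv k (fun x => c * f x + f' x) (fun x => c * g x + g' x).
Proof.
move=> /Lp1P[_ f1] /Lp1P[_ f1'] /Lp1P[_ g1] /Lp1P[_ g1'] wg wg' h sh ph.
have L (u u' v : R -> R) : integrable01 u -> integrable01 u' -> continuous v ->
  int01 (fun x => (c * u x + u' x) * v x) =
  c * int01 (fun x => u x * v x) + int01 (fun x => u' x * v x).
  move=> u1 u1' cv; rewrite -int01Z; last exact: integrable01Mc.
  rewrite -int01D; [|by apply: integrable01Z; exact: integrable01Mc|exact: integrable01Mc].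
  by congr int01; apply/funext => x; ring.
have ch := smooth_continuous sh.
have chk := smooth_continuous (@smooth_derive1n _ _ k sh).
have := wg h sh ph; have := wg' h sh ph; rewrite -!/(int01 _) !L// => -> ->.
by ring.
Qed.

(** The derivative of a test function is again a test function, so consecutive weak
    derivatives of f are weak derivatives of one another. *)
Lemma is_weak_derivS j f g g' : is_weak_deriv j f g -> is_weak_deriv j.+1 f g' ->
  is_weak_deriv 1 g g'.
Proof.
move=> wg wg' h sh ph.
have /= E := wg' h sh ph.
have := wg _ (smooth_derive sh) (periodic_derive sh ph).
rewrite -derive1Sn E exprS -mulrA => /(congr1 (fun x => (-1) ^+ j * x)).
have s2 z : (-1) ^+ j * ((-1) ^+ j * z) = z :> R by rewrite mulrA -expr2 sqrr_sign mul1r.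
by rewrite [X in X = _]mulrCA !s2 expr1 => <-.
Qed.

Lemma is_weak_deriv0 f : is_weak_deriv 0 f f.
Proof. by move=> h _ _; rewrite expr0 mul1r. Qed.

End weak_derivatives.

(** * Regular representatives *)

Section regularity.
Variable R : realType.
Local Notation I01 := (`[0, 1]%classic : set R).
Local Notation mu := (@lebesgue_measure R).
Implicit Types (f g h u w : R -> R) (x y b c : R).

Lemma continuous_integrable g a b : continuous g -> mu.-integrable `[a, b] (EFin \o g).
Proof.
move=> cg; apply: continuous_compact_integrable; first exact: segment_compact.
exact: continuous_subspaceT.
Qed.

(** The primitive vanishing at 0 is a difference of two integrals, one of which is
    over an empty interval or a point. *)
Lemma continuous_primitive g : continuous g -> exists W, has_deriv W g.
Proof.
move=> cg; pose W x := \int[mu]_(t in `[0, x]) g t - \int[mu]_(t in `[x, 0]) g t.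
exists W => x.
(* near x, the function W agrees up to a constant with the integral from the
   fixed base point a, to which the fundamental theorem of calculus applies *)
pose a := Num.min 0 x - 1.
have a0 : a < 0 by rewrite /a ltrBlDr add0r gt_min ltr01.
have ax : a < x by rewrite /a ltrBlDr gt_min ltrDl ltr01 orbT.
pose F y := \int[mu]_(t in `[a, y]) g t.
have H y z : a <= y -> y <= z -> F z - F y = \int[mu]_(t in `[y, z]) g t.
  move=> ay yz; rewrite /F Rintegral_itvB ?bnd_simp//; last exact: continuous_integrable.
  rewrite Rintegral_itv_obnd_cbnd//; apply: integrableS (continuous_integrable y z cg) => //.
  exact: subset_itv_oc_cc.
have WE y : a < y -> W y = F y - F 0.
  move=> ay; rewrite /W; have [y0|/ltW y0] := leP 0 y.
    rewrite (H 0 y (ltW a0) y0); move: y0; rewrite le_eqVlt => /orP[/eqP <-|y0].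
      by rewrite set_itv1 Rintegral_set1 subr0.
    by rewrite [X in _ - X](_ : _ = 0) ?subr0// set_itv_ge ?Rintegral_set0// bnd_simp -ltNge.
  rewrite -[RHS]opprB (H y 0 (ltW ay) y0); move: y0; rewrite le_eqVlt => /orP[/eqP ->|y0].
    by rewrite set_itv1 Rintegral_set1 subr0 oppr0.
  by rewrite [X in X - _](_ : _ = 0) ?add0r// set_itv_ge ?Rintegral_set0// bnd_simp -ltNge.
have [dF F'] := @continuous_FTC1_closed R g a x (x + 1) (ltr_pwDr ltr01 (lexx x))
  (continuous_integrable a (x + 1) cg) ax (cg x).
have dFx : is_derive x (1 : R) (fun y => F y - F 0) (g x).
  rewrite -[g x]subr0; apply: is_deriveB.
  by split; [exact: dF|rewrite -derive1E].
apply: near_eq_is_derive dFx; near=> y; rewrite WE//.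
near: y; exact: lt_nbhsr.
Unshelve. all: by end_near. Qed.

Lemma has_deriv_LR f f' a b : has_deriv f f' -> derivable_oo_LRcontinuous f a b.
Proof.
move=> df; have cf := has_deriv_continuous df; split.
- by move=> x _; exact: has_deriv_derivable df.
- exact/cvg_at_right_filter/cf.
- exact/cvg_at_left_filter/cf.
Qed.

Lemma int_parts F G f g a b : a < b -> has_deriv F f -> has_deriv G g ->
  continuous f -> continuous g ->
  \int[mu]_(x in `[a, b]) (F x * g x) =
  F b * G b - F a * G a - \int[mu]_(x in `[a, b]) (f x * G x).
Proof.
move=> ab dF dG cf cg; apply: Rintegration_by_parts => //.
- exact: continuous_subspaceT.
- exact: has_deriv_LR dF.
- by move=> x _; rewrite (has_derivE dF).
- exact: continuous_subspaceT.
- exact: has_deriv_LR dG.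
- by move=> x _; rewrite (has_derivE dG).
Qed.

Lemma cst_continuous1 c : continuous ((fun=> c) : R -> R).
Proof. by move=> x; exact: cvg_cst. Qed.

Lemma int_deriv G g a b : a <= b -> has_deriv G g -> continuous g ->
  \int[mu]_(x in `[a, b]) g x = G b - G a.
Proof.
rewrite le_eqVlt => /orP[/eqP <- _ _|ab dG cg].
  by rewrite set_itv1 Rintegral_set1 subrr.
have := int_parts ab (@has_deriv_cst R 1) dG (@cst_continuous1 0) cg.
rewrite !mul1r (_ : (fun x => 1 * g x) = g); last by apply/funext => x; rewrite mul1r.
move=> ->; rewrite (_ : (fun x => 0 * G x) = fun=> 0); last by apply/funext => x; rewrite mul0r.
by rewrite Rintegral_cst//= mul0r subr0.
Qed.

Lemma periodic_primitive G g : has_deriv G g -> continuous g -> periodic g 1 ->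
  int01 g = 0 -> periodic G 1.
Proof.
move=> dG cg pg ig x.
have d0 : has_deriv (fun x => G (x + 1) - G x) (fun=> 0).
  apply: has_deriv_eq (has_derivB (has_deriv_shift 1 dG) dG) _ => y.
  by rewrite pg subrr.
have := has_deriv0_cst d0 x 0; rewrite add0r -(int_deriv ler01 dG cg).
by rewrite -/(int01 g) ig => /eqP; rewrite subr_eq0 => /eqP.
Qed.

Lemma is_weak_deriv_C1 G g : has_deriv G g -> continuous g -> periodic G 1 ->
  is_weak_deriv 1 G g.
Proof.
move=> dG cg pG h sh ph /=.
rewrite (int_parts ltr01 dG (smooth_has_deriv sh) cg); last first.
  by apply: smooth_continuous; exact: smooth_derive.
have -> : G 1 = G 0 by rewrite -[in LHS](add0r 1) pG.
have -> : h 1 = h 0 by rewrite -[in LHS](add0r 1) ph.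
by rewrite subrr add0r expr1 mulN1r.
Qed.

(** A smooth function of mean 0 is the derivative of a test function, hence is
    orthogonal to u; subtracting its mean from an arbitrary test function shows
    that u minus its own mean is orthogonal to all test functions. *)
Lemma weak_deriv0_cst u : Lp_circle 1%E u -> is_weak_deriv 1 u (fun=> 0) ->
  exists c, ae_equal u (fun=> c).
Proof.
move=> Lu wu; have /Lp1P[pu u1] := Lu.
exists (int01 u).
have : ae_equal (fun x => -1 * int01 u + u x) (fun=> 0).
  apply: fundamental_lemma.
    apply/Lp1P; split; first by move=> x; rewrite pu.
    by apply: integrable01D => //; exact: integrable01_cst.
  move=> k sk pk; pose m := int01 k.
  have ck := smooth_continuous sk.
  have sk' := @smooth_addc _ _ (- m) sk.
  have ck' := smooth_continuous sk'.
  have [K dK] := continuous_primitive ck'.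
  have pK : periodic K 1.
    apply: periodic_primitive dK ck' _ _; first by move=> x; rewrite pk.
    rewrite int01B ?int01_cst ?subrr//; first exact: continuous_integrable01.
    exact: integrable01_cst.
  have := wu K (smooth_primitive dK sk') pK.
  rewrite (_ : (fun x => 0 * K x) = fun=> 0); last by apply/funext => x; rewrite mul0r.
  rewrite -!/(int01 _) int01_cst mulr0 /= (has_derivE dK) => E0.
  transitivity (int01 (fun x => u x * (k x - m)) + m * int01 u - int01 u * m).
    have u1k := integrable01Mc u1 ck; have u1k' := integrable01Mc u1 ck'.
    rewrite -int01Z// -int01D//; last exact: integrable01Z.
    rewrite -[X in _ = _ - X]int01Z; last exact: continuous_integrable01.
    rewrite -int01B; [|by apply: integrable01D => //; exact: integrable01Z|].
      by congr int01; apply/funext => x; ring.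
    by apply: integrable01Z; exact: continuous_integrable01.
  by rewrite E0 mulrC add0r subrr.
move=> /ae_equalP ne; apply/ae_equalP; apply: negligibleS ne => x /= ne E.
by apply: ne; lra.
Qed.

Lemma integral_sub01 g a b : integrable01 g -> 0 <= a -> b <= 1 ->
  `|\int[mu]_(t in `[a, b]) g t| <= int01 (fun x => `|g x|).
Proof.
move=> g1 a0 b1.
have sub : `[a, b]%classic `<=` I01.
  by move=> x /=; rewrite !in_itv /= => /andP[ax xb]; rewrite (le_trans a0)// (le_trans xb).
have g1' : mu.-integrable `[a, b] (EFin \o g) by apply: integrableS g1.
apply: le_trans (le_normr_Rintegral _ g1') _ => //.
have n1 := integrable01_norm g1.
apply: fine_le; try by apply: integrable_fin_num => //; apply: integrableS n1.
apply: ge0_subset_integral => //.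
by apply/measurable_EFinP; exact: integrable01_meas n1.
Qed.

Lemma L1_approx g e : integrable01 g -> 0 < e ->
  exists k, continuous k /\ int01 (fun x => `|g x - k x|) < e.
Proof.
move=> g1 e0.
have [|k [ck ik]] := @approximation_continuous_integrable R I01 g (@measurable_I01 R) _ g1.
  by have := @mu_I01 R => /= ->; rewrite ltry.
move=> /fine_cvgP[_ /cvgrPdist_lt /(_ e e0) [n _ /(_ n (leqnn n))]] /=.
rewrite sub0r normrN => H; exists (k n); split => //.
by apply: le_lt_trans (ler_norm _) H.
Qed.

(** Both sides are continuous in g for the L^1 norm, so the formula extends from
    continuous g by density. *)
Lemma int_parts_L1 g h h' : integrable01 g -> has_deriv h h' -> continuous h' ->
  int01 (fun x => (\int[mu]_(t in `[0, x]) g t) * h' x) =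
  int01 g * h 1 - int01 (fun x => g x * h x).
Proof.
move=> g1 dh ch'; have ch := has_deriv_continuous dh.
pose G x := \int[mu]_(t in `[0, x]) g t; rewrite -/(G _).
have cG : {within `[0, 1], continuous G} by exact: parameterized_integral_continuous.
have G1 : integrable01 G by apply: continuous_compact_integrable => //; exact: segment_compact.
have [M [M0 hM]] := continuous_bounded01 ch.
have [M' [M'0 h'M]] := continuous_bounded01 ch'.
have Gh' : integrable01 (fun x => G x * h' x) by exact: integrable01Mc.
apply/eqP; rewrite -subr_eq0 -normr_le0; apply/ler_addgt0Pr => e e0; rewrite add0r.
(* the three error terms below are at most d M', d M and d M *)
pose d := e / (M' + M + M + 1).
have D0 : 0 < M' + M + M + 1 by rewrite ltr_wpDl// !addr_ge0.
have d0 : 0 < d by rewrite divr_gt0.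
have [k [ck /ltW kd]] := L1_approx g1 d0.
have [K0 dK0] := continuous_primitive ck.
pose K x := K0 x - K0 0.
have dK : has_deriv K k.
  by apply: has_deriv_eq (has_derivB dK0 (has_deriv_cst _)) _ => x; rewrite subr0.
have k1 := continuous_integrable01 ck.
have gk1 := integrable01B g1 k1.
have GK x : x \in `[0, 1] -> `|G x - K x| <= d.
  rewrite in_itv /= => /andP[x0 x1]; rewrite /K -(int_deriv x0 dK0 ck) /G.
  have sub : `[0, x]%classic `<=` I01.
    by move=> y /=; rewrite !in_itv /= => /andP[-> yx]; rewrite (le_trans yx).
  rewrite -RintegralB//; [|exact: integrableS g1|exact: integrableS k1].
  apply: le_trans (integral_sub01 gk1 _ x1) kd => //.
have K1 : integrable01 K by apply: continuous_integrable01; exact: has_deriv_continuous dK.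
have E := int_parts ltr01 dK dh ck ch'.
rewrite -!/(int01 _) in E.
have K00 : K 0 = 0 by rewrite /K subrr.
rewrite K00 mul0r subr0 in E.
have -> : int01 (fun x => G x * h' x) - (int01 g * h 1 - int01 (fun x => g x * h x)) =
  int01 (fun x => (G x - K x) * h' x) + (K 1 - G 1) * h 1 +
  int01 (fun x => (g x - k x) * h x).
  rewrite (_ : (fun x => (G x - K x) * h' x) = (fun x => G x * h' x - K x * h' x)); last first.
    by apply/funext => x; ring.
  rewrite (_ : (fun x => (g x - k x) * h x) = (fun x => g x * h x - k x * h x)); last first.
    by apply/funext => x; ring.
  rewrite !int01B ?E; try exact: integrable01Mc.
  by rewrite -[G 1]/(int01 g); ring.
have B1 : `|int01 (fun x => (G x - K x) * h' x)| <= d * M'.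
  have i1 : integrable01 (fun x => (G x - K x) * h' x).
    by apply: integrable01Mc => //; exact: integrable01B.
  apply: le_trans (int01_norm i1) _; rewrite -(int01_cst (d * M')).
  apply: int01_le; [exact: integrable01_norm|exact: integrable01_cst|].
  by move=> x xI; rewrite normrM; apply: ler_pM => //; [exact: GK|exact: h'M].
have B2 : `|(K 1 - G 1) * h 1| <= d * M.
  rewrite normrM distrC; apply: ler_pM => //; [apply: GK|apply: hM];
    by rewrite in_itv /= ler01 lexx.
have B3 : `|int01 (fun x => (g x - k x) * h x)| <= d * M.
  have i1 : integrable01 (fun x => (g x - k x) * h x) by exact: integrable01Mc.
  apply: le_trans (int01_norm i1) _.
  apply: (@le_trans _ _ (int01 (fun x => M * `|g x - k x|))).
    apply: int01_le; [exact: integrable01_norm|by apply: integrable01Z; exact: integrable01_norm|].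
    by move=> x xI; rewrite normrM mulrC; apply: ler_wpM2r => //; exact: hM.
  rewrite int01Z; last exact: integrable01_norm.
  by rewrite mulrC; apply: ler_wpM2r.
apply: le_trans (ler_normD _ _) _; apply: le_trans (lerD (ler_normD _ _) (lexx _)) _.
apply: le_trans (lerD (lerD B1 B2) B3) _.
by rewrite -!mulrDr /d mulrAC ler_pdivrMr// ler_wpM2l ?ltW// ltrDl.
Qed.

(** Near an integer the values of G o frac come from both ends of [0, 1].  Let cl
    be the retraction of the line onto [0, 1] and m the integer part of the point
    under study; on (m - 1, m + 1), G o frac is a sum of two continuous functions
    G (cl (y - m)) and G (cl (y - m + 1)), of which one is constant on each side
    of m, minus the common value of G at the ends. *)
Lemma frac_continuous (G : R -> R) : {within I01, continuous G} -> G 0 = G 1 ->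
  continuous (fun x => G (frac x)).
Proof.
move=> cG G01 x0.
pose cl x : R := Num.max 0 (Num.min x 1).
have cl_in x : cl x \in `[0, 1].
  by rewrite in_itv /= /cl le_max lexx /= ge_max ler01 ge_min lexx orbT.
have ccl : continuous cl.
  apply: (@max_fun_continuous _ _ R (cst 0) (fun x : R => Num.min x 1)).
    by move=> x; exact: cvg_cst.
  apply: (@min_fun_continuous _ _ R (fun x : R => x) (cst 1)); first by move=> x; exact: cvg_id.
  by move=> x; exact: cvg_cst.
have cE : continuous (G \o cl).
  move=> x; move: cG => /subspace_continuousP/(_ (cl x) (cl_in x)) => cG.
  apply: cvg_trans cG => P /= HP.
  have H : \forall y \near x, I01 (cl y) -> P (G (cl y)) by exact: (ccl x _ HP).
  suff : \forall y \near x, P (G (cl y)) by [].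
  by near=> y; apply: (near H y); last exact: cl_in.
pose n : int := Num.floor x0; pose m : R := n%:~R.
have /andP[mx xm] : m <= x0 < m + 1.
  by have := floor_itv x0; rewrite -/n intrD.
have nE y : m - 1 < y < m + 1 ->
    G (frac y) = G (cl (y - m)) + G (cl (y - m + 1)) - G 0.
  move=> /andP[y1 y2]; have [ym|ym] := ltP y m.
    have -> : frac y = y - m + 1.
      rewrite /frac (_ : Num.floor y = n - 1) ?intrB ?opprB ?addrA//.
        by rewrite addrAC.
      apply: floor_def; rewrite subrK intrB -/m ym andbT.
      by rewrite ltW.
    have -> : cl (y - m) = 0 by rewrite /cl min_l ?max_l//; lra.
    have -> : cl (y - m + 1) = y - m + 1 by rewrite /cl min_l ?max_r//; lra.
    by ring.
  have -> : frac y = y - m.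
    rewrite /frac (_ : Num.floor y = n)//.
    by apply: floor_def; rewrite intrD -/m ym.
  have -> : cl (y - m) = y - m by rewrite /cl min_l ?max_r//; lra.
  have -> : cl (y - m + 1) = 1 by rewrite /cl min_r ?max_r//; lra.
  by rewrite -G01; ring.
have cS : {for x0, continuous (fun y => G (cl (y - m)) + G (cl (y - m + 1)) - G 0)}.
  have cs c : {for x0, continuous (fun y : R => G (cl (y + c)))}.
    apply: (@continuous_comp _ _ _ (fun y => y + c) (G \o cl)); last exact: cE.
    by apply: cvgD; [exact: cvg_id|exact: cvg_cst].
  apply: cvgB; last exact: cvg_cst.
  apply: cvgD; first exact: cs.
  under eq_fun do rewrite -addrA.
  by rewrite -addrA; exact: cs.
rewrite /continuous_at nE; last by rewrite xm andbT; lra.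
apply: cvg_trans cS; apply: near_eq_cvg; near=> y; rewrite nE//.
apply/andP; split.
  by near: y; apply: lt_nbhsr; lra.
by near: y; exact: lt_nbhsl.
Unshelve. all: by end_near. Qed.

Lemma primitive_oscillation g a b : integrable01 g -> 0 <= a -> a <= b -> b <= 1 ->
  `|\int[mu]_(t in `[0, b]) g t - \int[mu]_(t in `[0, a]) g t| <=
  int01 (fun x => `|g x|).
Proof.
move=> g1 a0 ab b1.
have sub c : c <= 1 -> `[0, c]%classic `<=` I01.
  by move=> c1 y /=; rewrite !in_itv /= => /andP[-> yx]; rewrite (le_trans yx).
have g1' c : c <= 1 -> mu.-integrable `[0, c] (EFin \o g).
  by move=> c1; apply: integrableS g1 => //; exact: sub.
rewrite Rintegral_itvB ?bnd_simp//; last exact: g1'.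
rewrite Rintegral_itv_obnd_cbnd; first exact: integral_sub01.
apply: integrableS (g1' b b1) => // x /=; rewrite !in_itv /= => /andP[ax ->].
by rewrite ltW// (le_lt_trans a0).
Qed.

Lemma weak_deriv_mean0 f g : is_weak_deriv 1 f g -> int01 g = 0.
Proof.
move=> wg; have := wg _ (@smooth_cst R 1) (fun=> erefl) => /=.
rewrite (has_derivE (@has_deriv_cst R 1)).
rewrite (_ : (fun x => f x * 0) = fun=> 0); last by apply/funext => x; rewrite mulr0.
rewrite (_ : (fun x => g x * 1) = g); last by apply/funext => x; rewrite mulr1.
by rewrite -!/(int01 _) int01_cst expr1 mulN1r => /eqP; rewrite eq_sym oppr_eq0 => /eqP.
Qed.

(** The continuous representative is c + G with G the indefinite integral of g
    on [0, 1], extended periodically; g has mean 0 because constants are test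
    functions, so G takes the same value at both ends. *)
Lemma continuous_representative f g : Lp_circle 1%E f -> Lp_circle 1%E g ->
  is_weak_deriv 1 f g -> exists w, [/\ continuous w, periodic w 1, ae_equal f w &
    forall x, `|w x| <= int01 (fun x => `|f x|) + int01 (fun x => `|g x|)].
Proof.
move=> Lf Lg wg; have /Lp1P[pf f1] := Lf; have /Lp1P[pg g1] := Lg.
pose G x := \int[mu]_(t in `[0, x]) g t.
have G0 : G 0 = 0 by rewrite /G set_itv1 Rintegral_set1.
have ig : int01 g = 0.
  exact: weak_deriv_mean0 wg.
have cG : {within I01, continuous G} by exact: parameterized_integral_continuous.
pose w0 x := G (frac x).
have cw0 : continuous w0 by apply: frac_continuous => //; rewrite G0 -[G 1]/(int01 g) ig.
have pw0 : periodic w0 1 by move=> x; rewrite /w0 fracD1.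
have w0E x : x \in `[0, 1] -> w0 x = G x.
  rewrite in_itv /= => /andP[x0]; rewrite le_eqVlt => /orP[/eqP ->|x1].
    rewrite /w0 -[in LHS](add0r 1) fracD1 -[G 1]/(int01 g) ig.
    by rewrite /frac floor0 subrr G0.
  by rewrite /w0 /frac (_ : Num.floor x = 0) ?subr0//; apply: floor_def; rewrite x0.
have ww0 : is_weak_deriv 1 w0 g.
  move=> h sh ph /=.
  transitivity (int01 (fun x => G x * derive1 h x)).
    by apply: eq_int01 => x xI; rewrite w0E.
  rewrite (int_parts_L1 g1 (smooth_has_deriv sh)); last first.
    by apply: smooth_continuous; exact: smooth_derive.
  by rewrite ig mul0r add0r expr1 mulN1r.
have Lw0 := continuous_Lp1 cw0 pw0.
have [c fc] : exists c, ae_equal (fun x => -1 * w0 x + f x) (fun=> c).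
  apply: weak_deriv0_cst; first exact: Lp1_lin.
  have := is_weak_deriv_lin (-1) Lw0 Lf Lg Lg ww0 wg.
  by rewrite (_ : (fun x => -1 * g x + g x) = fun=> 0)//; apply/funext => x; rewrite mulN1r addNr.
pose w x := c + w0 x.
have cw : continuous w.
  by move=> x; apply: cvgD; [exact: cvg_cst|exact: cw0].
have pw : periodic w 1 by move=> x; rewrite /w pw0.
have fw : ae_equal f w.
  by apply: ae_lift fc _ => x E; rewrite /w -E; ring.
exists w; split => // x.
have wxy y z : `|w y - w z| <= int01 (fun x => `|g x|).
  rewrite /w opprD addrACA subrr add0r /w0.
  have [zy|/ltW yz] := leP (frac z) (frac y).
    by apply: primitive_oscillation => //; [exact: frac_ge0|exact/ltW/frac_lt1].
  by rewrite distrC; apply: primitive_oscillation => //; [exact: frac_ge0|exact/ltW/frac_lt1].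
have w1 := continuous_integrable01 cw.
have n1 := integrable01_norm w1.
have -> : int01 (fun x => `|f x|) = int01 (fun x => `|w x|).
  apply: ae_int01; [exact: integrable01_meas (integrable01_norm f1)|exact: integrable01_meas n1|].
  by apply: ae_lift fw _ => y E; rewrite E.
rewrite -[leLHS]int01_cst -[X in _ + X]int01_cst -int01D//; last exact: integrable01_cst.
apply: int01_le; first exact: integrable01_cst.
  by apply: integrable01D => //; exact: integrable01_cst.
move=> y _; rewrite -lerBlDl.
by apply: le_trans (wxy x y); exact: lerB_dist.
Qed.

(** A point where f and g differ has a neighbourhood where they do, and this
    neighbourhood has positive measure. *)
Lemma continuous_ae_eq f g : continuous f -> continuous g -> periodic f 1 ->
  periodic g 1 -> ae_equal f g -> f = g.
Proof.
move=> cf cg pf pg /ae_equalP fg; apply/funext => x; apply/eqP; apply/negPn/negP => ne.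
have : \forall y \near x, f y != g y.
  have : {for x, continuous (fun y => f y - g y)} by apply: cvgB; [exact: cf|exact: cg].
  move=> /cvgr_neq0; rewrite subr_eq0 => /(_ ne).
  by apply: filterS => y; rewrite subr_eq0.
move=> [e /= e0 He].
have : mu.-negligible (`[x - e / 2, x + e / 2]%classic : set R).
  apply: negligibleS fg => y /=; rewrite in_itv /= -ler_distlC => xy.
  apply/eqP; apply: He => /=; apply: le_lt_trans xy _.
  by rewrite gtr_pMr// invf_lt1// ltr1n.
move=> neg; have : mu (`[x - e / 2, x + e / 2]%classic : set R) = 0%E by apply/negligibleP.
have e2 : 0 < e / 2 by rewrite divr_gt0.
rewrite lebesgue_measure_itv /= lte_fin -EFinB.
have -> : x - e / 2 < x + e / 2 by lra.
by move=> [] E; lra.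
Qed.

(** If the weak derivative of f has a continuous version then the continuous
    version of f is differentiable: the difference between f and a classical
    primitive is a constant. *)
Lemma representative_deriv f g w w' : Lp_circle 1%E f -> Lp_circle 1%E g ->
  is_weak_deriv 1 f g -> continuous w -> periodic w 1 -> ae_equal f w ->
  continuous w' -> periodic w' 1 -> ae_equal g w' -> has_deriv w w'.
Proof.
move=> Lf Lg wg cw pw fw cw' pw' gw'.
have Lw := continuous_Lp1 cw pw; have Lw' := continuous_Lp1 cw' pw'.
have ww' : is_weak_deriv 1 w w'.
  exact: is_weak_deriv_ae Lf Lw fw (is_weak_deriv_aer Lg Lw' gw' wg).
have iw' : int01 w' = 0.
  exact: weak_deriv_mean0 ww'.
have [W dW] := continuous_primitive cw'.
have pW := periodic_primitive dW cw' pw' iw'.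
have cW := has_deriv_continuous dW.
have [c Hc] : exists c, ae_equal (fun x => -1 * W x + w x) (fun=> c).
  have LW := continuous_Lp1 cW pW.
  apply: weak_deriv0_cst; first exact: Lp1_lin.
  have := is_weak_deriv_lin (-1) LW Lw Lw' Lw' (is_weak_deriv_C1 dW cw' pW) ww'.
  by rewrite (_ : (fun x => -1 * w' x + w' x) = fun=> 0)//; apply/funext => x; rewrite mulN1r addNr.
have -> : w = (fun x => W x + c).
  apply: continuous_ae_eq => //.
  - by move=> x; apply: cvgD; [exact: cW|exact: cvg_cst].
  - by move=> x; rewrite pW.
  by apply: ae_lift Hc _ => x E; rewrite -E; ring.
by apply: has_deriv_eq (has_derivD dW (has_deriv_cst c)) _ => x; rewrite addr0.
Qed.

(** This is the Sobolev embedding of W^{3,1} into C^2: the continuous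
    representatives of the successive weak derivatives are derivatives of one
    another. *)
Lemma C2_representative f (g : nat -> R -> R) :
  (forall j, (j <= 3)%N -> Lp_circle 1%E (g j) /\ is_weak_deriv j f (g j)) ->
  Lp_circle 1%E f ->
  exists w w1 w2, [/\ [/\ has_deriv w w1, has_deriv w1 w2, continuous w2 & periodic w 1],
   ae_equal f w &
   forall x, [/\ `|w x| <= int01 (fun x => `|g 0%N x|) + int01 (fun x => `|g 1%N x|),
    `|w1 x| <= int01 (fun x => `|g 1%N x|) + int01 (fun x => `|g 2%N x|) &
    `|w2 x| <= int01 (fun x => `|g 2%N x|) + int01 (fun x => `|g 3%N x|)]].
Proof.
move=> Hg Lf.
have S j : (j < 3)%N -> is_weak_deriv 1 (g j) (g j.+1).
  move=> j3; have [_ w1] := Hg j (ltnW j3); have [_ w2] := Hg j.+1 j3.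
  exact: is_weak_derivS w1 w2.
have L j : (j <= 3)%N -> Lp_circle 1%E (g j) by case/Hg.
have fg : ae_equal f (g 0%N).
  have [L0 w0] := Hg 0%N isT.
  exact: weak_deriv_unique Lf L0 (is_weak_deriv0 f) w0.
have [w [cw pw gw bw]] := continuous_representative (L 0%N isT) (L 1%N isT) (S 0%N isT).
have [w1 [cw1 pw1 gw1 bw1]] := continuous_representative (L 1%N isT) (L 2%N isT) (S 1%N isT).
have [w2 [cw2 pw2 gw2 bw2]] := continuous_representative (L 2%N isT) (L 3%N isT) (S 2%N isT).
exists w, w1, w2; split => //; last exact: ae_equal_trans fg gw.
split => //.
- exact: representative_deriv (L 0%N isT) (L 1%N isT) (S 0%N isT) cw pw gw cw1 pw1 gw1.
- exact: representative_deriv (L 1%N isT) (L 2%N isT) (S 1%N isT) cw1 pw1 gw1 cw2 pw2 gw2.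
Qed.

End regularity.
(** * Maximising a bounded linear functional on a Hilbert ball *)

Section maximiser.
Variables (R : realType) (V : lmodType R) (P : V -> Prop) (B : V -> V -> R) (J : V -> R).
Hypothesis Plin : forall a x y, P x -> P y -> P (a *: x + y).
Hypothesis Bsym : forall x y, P x -> P y -> B x y = B y x.
Hypothesis Blin : forall a x y z, P x -> P y -> P z ->
  B (a *: x + y) z = a * B x z + B y z.
Hypothesis B0 : forall x, P x -> 0 <= B x x.
Hypothesis Jlin : forall a x y, P x -> P y -> J (a *: x + y) = a * J x + J y.

Lemma sub_in x y : P x -> P y -> P (x - y).
Proof. by move=> Px Py; rewrite addrC -scaleN1r; exact: Plin. Qed.

Lemma add_in x y : P x -> P y -> P (x + y).
Proof. by move=> Px Py; rewrite -[x]scale1r; exact: Plin. Qed.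

Lemma zero_in x : P x -> P 0.
Proof. by move=> Px; rewrite -(subrr x); exact: sub_in. Qed.

Lemma J0 x : P x -> J 0 = 0.
Proof.
move=> Px; have P0 := zero_in Px; have := Jlin 1 P0 P0.
by rewrite scaler0 addr0 mul1r => /esym/eqP; rewrite -subr_eq0 addrK => /eqP.
Qed.

Lemma B0l x y : P x -> P y -> B 0 y = 0.
Proof.
move=> Px Py; have P0 := zero_in Px; have := Blin 1 P0 P0 Py.
by rewrite scaler0 addr0 mul1r => /esym/eqP; rewrite -subr_eq0 addrK => /eqP.
Qed.

Lemma BZl a x y : P x -> P y -> B (a *: x) y = a * B x y.
Proof.
by move=> Px Py; have P0 := zero_in Px; rewrite -[a *: x]addr0 Blin// (B0l Px Py) addr0.
Qed.

Lemma scale_in a x : P x -> P (a *: x).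
Proof. by move=> Px; rewrite -[a *: x]addr0; exact: Plin (zero_in Px). Qed.

Lemma JZ a x : P x -> J (a *: x) = a * J x.
Proof. by move=> Px; have P0 := zero_in Px; rewrite -[a *: x]addr0 Jlin// (J0 Px) addr0. Qed.

Lemma JB x y : P x -> P y -> J (x - y) = J x - J y.
Proof. by move=> Px Py; rewrite addrC -scaleN1r Jlin// mulN1r addrC. Qed.

Lemma JD x y : P x -> P y -> J (x + y) = J x + J y.
Proof. by move=> Px Py; rewrite -[x in LHS]scale1r Jlin// mul1r. Qed.

Lemma BZ a x : P x -> B (a *: x) (a *: x) = a ^+ 2 * B x x.
Proof.
move=> Px; have Pax := scale_in a Px.
by rewrite BZl// Bsym// BZl// mulrA.
Qed.

Lemma B_quad a x y : P x -> P y ->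
  B (a *: x + y) (a *: x + y) = a ^+ 2 * B x x + (a *+ 2) * B x y + B y y.
Proof.
move=> Px Py; have Pz := Plin a Px Py.
rewrite Blin// Bsym// Blin// (Bsym Py Pz) Blin// (Bsym Py Px); ring.
Qed.

Lemma parallelogram x y : P x -> P y ->
  B (x - y) (x - y) = (B x x + B y y) *+ 2 - B (x + y) (x + y).
Proof.
move=> Px Py.
have -> : x - y = (-1) *: y + x by rewrite scaleN1r addrC.
have -> : x + y = 1 *: y + x by rewrite scale1r addrC.
by rewrite !B_quad//; ring.
Qed.

(** Limits are taken in the form of dyadic estimates, so that the space V needs no
    topology. *)
Lemma le0_dyadic (K a : R) : (forall n, a <= K * 2^-1 ^+ n) -> a <= 0.
Proof.
move=> H; rewrite leNgt; apply/negP => a0.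
have K0 : 0 < K by have := H 0%N; rewrite expr0 mulr1; exact: lt_le_trans.
have [n Hn] : exists n : nat, K / a < n%:R.
  exists (Num.bound (K / a)); apply: archi_boundP.
  by rewrite divr_ge0// ltW.
have := H n; rewrite exprVn ler_pdivlMr ?exprn_gt0//; apply/negP; rewrite -ltNge.
move: Hn; rewrite ltr_pdivrMr// => /lt_le_trans; apply.
rewrite mulrC ler_pM2l// -natrX ler_nat; exact/ltnW/ltn_expl.
Qed.

(** Completeness for sequences that are Cauchy at a geometric rate; the constant 5
    is the number of summands in the scalar product of H^4. *)
Hypothesis Bcomplete : forall u : nat -> V, (forall n, P (u n)) ->
  (forall n m, (n <= m)%N -> B (u m - u n) (u m - u n) <= 4^-1 ^+ n) ->
  exists x, P x /\ forall n, B (u n - x) (u n - x) <= 5 * 4^-1 ^+ n.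
Hypothesis Jbound : exists C, 0 <= C /\ forall x, P x -> J x ^+ 2 <= C * B x x.
Hypothesis Jne0 : exists x, P x /\ J x <> 0.

Definition ball_maximiser x := [/\ P x, B x x <= 1 &
  forall y, P y -> B y y <= 1 -> J y <= J x].

(** A maximising sequence is Cauchy: its members are close to having norm 1,
    and so are their midpoints, whence by the parallelogram identity they are
    close to each other.  Uniqueness is the limiting case of this estimate. *)
Lemma hilbert_ball_maximiser : exists x, ball_maximiser x /\
  forall y, ball_maximiser y -> B (y - x) (y - x) = 0.
Proof.
have [C [C0 HC]] := Jbound; have [x0 [Px0 Jx0]] := Jne0.
pose S := [set J x | x in [set x | P x /\ B x x <= 1]].
have S0 : S 0.
  exists 0; last exact: J0 Px0.
  by split; [exact: zero_in Px0|rewrite (B0l Px0 (zero_in Px0))].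
have supS : has_sup S.
  split; first by exists 0.
  exists (C + 1) => _ [x [Px Bx] <-].
  have := HC x Px; have : C * B x x <= C by rewrite ler_piMr.
  move=> h1 h2; have {h1 h2} h : J x ^+ 2 <= C by exact: le_trans h2 h1.
  have := sqr_ge0 (J x - 1); move: h; rewrite !expr2; nra.
pose M := sup S.
have SM x : P x -> B x x <= 1 -> J x <= M.
  by move=> Px Bx; apply: sup_upper_bound => //; exists x.
(* one of x0 and - x0 has a positive value *)
have M0 : 0 < M.
  pose t := (1 + B x0 x0)^-1.
  have b0 := B0 Px0.
  have t0 : 0 < t by rewrite invr_gt0 ltr_pwDl.
  have tb a : a ^+ 2 = t ^+ 2 -> B (a *: x0) (a *: x0) <= 1.
    move=> a2; rewrite BZ// a2 /t exprVn mulrC ler_pdivrMr ?exprn_gt0 ?ltr_pwDl//.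
    by rewrite mul1r; nra.
  have h1 := SM _ (scale_in t Px0) (tb t erefl).
  have h2 := SM _ (scale_in (- t) Px0) (tb (- t) (sqrrN t)).
  rewrite !JZ// in h1 h2.
  have : 0 < `|t * J x0| by rewrite normr_gt0 mulf_eq0 negb_or gt_eqF//=; exact/eqP.
  move=> /lt_le_trans; apply; rewrite ler_norml h1 andbT.
  by rewrite lerNl -mulNr.
(* by homogeneity; the vectors of norm 0 that are not 0 are handled by the
   boundedness of J *)
have key z : P z -> 0 <= J z -> J z ^+ 2 <= M ^+ 2 * B z z.
  move=> Pz Jz0; have := B0 Pz; rewrite le_eqVlt => /orP[/eqP/esym Bz0|Bz].
    by have := HC z Pz; rewrite Bz0 !mulr0.
  pose s := Num.sqrt (B z z).
  have s0 : 0 < s by rewrite sqrtr_gt0.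
  have s2 : s ^+ 2 = B z z by rewrite sqr_sqrtr ?ltW.
  have := SM (s^-1 *: z) (scale_in _ Pz).
  rewrite BZ// JZ// -s2 exprVn mulVf ?lexx; last by rewrite expf_neq0// gt_eqF.
  move=> /(_ isT); rewrite mulrC ler_pdivrMr// => h.
  by rewrite -exprMn ler_sqr ?nnegrE// mulr_ge0// ltW.
(* the constant 8 makes the choice e = M 4^-n / 8 give distances at most 2^-n *)
have close e x y : 0 <= e <= M -> P x -> P y -> B x x <= 1 -> B y y <= 1 ->
    M - e <= J x -> M - e <= J y -> M * B (x - y) (x - y) <= e * 8.
  move=> /andP[e0 eM] Px Py Bx By Jx Jy.
  have Pxy := add_in Px Py.
  have h : (M - e) *+ 2 <= J (x + y) by rewrite JD// mulr2n; exact: lerD.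
  have h0 : 0 <= (M - e) *+ 2 by rewrite mulrn_wge0// subr_ge0.
  have := key _ Pxy (le_trans h0 h); rewrite parallelogram//.
  have h2 : ((M - e) *+ 2) ^+ 2 <= J (x + y) ^+ 2.
    by rewrite ler_sqr ?nnegrE// (le_trans h0).
  move=> /(le_trans h2); move: (B (x + y) (x + y)) (B x x) (B y y) Bx By => q bx by' Bx By Hq.
  rewrite -(ler_pM2l M0); move: Hq; rewrite !expr2 !mulr2n => Hq.
  have h3 : M * M * (bx + by') <= M * M * 2 by rewrite ler_pM2l ?mulr_gt0//; lra.
  nra.
have ex n : exists z : V, [/\ P z, B z z <= 1 & M - M / 8 * 4^-1 ^+ n <= J z].
  have e0 : 0 < M / 8 * 4^-1 ^+ n by rewrite mulr_gt0 ?exprn_gt0 ?divr_gt0.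
  have [_ [x [Px Bx] <-] Jx] := sup_adherent e0 supS.
  by exists x; split => //; exact: ltW.
have [u Hu] := choice ex.
have e4 n : 0 <= (4^-1 : R) ^+ n <= 1 by rewrite exprn_ge0//= exprn_ile1//; lra.
have [|n m nm|x [Px Hx]] := @Bcomplete u.
- by move=> n; have [] := Hu n.
- have [Pn Bn Jn] := Hu n; have [Pm Bm Jm] := Hu m.
  have mn4 : (4^-1 : R) ^+ m <= 4^-1 ^+ n by rewrite ler_wiXn2l//; lra.
  have /andP[p0 p1] := e4 n.
  have := close (M / 8 * 4^-1 ^+ n) _ _ _ Pm Pn Bm Bn _ Jn.
  rewrite -[X in _ -> _ -> _ <= X]/(M / 8 * 4^-1 ^+ n * 8).
  have -> : M / 8 * 4^-1 ^+ n * 8 = M * 4^-1 ^+ n by field.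
  rewrite ler_pM2l//; apply.
    by apply/andP; split; nra.
  apply: le_trans Jm; rewrite lerD2l lerN2 ler_pM2l// divr_gt0//.
have PB n : P (u n - x) by have [Pn _ _] := Hu n; exact: sub_in.
have h42 n : (4^-1 : R) ^+ n = (2^-1 ^+ n) ^+ 2.
  by rewrite -exprM mulnC exprM; congr (_ ^+ _); field.
have p2 n : 0 < (2^-1 : R) ^+ n <= 1 by rewrite exprn_gt0//= exprn_ile1//; lra.
(* expanding the square of t u_n + (u_n - x), with t = 2^-n, bounds the cross
   term 2 B (u_n) (u_n - x) from below by - 6 t *)
have Bx : B x x <= 1.
  rewrite -subr_le0; apply: (@le0_dyadic 11) => n.
  have [Pn Bn _] := Hu n; have Hn := Hx n; have /andP[t0 t1] := p2 n.
  have Pd := PB n.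
  have -> : x = (-1) *: (u n - x) + u n by rewrite scaleN1r opprB subrK.
  rewrite B_quad//.
  have := B0 (Plin (2^-1 ^+ n) Pn Pd); rewrite B_quad// (Bsym Pn Pd).
  move: Hn; rewrite h42; move: (2^-1 ^+ n) t0 t1 => t t0 t1.
  move: (B (u n - x) (u n - x)) (B (u n - x) (u n)) (B (u n) (u n)) (B0 Pd) Bn => d c b d0 b1 hd hq.
  have : t * (- (c *+ 2)) <= t * (t + 5 * t).
    by move: hq; rewrite !expr2 !mulr2n; move: hd; rewrite expr2; nra.
  rewrite ler_pM2l// => hc.
  by move: hd; rewrite !expr2 !mulr2n; move: hc; rewrite mulr2n; nra.
have Jx : M <= J x.
  rewrite -subr_le0; apply: (@le0_dyadic (M + 5 * C + 1)) => n.
  have [Pn Bn Jn] := Hu n; have Hn := Hx n; have /andP[t0 t1] := p2 n.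
  have := HC _ (PB n); rewrite JB//.
  have : C * B (u n - x) (u n - x) <= C * (5 * 4^-1 ^+ n) by rewrite ler_wpM2l.
  move: Jn; rewrite h42; move: (2^-1 ^+ n) t0 t1 => t t0 t1 Jn h1 h2.
  have h3 : (J (u n) - J x) ^+ 2 <= ((5 * C + 1) * t) ^+ 2.
    by apply: le_trans h2 (le_trans h1 _); rewrite !expr2; nra.
  have h4 : J (u n) - J x <= (5 * C + 1) * t.
    apply: le_trans (ler_norm _) _.
    by rewrite -ler_sqr ?nnegrE ?normr_ge0 ?real_normK ?num_real// mulr_ge0//; lra.
  have : M * t ^+ 2 <= M * t by rewrite ler_pM2l// expr2 ler_piMr// ltW.
  have : 0 <= M * t ^+ 2 by rewrite mulr_ge0 ?sqr_ge0// ltW.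
  by lra.
have maxx : ball_maximiser x by split => // y Py By; apply: le_trans (SM _ Py By) Jx.
exists x; split => // y [Py By Hy].
have Jy : M <= J y by apply: le_trans Jx _; exact: Hy.
apply/eqP; rewrite eq_le B0 ?andbT; last exact: sub_in.
rewrite -(ler_pM2l M0) mulr0.
have := @close 0 y x; rewrite !subr0 mul0r lexx ltW//; exact.
Qed.

End maximiser.

(** * Completeness of L^2 on the circle *)

Section hilbert.
Variable R : realType.
Local Notation I01 := (`[0, 1]%classic : set R).
Local Notation mu := (@lebesgue_measure R).
Implicit Types (f g h : R -> R) (x y c : R).

(** A fast Cauchy sequence converges almost everywhere since the sum of its
    increments is integrable, and Fatou's lemma turns the Cauchy estimate into an
    estimate of the distance to the limit. *)
Lemma L2_complete (u : nat -> R -> R) : (forall n, Lp_circle 2%:E (u n)) ->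
  (forall n m, (n <= m)%N -> int01 (fun x => (u m x - u n x) ^+ 2) <= 4^-1 ^+ n) ->
  exists f, Lp_circle 2%:E f /\
    forall n, integrable01 (fun x => (u n x - f x) ^+ 2) /\
      int01 (fun x => (u n x - f x) ^+ 2) <= 4^-1 ^+ n.
Proof.
move=> L2u cu.
have pu n : periodic (u n) 1 by case/Lp2P: (L2u n).
have mu_ n : measurable_fun I01 (u n) by case/Lp2P: (L2u n).
have u2 n : integrable01 (fun x => u n x ^+ 2) by case/Lp2P: (L2u n).
have d2 (n m : nat) : integrable01 (fun x => (u m x - u n x) ^+ 2).
  have /Lp2P[_ _] := Lp2_lin (-1) (L2u n) (L2u m).
  by under eq_fun do rewrite mulN1r addrC.
have md (n m : nat) : measurable_fun I01 (fun x => u m x - u n x).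
  exact: measurable_funB.
have d1 (n m : nat) : integrable01 (fun x => u m x - u n x).
  by apply: sqr_integrable01 => //; exact: d2.
have step n : int01 (fun x => `|u n.+1 x - u n x|) <= 2^-1 ^+ n.
  rewrite -ler_sqr ?nnegrE ?exprn_ge0//; last by apply: int01_ge0.
  apply: le_trans (sqr_int01_norm (d1 n n.+1) (d2 n n.+1)) _.
  apply: le_trans (cu n n.+1 (leqnSn n)) _.
  by rewrite -exprM mulnC exprM; apply: lerXn2r; rewrite ?nnegrE ?sqr_ge0//; lra.
pose S x := (\sum_(0 <= n <oo) `|u n.+1 x - u n x|%:E)%E.
have mS n : measurable_fun I01 (fun x => `|u n.+1 x - u n x|%:E).
  by apply/measurable_EFinP; exact: (@integrable01_meas _ (fun x => `|_ x|)) (integrable01_norm (d1 _ _)).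
have iS : mu.-integrable I01 S.
  apply/integrableP; split.
    by apply: ge0_emeasurable_sum => [k x _ _|k _]; [rewrite lee_fin|exact: mS].
  under eq_integral.
    move=> x _; rewrite gee0_abs; last by apply: nneseries_ge0.
    over.
  rewrite integral_nneseries//.
  apply: (@le_lt_trans _ _ (\sum_(0 <= n <oo) (2^-1 ^+ n)%:E)%E).
    apply: lee_nneseries => [n _ _|n _]; first exact: integral_ge0.
    by rewrite (int01_EFin (integrable01_norm (d1 n n.+1))) lee_fin.
  apply: (@le_lt_trans _ _ 2%:E); last by rewrite ltry.
  apply: lime_le; first by apply: is_cvg_nneseries => k _ _; rewrite lee_fin exprn_ge0.
  apply: nearW => n; rewrite sumEFin lee_fin.
  suff -> : \sum_(0 <= k < n) (2^-1 : R) ^+ k = 2 - 2 * 2^-1 ^+ n.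
    by rewrite gerBl mulr_ge0 ?exprn_ge0.
  elim: n => [|n IH]; first by rewrite big_geq// expr0 mulr1 subrr.
  by rewrite big_nat_recr//= IH exprS; field.
(* the upper limit, unlike a limit chosen almost everywhere, is measurable and
   periodic at every point *)
pose f x := fine (limn_esup (fun n => (u n x)%:E)).
have cf : {ae mu, forall x, I01 x -> u n x @[n --> \oo] --> f x}.
  have : \forall x \ae mu, I01 x -> S x \is a fin_num by exact: (integrable_ae _ iS).
  apply: negligibleS => x /= ne H; apply: ne => /H {H}fS.
  have cu' : cvgn (u^~ x).
    have ct : cvgn (series (telescope (u^~ x))).
      apply: normed_cvg; apply: nondecreasing_is_cvgn.
        by apply: nondecreasing_series => k _ _; exact: normr_ge0.
      exists (fine (S x)) => _ [k _ <-].
      rewrite -lee_fin fineK// /= -sumEFin; apply: nneseries_lim_ge => i _ _.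
      by rewrite lee_fin.
    have -> : u^~ x = (fun n => u 0%N x + series (telescope (u^~ x)) n).
      by apply/funext => n; rewrite -eq_sum_telescope.
    by apply: is_cvgD => //; exact: is_cvg_cst.
  have cE : (u n x)%:E @[n --> \oo] --> (limn (u^~ x))%:E.
    by apply: cvg_EFin; [exact: nearW|exact: cu'].
  by rewrite /f (cvg_limn_einf_sup cE).2 /=; exact: cu'.
have mf : measurable_fun I01 f.
  apply: measurableT_comp => //.
  by apply: measurable_fun_limn_esup => n; exact/measurable_EFinP.
have pf : periodic f 1.
  by move=> x; rewrite /f; congr (fine (limn_esup _)); apply/funext => n; rewrite pu.
have mdf n : measurable_fun I01 (fun x => (u n x - f x) ^+ 2).
  by apply: measurable_funX; exact: measurable_funB.
have main n : (\int[mu]_(x in I01) ((u n x - f x) ^+ 2)%:E <= (4^-1 ^+ n)%:E)%E.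
  pose F m x := ((u n x - u (n + m)%N x) ^+ 2)%:E.
  have mF m : measurable_fun I01 (F m).
    by apply/measurable_EFinP; apply: measurable_funX; exact: md.
  have -> : (\int[mu]_(x in I01) ((u n x - f x) ^+ 2)%:E = \int[mu]_(x in I01) limn_einf (F^~ x))%E.
    have m1 : measurable_fun I01 (fun x => ((u n x - f x) ^+ 2)%:E) by exact/measurable_EFinP.
    have m2 : measurable_fun I01 (fun x => limn_einf (F^~ x)).
      have -> : (fun x => limn_einf (F^~ x)) = (fun x => - limn_esup ((fun m y => - F m y)^~ x))%E.
        by apply/funext => x; have /(congr1 oppe) := limn_esupN (F^~ x); rewrite oppeK => <-.
      apply: measurableT_comp => //; apply: measurable_fun_limn_esup => m.
      exact: measurableT_comp.
    apply: ae_eq_integral; [by []|exact: m1|exact: m2|].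
    move: cf; apply: negligibleS => x /= ne H; apply: ne => /H {}H.
    have cE : F m x @[m --> \oo] --> ((u n x - f x) ^+ 2)%:E.
      apply: cvg_EFin; first exact: nearW.
      have c1 : u n x - u (n + m)%N x @[m --> \oo] --> u n x - f x.
        apply: cvgB; first exact: cvg_cst.
        under eq_fun do rewrite addnC.
        by move: H; rewrite -(cvg_shiftn n (u^~ x)).
      exact: (cvgM c1 c1).
    by rewrite (cvg_limn_einf_sup cE).1.
  apply: (@le_trans _ _ (limn_einf (fun m => \int[mu]_(x in I01) F m x)%E)).
    by apply: fatou => // m x _; rewrite lee_fin sqr_ge0.
  rewrite limn_einf_lim; apply: lime_le; first exact: is_cvg_einfs.
  apply: nearW => m; apply: le_trans (ereal_inf_lbound _) _; first by exists m => /=.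
  have e : (fun x => (u n x - u (n + m)%N x) ^+ 2) = (fun x => (u (n + m)%N x - u n x) ^+ 2).
    by apply/funext => x; rewrite -sqrrN opprB.
  rewrite int01_EFin; last by rewrite e.
  by rewrite lee_fin e; apply: cu; rewrite leq_addr.
have idf n : integrable01 (fun x => (u n x - f x) ^+ 2).
  apply/integrableP; split; first by apply/measurable_EFinP; exact: mdf.
  under eq_integral do rewrite gee0_abs ?lee_fin ?sqr_ge0//.
  by apply: le_lt_trans (main n) _; rewrite ltry.
exists f; split; last first.
  move=> n; split => //; rewrite -lee_fin -int01_EFin//.
apply/Lp2P; split => //.
have ud : Lp_circle 2%:E (fun x => u 0%N x - f x).
  apply/Lp2P; split => //; last exact: measurable_funB.
  by move=> x; rewrite pu pf.
have /Lp2P[_ _] := Lp2_lin (-1) ud (L2u 0%N).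
by congr integrable01; apply/funext => x; congr (_ ^+ 2); ring.
Qed.

(** * The Hilbert space H^4 *)

Definition H4_inner f g : R :=
  \sum_(k < 5) int01 (fun x => weak_deriv k f x * weak_deriv k g x).

Lemma H4_norm_le1 f : (H4_norm f <= 1) = (H4_inner f f <= 1).
Proof. by rewrite -[1 in LHS]sqrtr1 ler_sqrt. Qed.

Lemma Lp2_ae f g : periodic g 1 -> measurable_fun setT g -> ae_equal f g ->
  Lp_circle 2%:E f -> Lp_circle 2%:E g.
Proof.
move=> pg mg fg /Lp2P[pf mf f2]; apply/Lp2P.
have mg' : measurable_fun I01 g by exact: measurable_funTS.
split => //; apply: ae_integrable01 f2; first exact: measurable_funX.
by apply: ae_lift fg _ => x E; rewrite E.
Qed.

Lemma H4_deriv f k : H4 f -> (k <= 4)%N ->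
  Lp_circle 2%:E (weak_deriv k f) /\ is_weak_deriv k f (weak_deriv k f).
Proof.
move=> [Lf Hf] k4; have [g [Lg wg]] := Hf k k4.
have Lg1 := Lp2_Lp1 Lg.
have [|L1 w1] := @weak_derivP R k f; first by exists g.
split => //; apply: Lp2_ae Lg; [by case: L1|exact: Lp_measT L1|].
exact: ae_equal_sym (weak_deriv_ae Lg1 wg).
Qed.

Lemma H4_lin c f g : H4 f -> H4 g -> H4 (fun x => c * f x + g x).
Proof.
move=> Hf Hg; have [Lf _] := Hf; have [Lg _] := Hg.
split; first exact: Lp2_lin.
move=> j j4; have [L1 w1] := H4_deriv Hf j4; have [L2 w2] := H4_deriv Hg j4.
exists (fun x => c * weak_deriv j f x + weak_deriv j g x); split; first exact: Lp2_lin.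
exact: (is_weak_deriv_lin c (Lp2_Lp1 Lf) (Lp2_Lp1 Lg) (Lp2_Lp1 L1) (Lp2_Lp1 L2) w1 w2).
Qed.

Lemma H4_lin_deriv c f g k : H4 f -> H4 g -> (k <= 4)%N ->
  ae_equal (weak_deriv k (fun x => c * f x + g x))
           (fun x => c * weak_deriv k f x + weak_deriv k g x).
Proof.
move=> Hf Hg k4; have [Lf _] := Hf; have [Lg _] := Hg.
have [L1 w1] := H4_deriv Hf k4; have [L2 w2] := H4_deriv Hg k4.
apply: weak_deriv_ae; first by apply: Lp1_lin; exact: Lp2_Lp1.
exact: (is_weak_deriv_lin c (Lp2_Lp1 Lf) (Lp2_Lp1 Lg) (Lp2_Lp1 L1) (Lp2_Lp1 L2) w1 w2).
Qed.

Lemma H4_deriv_meas f k : H4 f -> (k <= 4)%N -> measurable_fun I01 (weak_deriv k f).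
Proof. by move=> Hf k4; have [/Lp_meas] := H4_deriv Hf k4. Qed.

Lemma H4_deriv_mul f g k : H4 f -> H4 g -> (k <= 4)%N ->
  integrable01 (fun x => weak_deriv k f x * weak_deriv k g x).
Proof.
move=> Hf Hg k4; have [/Lp2P[_ m1 i1] _] := H4_deriv Hf k4.
have [/Lp2P[_ m2 i2] _] := H4_deriv Hg k4.
exact: sqr_int01_cauchy.
Qed.

Lemma H4_inner_sym f g : H4_inner f g = H4_inner g f.
Proof. by apply: eq_bigr => k _; congr int01; apply/funext => x; rewrite mulrC. Qed.

Lemma ord5 (k : 'I_5) : (k <= 4)%N.
Proof. by have := ltn_ord k; rewrite ltnS. Qed.

Lemma H4_inner_lin c f g h : H4 f -> H4 g -> H4 h ->
  H4_inner (fun x => c * f x + g x) h = c * H4_inner f h + H4_inner g h.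
Proof.
move=> Hf Hg Hh; rewrite /H4_inner mulr_sumr -big_split /=; apply: eq_bigr => k _.
have k4 := ord5 k.
have i1 := H4_deriv_mul Hf Hh k4; have i2 := H4_deriv_mul Hg Hh k4.
rewrite -int01Z// -int01D//; last exact: integrable01Z.
apply: ae_int01.
- by apply: measurable_funM; apply: H4_deriv_meas => //; exact: H4_lin.
- by apply: integrable01_meas; apply: integrable01D => //; exact: integrable01Z.
by apply: ae_lift (H4_lin_deriv c Hf Hg k4) _ => x ->; ring.
Qed.

Lemma H4_inner_ge0 f : 0 <= H4_inner f f.
Proof.
by apply: sumr_ge0 => k _; apply: int01_ge0 => x _; rewrite -expr2 sqr_ge0.
Qed.

Lemma H4_deriv_le f k : (k <= 4)%N ->
  int01 (fun x => weak_deriv k f x ^+ 2) <= H4_inner f f.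
Proof.
move=> k4; have k5 : (k < 5)%N by [].
rewrite /H4_inner (bigD1 (Ordinal k5)) //=.
under eq_int01 do rewrite expr2.
by rewrite lerDl; apply: sumr_ge0 => i _; apply: int01_ge0 => x _; rewrite -expr2 sqr_ge0.
Qed.

Lemma H4_deriv0 f : H4 f -> ae_equal (weak_deriv 0 f) f.
Proof.
move=> Hf; have [Lf _] := Hf; apply: weak_deriv_ae; first exact: Lp2_Lp1.
exact: is_weak_deriv0.
Qed.

Lemma H4_inner_eq0 f : H4 f -> H4_inner f f = 0 -> ae_equal f (fun=> 0).
Proof.
move=> Hf f0; apply: ae_equal_trans (ae_equal_sym (H4_deriv0 Hf)) _.
have [Lw _] := H4_deriv Hf (leq0n 4); have /Lp2P[pw mw w2] := Lw.
apply: periodic_ae => //.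
have : (fun x => weak_deriv 0 f x ^+ 2) = (fun=> 0) %[ae mu in I01].
  apply: int01_eq0 => //; first by move=> x; rewrite sqr_ge0.
  apply/eqP; rewrite eq_le -{1}f0 H4_deriv_le//=.
  by apply: int01_ge0 => x _; rewrite sqr_ge0.
apply: negligibleS => x /= ne H; apply: ne => xI; apply/eqP.
by rewrite -(sqrf_eq0 (weak_deriv 0 f x)) H.
Qed.

(** Convergence in L^2 implies convergence in L^1, hence of the integrals against a
    bounded function. *)
Lemma L2_limit_integral (u : nat -> R -> R) f h :
  (forall n, integrable01 (u n)) -> integrable01 f ->
  (forall n, integrable01 (fun x => (u n x - f x) ^+ 2) /\
      int01 (fun x => (u n x - f x) ^+ 2) <= 4^-1 ^+ n) -> continuous h ->
  exists M, forall n, `|int01 (fun x => u n x * h x) - int01 (fun x => f x * h x)| <=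
    M * 2^-1 ^+ n.
Proof.
move=> u1 f1 uf ch; have [M [M0 hM]] := continuous_bounded01 ch.
exists M => n; have [i2 le2] := uf n.
have d1 := integrable01B (u1 n) f1.
rewrite -int01B; [|exact: integrable01Mc..].
have -> : (fun x => u n x * h x - f x * h x) = (fun x => (u n x - f x) * h x).
  by apply/funext => x; ring.
apply: le_trans (int01_norm (integrable01Mc d1 ch)) _.
apply: (@le_trans _ _ (int01 (fun x => M * `|u n x - f x|))).
  apply: int01_le; first by apply: integrable01_norm; exact: integrable01Mc.
    by apply: integrable01Z; exact: integrable01_norm.
  by move=> x xI; rewrite normrM mulrC ler_wpM2r//; exact: hM.
rewrite int01Z; last exact: integrable01_norm.
apply: ler_wpM2l => //; rewrite -ler_sqr ?nnegrE ?exprn_ge0//; last exact: int01_ge0.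
apply: le_trans (sqr_int01_norm d1 i2) _; apply: le_trans le2 _.
by rewrite -exprM mulnC exprM; apply: lerXn2r; rewrite ?nnegrE ?sqr_ge0//; lra.
Qed.

Lemma is_weak_deriv_limit k (u v : nat -> R -> R) f g :
  (forall n, is_weak_deriv k (u n) (v n)) ->
  (forall n, integrable01 (u n)) -> (forall n, integrable01 (v n)) ->
  integrable01 f -> integrable01 g ->
  (forall n, integrable01 (fun x => (u n x - f x) ^+ 2) /\
      int01 (fun x => (u n x - f x) ^+ 2) <= 4^-1 ^+ n) ->
  (forall n, integrable01 (fun x => (v n x - g x) ^+ 2) /\
      int01 (fun x => (v n x - g x) ^+ 2) <= 4^-1 ^+ n) ->
  is_weak_deriv k f g.
Proof.
move=> wuv u1 v1 f1 g1 uf vg h sh ph.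
have [M HM] := L2_limit_integral u1 f1 uf (smooth_continuous (@smooth_derive1n _ _ k sh)).
have [N HN] := L2_limit_integral v1 g1 vg (smooth_continuous sh).
apply/eqP; rewrite -subr_eq0 -normr_le0; apply: (@le0_dyadic _ (M + N)) => n.
have := HM n; have := HN n; have := wuv n h sh ph; rewrite -!/(int01 _) => ->.
move: (int01 _) (int01 _) (int01 _) => b c a H1 H2.
have -> : b - (-1) ^+ k * c = - ((-1) ^+ k * a - b) + (-1) ^+ k * (a - c) by ring.
apply: le_trans (ler_normD _ _) _; rewrite normrN normrM normrX normrN1 expr1n mul1r.
by rewrite mulrDl; exact: lerD.
Qed.

(** Completeness of H^4: each of the five derivatives converges in L^2, and the
    identity defining weak derivatives passes to the limit. *)
Lemma H4_complete (u : nat -> R -> R) : (forall n, H4 (u n)) ->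
  (forall n m, (n <= m)%N ->
    H4_inner (fun x => -1 * u n x + u m x) (fun x => -1 * u n x + u m x) <= 4^-1 ^+ n) ->
  exists f, H4 f /\ forall n,
    H4_inner (fun x => -1 * f x + u n x) (fun x => -1 * f x + u n x) <= 5 * 4^-1 ^+ n.
Proof.
move=> Hu cu.
have ex k : exists g, (k <= 4)%N -> Lp_circle 2%:E g /\
    forall n, integrable01 (fun x => (weak_deriv k (u n) x - g x) ^+ 2) /\
      int01 (fun x => (weak_deriv k (u n) x - g x) ^+ 2) <= 4^-1 ^+ n.
  have [k4|_] := boolP (k <= 4)%N; last by exists 0.
  have [|n m nm|g Hg] := @L2_complete (fun n => weak_deriv k (u n)).
  - by move=> n; have [] := H4_deriv (Hu n) k4.
  - apply: le_trans (cu n m nm); apply: le_trans (H4_deriv_le _ k4).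
    have Hd := H4_lin (-1) (Hu n) (Hu m).
    rewrite le_eqVlt; apply/orP; left; apply/eqP; apply: ae_int01.
    + by apply: measurable_funX; apply: measurable_funB; exact: H4_deriv_meas.
    + by apply: measurable_funX; exact: H4_deriv_meas.
    by apply: ae_lift (H4_lin_deriv (-1) (Hu n) (Hu m) k4) _ => x ->; rewrite mulN1r addrC.
  - by exists g.
have [g Hg] := choice ex.
have L2g k : (k <= 4)%N -> Lp_circle 2%:E (g k) by move=> /Hg[].
have L1g k : (k <= 4)%N -> integrable01 (g k).
  by move=> /L2g/Lp2_Lp1/Lp1P[].
have L1u k n : (k <= 4)%N -> integrable01 (weak_deriv k (u n)).
  by move=> k4; have [/Lp2_Lp1/Lp1P[]] := H4_deriv (Hu n) k4.
have wg k : (k <= 4)%N -> is_weak_deriv k (g 0%N) (g k).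
  move=> k4; have [_ H0] := Hg 0%N isT; have [_ Hk] := Hg k k4.
  have W n : is_weak_deriv k (weak_deriv 0 (u n)) (weak_deriv k (u n)).
    have [Lw ww] := H4_deriv (Hu n) k4.
    have [L0 _] := H4_deriv (Hu n) (leq0n 4); have [Lu _] := Hu n.
    apply: is_weak_deriv_ae ww; [exact: Lp2_Lp1|exact: Lp2_Lp1|].
    exact: ae_equal_sym (H4_deriv0 (Hu n)).
  exact: (@is_weak_deriv_limit k _ _ (g 0%N) (g k) W (fun n => L1u 0%N n isT) (fun n => L1u k n k4)
    (L1g 0%N isT) (L1g _ k4) H0 Hk).
have Hf : H4 (g 0%N).
  split; first exact: L2g.
  by move=> j j4; exists (g j); split; [exact: L2g|exact: wg].
exists (g 0%N); split => // n.
apply: (@le_trans _ _ (\sum_(k < 5) (4^-1 : R) ^+ n)); last first.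
  by rewrite sumr_const card_ord mulr_natl.
apply: ler_sum => k _; have k4 := ord5 k.
have [_ /(_ n)[_ Hk]] := Hg k k4; apply: le_trans Hk.
rewrite le_eqVlt; apply/orP; left; apply/eqP.
have Hd := H4_lin (-1) Hf (Hu n).
apply: ae_int01.
- by apply: measurable_funM; exact: H4_deriv_meas.
- apply: measurable_funX; apply: measurable_funB; first exact: H4_deriv_meas.
  exact: Lp_meas (L2g k k4).
have wgk : ae_equal (weak_deriv k (g 0%N)) (g k).
  by apply: weak_deriv_ae; [exact: Lp2_Lp1 (L2g k k4)|exact: wg].
by apply: ae_lift2 (H4_lin_deriv (-1) Hf (Hu n) k4) wgk _ => x -> ->; ring.
Qed.

End hilbert.

(** * The transfer operator of an expanding circle map *)

Section transfer.
Variables (R : realType) (T T1 T2 : R -> R) (d : int) (alpha : R).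
Hypotheses (Tlift : forall x, T (x + 1) = T x + d%:~R) (alpha_gt0 : 0 < alpha).
Hypotheses (expanding : forall x, alpha^-1 <= `|T1 x|).
Hypotheses (dT : has_deriv T T1) (dT1 : has_deriv T1 T2) (cT2 : continuous T2).
Local Notation mu := (@lebesgue_measure R).
Implicit Types (f g : R -> R) (x y c : R).

Lemma T1_neq0 x : T1 x != 0.
Proof.
by rewrite -normr_gt0; apply: lt_le_trans (expanding x); rewrite invr_gt0.
Qed.

Lemma cT1 : continuous T1. Proof. exact: has_deriv_continuous dT1. Qed.

Lemma cT : continuous T. Proof. exact: has_deriv_continuous dT. Qed.

Lemma T1_periodic : periodic T1 1.
Proof.
move=> x.
have d0 : has_deriv (fun y => T (y + 1) - T y) (fun y => T1 (y + 1) - T1 y).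
  exact: has_derivB (has_deriv_shift 1 dT) dT.
have /has_derivE : has_deriv (fun y => T (y + 1) - T y) (fun=> 0).
  rewrite (_ : (fun y => _) = fun=> d%:~R); first exact: has_deriv_cst.
  by apply/funext => y; rewrite Tlift addrAC subrr add0r.
by rewrite (has_derivE d0) => /(congr1 (fun h : R -> R => h x)) /eqP; rewrite subr_eq0 => /eqP.
Qed.

Lemma T2_periodic : periodic T2 1.
Proof. exact: has_deriv_periodic dT1 T1_periodic. Qed.

(** By the intermediate value theorem T' keeps its sign, so |T'| is a constant
    multiple of T' and in particular is as regular as T'. *)
Lemma T1_sign : exists s : R, `|s| = 1 /\ forall x, `|T1 x| = s * T1 x.
Proof.
have H a b : a <= b -> ~ (Num.min (T1 a) (T1 b) <= 0 <= Num.max (T1 a) (T1 b)).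
  move=> ab H; have [c _ /eqP] := IVT ab (continuous_subspaceT cT1) H.
  exact/negP/T1_neq0.
have same a b : (0 < T1 a) = (0 < T1 b).
  wlog ab : a b / a <= b.
    by move=> W; have [/W //|/ltW/W ->] := leP a b.
  have := H a b ab; have := T1_neq0 a; have := T1_neq0 b.
  rewrite !neq_lt => /orP[] hb /orP[] ha; rewrite ?ha ?hb ?(lt_gtF ha) ?(lt_gtF hb)//.
    by case; rewrite ge_min le_max (ltW ha) (ltW hb) orbT.
  by case; rewrite ge_min le_max (ltW ha) (ltW hb) orbT.
have [h|h] := boolP (0 < T1 0).
  exists 1; rewrite normr1; split => // x; rewrite mul1r gtr0_norm//.
  by rewrite (same x 0).
exists (-1); rewrite normrN1; split => // x; rewrite mulN1r ler0_norm//.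
by rewrite leNgt (same x 0).
Qed.

Lemma T_mvt x y : exists c, T y - T x = T1 c * (y - x).
Proof.
wlog xy : x y / x <= y.
  move=> W; have [/W //|/ltW/W [c Hc]] := leP x y.
  by exists c; rewrite -opprB Hc -mulrN opprB.
have [|c _ E] := @MVT_segment R T T1 x y xy _ (continuous_subspaceT cT).
  by move=> z _; exact: dT.
by exists c.
Qed.

Lemma T_lipschitz : exists K, forall x y, `|T x - T y| <= K * `|x - y|.
Proof.
have [K [_ HK]] := periodic_bounded T1_periodic cT1.
exists K => x y; have [c ->] := T_mvt y x.
by rewrite normrM ler_wpM2r.
Qed.

Lemma T_expands x y : `|x - y| <= alpha * `|T x - T y|.
Proof.
have [c ->] := T_mvt y x; rewrite normrM mulrA ler_peMl//.
by rewrite -(ler_pM2l (_ : 0 < alpha^-1)) ?invr_gt0// mulr1 mulrA mulVf ?mul1r// gt_eqF.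
Qed.

Lemma T_inj : injective T.
Proof.
move=> x y E; have := T_expands x y; rewrite E subrr normr0 mulr0 normr_le0.
by rewrite subr_eq0 => /eqP.
Qed.

(** Degree 0 would give T the same value at 0 and at 1. *)
Lemma d_neq0 : d != 0.
Proof.
apply/eqP => d0; have := Tlift 0; rewrite d0 addr0 add0r => /T_inj/eqP.
by rewrite oner_eq0.
Qed.

Lemma T_liftz x (k : int) : T (x + k%:~R) = T x + (k * d)%:~R.
Proof.
have H (n : nat) y : T (y + n%:R) = T y + (n%:Z * d)%:~R.
  elim: n => [|n IH]; first by rewrite mul0r !addr0.
  by rewrite -natr1 addrA Tlift IH -addrA -intrD -addn1 PoszD mulrDl mul1r.
case: k => n; first exact: H.
rewrite NegzE; have := H n.+1 (x + (- n.+1%:Z)%:~R).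
rewrite mulrNz -pmulrn subrK => ->.
by rewrite mulNr mulrNz addrK.
Qed.

(** T (n) and T (- n) are T 0 + n d and T 0 - n d, which surround y for large n. *)
Lemma T_surj y : exists x, T x = y.
Proof.
pose n := Num.bound `|y - T 0|.
have : `|y - T 0| < n%:R by exact: archi_boundP.
rewrite ltr_norml => /andP[h1 h2].
have Tn : T n%:R = T 0 + n%:R * d%:~R.
  by rewrite -[in LHS](add0r n%:R) -[n%:R in LHS]/(n%:~R) T_liftz intrM.
have TNn : T (- n%:R) = T 0 - n%:R * d%:~R.
  by rewrite -[in LHS](add0r (- n%:R)) -[n%:R in LHS]/(n%:~R) -mulrNz T_liftz intrM mulrNz mulNr.
have n0 : (0 : R) <= n%:R by [].
have nn : - n%:R <= n%:R :> R by lra.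
have := IVT nn (continuous_subspaceT cT).
suff H : Num.min (T (- n%:R)) (T n%:R) <= y <= Num.max (T (- n%:R)) (T n%:R).
  by move=> /(_ _ H)[c _ Hc]; exists c.
rewrite Tn TNn ge_min le_max.
have := d_neq0; rewrite neq_lt => /orP[d0|d0].
  have : d%:~R <= (-1 : R) by rewrite -[-1]/((-1)%:~R) ler_int; lia.
  move: (d%:~R : R) => e e1; apply/andP; split; apply/orP; [right|left]; nra.
have : (1 : R) <= d%:~R by rewrite -[1]/(1%:~R) ler_int; lia.
by move: (d%:~R : R) => e e1; apply/andP; split; apply/orP; [left|right]; nra.
Qed.

Lemma T_inverse : exists S : R -> R, cancel S T.
Proof. by have [S HS] := choice T_surj; exists S. Qed.

Section inverse.
Variable S : R -> R.
Hypothesis ST : cancel S T.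

Lemma TS : cancel T S.
Proof. by move=> x; apply: T_inj; rewrite ST. Qed.

Lemma S_lipschitz x y : `|S x - S y| <= alpha * `|x - y|.
Proof. by have := T_expands (S x) (S y); rewrite !ST. Qed.

Lemma cS : continuous S.
Proof.
move=> x; apply/cvgrPdist_le => e e0; near=> y.
apply: le_trans (S_lipschitz x y) _; rewrite -ler_pdivlMl//.
near: y; apply: cvgr_dist_le; first exact: cvg_id.
by rewrite mulr_gt0// invr_gt0.
Unshelve. all: by end_near. Qed.

Lemma dS : has_deriv S (fun x => (T1 (S x))^-1).
Proof.
move=> x; rewrite -{1}(ST x); apply: is_derive_inverse; last exact: T1_neq0.
- by near=> y; exact: TS.
- by near=> y; exact: cT.
- exact: dT.
Unshelve. all: by end_near. Qed.

Lemma S_liftz x (k : int) : S (x + (k * d)%:~R) = S x + k%:~R.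
Proof. by apply: T_inj; rewrite ST T_liftz ST. Qed.

(** Since T (x + k) = T x + k d, the preimages of the class of x modulo 1 are the
    classes of S (x + m), and m only matters modulo d. *)
Definition branch (m : nat) x := S (x + m%:R).

Lemma branch_preimage x :
  set_bij `I_(absz d) (circle_preimage T x) (fun m => frac (branch m x)).
Proof.
have preimE (m : int) : exists k : int, T (frac (S (x + m%:~R))) = x + k%:~R.
  exists (m - Num.floor (S (x + m%:~R)) * d).
  by rewrite /frac -mulrNz T_liftz ST mulNr intrD addrA.
split.
- move=> m _; split; first by rewrite frac_ge0 frac_lt1.
  by have [k Hk] := preimE m; exists k.
- move=> m m' /set_mem /= md /set_mem /= md' E.
  have [k Hk] : exists k : int, S (x + m%:R) = S (x + m'%:R) + k%:~R.
    exists (Num.floor (branch m x) - Num.floor (branch m' x)).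
    rewrite intrB -[LHS]/(branch m x) -[S (x + m'%:R)]/(branch m' x).
    by move: E; rewrite /frac => E; lra.
  rewrite -S_liftz in Hk; move: Hk => /(can_inj ST).
  rewrite -addrA => /addrI; rewrite [m%:R]pmulrn [m'%:R]pmulrn -intrD => /eqP.
  rewrite eqr_int => /eqP E'.
  have [k0|k0] := eqVneq k 0; first by move: E'; rewrite k0 mul0r addr0 => -[].
  have : (absz (m%:Z - m'%:Z) < absz d)%N by lia.
  by rewrite E' addrAC subrr add0r abszM -[X in (_ < X)%N]mul1n ltn_mul2r ltnS leqn0 absz_eq0 (negbTE k0) andbF.
- move=> y [y01 [m Hm]].
  have dn0 := d_neq0.
  have r0 := modz_ge0 m dn0; have rd := ltz_mod m dn0.
  pose r := absz (m %% d)%Z.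
  have rE : (m %% d)%Z = r%:Z by rewrite /r gez0_abs.
  exists r; first by rewrite /= -ltz_nat -rE abszE.
  have -> : branch r x = y + (- (m %/ d)%Z)%:~R.
    rewrite -[y]TS Hm -S_liftz; congr S; rewrite -addrA -intrD.
    by rewrite {1}(divz_eq m d) mulNr addrAC subrr add0r rE.
  have yf : frac y = y.
    rewrite /frac (_ : Num.floor y = 0) ?subr0//; apply: floor_def.
    by rewrite add0r.
  by rewrite -[RHS]yf; exact: periodic_int (@fracD1 R) _ _.
Qed.

(** The sum over preimages, written with the inverse branches on the line. *)
Definition real_transfer g x : R :=
  \sum_(m < absz d) g (branch m x) * `|T1 (branch m x)|^-1.

Lemma sum_complex n (a b : nat -> R) :
  \sum_(m < n) (a m +i* b m) = (\sum_(m < n) a m) +i* (\sum_(m < n) b m).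
Proof.
elim: n => [|n IH]; first by rewrite !big_ord0.
by rewrite !big_ord_recr /= IH; simpc.
Qed.

Lemma transferE (f : R -> R[i]) : periodic f 1 -> derive1 T = T1 -> forall x,
  transfer T f x = real_transfer (fun y => complex.Re (f y)) x +i*
                   real_transfer (fun y => complex.Im (f y)) x.
Proof.
move=> pf T1E x; rewrite /transfer (reindex_fsbig _ _ _ _ (branch_preimage x)).
rewrite -(fsbig_ord _ _ (fun m => f (frac (branch m x)) / `|derive1 T (frac (branch m x))|%:C)).
rewrite -(sum_complex _ (fun m => complex.Re (f (branch m x)) * `|T1 (branch m x)|^-1)
  (fun m => complex.Im (f (branch m x)) * `|T1 (branch m x)|^-1)).
apply: eq_bigr => m _.
rewrite T1E !periodic_frac//; last exact: T1_periodic.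
by case: (f _) => a b; rewrite -fmorphV /=; simpc.
Qed.

Lemma circle_preimage_periodic x : circle_preimage T (x + 1) = circle_preimage T x.
Proof.
apply/seteqP; split => y [y01 [m Hm]]; split => //.
  by exists (m + 1); rewrite Hm intrD; ring.
by exists (m - 1); rewrite Hm intrB; ring.
Qed.

Lemma transfer_periodic (f : R -> R[i]) : periodic (transfer T f) 1.
Proof. by move=> x; rewrite /transfer circle_preimage_periodic. Qed.

Lemma branch_continuous m : continuous (branch m).
Proof.
move=> x; apply: (@continuous_comp _ _ _ (fun x => x + m%:R) S); last exact: cS.
by apply: cvgD; [exact: cvg_id|exact: cvg_cst].
Qed.

Lemma branch_deriv m : has_deriv (branch m) (fun x => (T1 (branch m x))^-1).
Proof. exact: has_deriv_shift dS. Qed.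

Lemma real_transfer_meas g : measurable_fun setT g ->
  measurable_fun setT (real_transfer g).
Proof.
move=> mg; apply: measurable_sum => m.
have mb : measurable_fun setT (branch m).
  by apply: continuous_meas; exact: branch_continuous.
apply: measurable_funM; first exact: measurableT_comp.
apply: continuous_meas => x.
apply: cvgV; first by rewrite normr_eq0 T1_neq0.
apply: cvg_norm; apply: (@continuous_comp _ _ _ (branch m) T1); last exact: cT1.
exact: branch_continuous.
Qed.

(** Almost everywhere equality is preserved because T, being Lipschitz, maps
    null sets to null sets. *)
Lemma real_transfer_ae g h : ae_equal g h ->
  ae_equal (real_transfer g) (real_transfer h).
Proof.
move=> gh; have [K HK] := T_lipschitz.
have H m : ae_equal (g \o branch m) (h \o branch m).
  apply: (@ae_equal_comp _ _ _ _ _ (fun y => T y - m%:R) K) gh.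
    by move=> x; rewrite /branch ST addrK.
  by move=> x y; rewrite opprB addrA subrK.
have N : mu.-negligible (\bigcup_m [set x | g (branch m x) <> h (branch m x)]).
  by apply: negligible_bigcup => m; exact/ae_equalP/H.
apply/ae_equalP; apply: negligibleS N => x /= ne.
apply: contrapT => H'; apply: ne; apply: eq_bigr => m _; congr (_ * _).
by apply: contrapT => ne; apply: H'; exists m.
Qed.

Lemma has_deriv_sum n (f f' : nat -> R -> R) : (forall m, has_deriv (f m) (f' m)) ->
  has_deriv (fun x => \sum_(m < n) f m x) (fun x => \sum_(m < n) f' m x).
Proof.
move=> df; elim: n => [|n IH].
  have e (u : nat -> R -> R) : (fun x => \sum_(m < 0) u m x) = fun=> 0.
    by apply/funext => x; rewrite big_ord0.
  by rewrite !e; exact: has_deriv_cst.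
have e (u : nat -> R -> R) : (fun x => \sum_(m < n.+1) u m x) =
    (fun x => \sum_(m < n) u m x + u n x).
  by apply/funext => x; rewrite big_ord_recr.
by rewrite !e; exact: has_derivD.
Qed.

Lemma sum_continuous n (f : nat -> R -> R) : (forall m, continuous (f m)) ->
  continuous (fun x => \sum_(m < n) f m x).
Proof.
move=> cf; elim: n => [|n IH].
  have -> : (fun x => \sum_(m < 0) f m x) = fun=> 0.
    by apply/funext => x; rewrite big_ord0.
  exact: cst_continuous1.
have -> : (fun x => \sum_(m < n.+1) f m x) = (fun x => \sum_(m < n) f m x + f n x).
  by apply/funext => x; rewrite big_ord_recr.
by move=> x; apply: cvgD; [exact: IH|exact: cf].
Qed.

(** Each branch has derivative 1 / T', of absolute value at most alpha, and the
    weight 1 / |T'| is C^1 because |T'| is a constant sign times T'.  The summand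
    for a branch is s g / T' evaluated along it, and its derivative is
    (s g / T')' / T'. *)
Lemma real_transfer_C1 : exists K, 0 <= K /\ forall g g' M,
  has_deriv g g' -> continuous g' ->
  (forall x, `|g x| <= M) -> (forall x, `|g' x| <= M) ->
  exists h', [/\ has_deriv (real_transfer g) h', continuous h' &
    forall x, `|real_transfer g x| <= K * M /\ `|h' x| <= K * M].
Proof.
have [s [s1 sE]] := T1_sign.
have [B [B0 HB]] := periodic_bounded T2_periodic cT2.
have a0 := ltW alpha_gt0.
have inv x : `|(T1 x)^-1| <= alpha.
  by rewrite normfV -[leRHS]invrK lef_pV2 ?posrE ?invr_gt0// normr_gt0 T1_neq0.
pose K := `|d|%:R * (alpha + alpha ^+ 2 + B * alpha ^+ 3).
have K0 : 0 <= K by rewrite mulr_ge0 ?addr_ge0 ?mulr_ge0 ?exprn_ge0.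
exists K; split => // g g' M dg cg' gM g'M.
have M0 : 0 <= M by apply: le_trans (gM 0).
have dw : has_deriv (fun x => (T1 x)^-1) (fun x => - T2 x / T1 x ^+ 2).
  exact: has_derivV T1_neq0 dT1.
have dG := has_derivZ s (has_derivM dg dw).
pose G' x := s * (g' x * (T1 x)^-1 + g x * (- T2 x / T1 x ^+ 2)).
have cG' : continuous G'.
  move=> x; apply: cvgM; first exact: cvg_cst.
  have ciT : continuous (fun x => (T1 x)^-1) by exact: has_deriv_continuous dw.
  apply: cvgD; first by apply: cvgM; [exact: cg'|exact: ciT].
  apply: cvgM; first exact: (has_deriv_continuous dg).
  apply: cvgM; first by apply: cvgN; exact: cT2.
  under eq_fun do rewrite -exprVn expr2.
  by rewrite -exprVn expr2; apply: cvgM; exact: ciT.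
have E : real_transfer g = (fun x => \sum_(m < absz d)
    (fun y => s * (g y * (T1 y)^-1)) (branch m x)).
  apply/funext => x; apply: eq_bigr => m _ /=.
  have s0 : s != 0 by rewrite -normr_eq0 s1 oner_eq0.
  have ss : s^-1 = s.
    apply: (mulfI s0); rewrite divff// -expr2 -real_normK ?num_real// s1.
    by rewrite expr1n.
  by rewrite sE invfM ss mulrCA.
exists (fun x => \sum_(m < absz d) (G' (branch m x) * (T1 (branch m x))^-1)).
have sumb (u : nat -> R) c : (forall m, `|u m| <= c) ->
    `|\sum_(m < absz d) u m| <= `|d|%:R * c.
  move=> uc; apply: le_trans (ler_norm_sum _ _ _) _.
  apply: (@le_trans _ _ (\sum_(m < absz d) c)); first by apply: ler_sum => m _.
  by rewrite sumr_const card_ord mulr_natl.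
split.
- by rewrite E; apply: (has_deriv_sum _ (fun m => has_deriv_comp dG (branch_deriv m))).
- apply: (sum_continuous _ (f := fun m x => G' (branch m x) * (T1 (branch m x))^-1)) => m x.
  have cb : continuous (branch m) by exact: branch_continuous.
  apply: cvgM; first by apply: (@continuous_comp _ _ _ (branch m) G'); [exact: cb|exact: cG'].
  apply: cvgV; first exact: T1_neq0.
  by apply: (@continuous_comp _ _ _ (branch m) T1); [exact: cb|exact: cT1].
have a2 : 0 <= alpha ^+ 2 by exact: exprn_ge0.
have a3 : 0 <= B * alpha ^+ 3 by rewrite mulr_ge0// exprn_ge0.
move=> x; split.
- have h : `|real_transfer g x| <= `|d|%:R * (M * alpha).
    apply: (sumb (fun m => g (branch m x) * `|T1 (branch m x)|^-1)) => m.
    by rewrite normrM normfV normr_id -normfV; apply: ler_pM.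
  apply: le_trans h _; rewrite /K -mulrA ler_wpM2l// mulrC ler_wpM2r// -addrA lerDl addr_ge0//.
- have h : `|\sum_(m < `|d|) G' (branch m x) * (T1 (branch m x))^-1| <=
      `|d|%:R * (M * (alpha ^+ 2 + B * alpha ^+ 3)).
    apply: (sumb (fun m => G' (branch m x) * (T1 (branch m x))^-1)) => m.
    rewrite normrM /G' normrM s1 mul1r.
    have h1 : `|g' (branch m x) * (T1 (branch m x))^-1| <= M * alpha.
      by rewrite normrM; apply: ler_pM.
    have h2 : `|g (branch m x) * (- T2 (branch m x) / T1 (branch m x) ^+ 2)| <=
        M * (B * alpha ^+ 2).
      rewrite normrM; apply: ler_pM => //; rewrite normrM normrN; apply: ler_pM => //.
      by rewrite -exprVn normrX; apply: lerXn2r; rewrite ?nnegrE.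
    have h3 := le_trans (ler_normD _ _) (lerD h1 h2).
    apply: le_trans (ler_pM (normr_ge0 _) (normr_ge0 _) h3 (inv _)) _.
    by rewrite !exprS expr0; lra.
  apply: le_trans h _; rewrite /K -mulrA ler_wpM2l// mulrC ler_wpM2r//; lra.
Qed.

End inverse.
End transfer.
(** The transfer operator of T on real functions, described without inverse
    branches: the degree and the inverse of the lift stay confined to the
    construction of L. *)
Record transfer_model (R : realType) (T : R -> R) (L : (R -> R) -> R -> R) : Prop := {
  model_transfer : forall f : R -> R[i], periodic f 1 -> forall x, transfer T f x =
    L (fun y => complex.Re (f y)) x +i* L (fun y => complex.Im (f y)) x;
  model_lin : forall c g h, L (fun x => c * g x + h x) = (fun x => c * L g x + L h x);
  model_meas : forall g, measurable_fun setT g -> measurable_fun setT (L g);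
  model_ae : forall g h, ae_equal g h -> ae_equal (L g) (L h);
  model_C1 : exists K, 0 <= K /\ forall g g' M, has_deriv g g' -> continuous g' ->
    (forall x, `|g x| <= M) -> (forall x, `|g' x| <= M) ->
    exists h', [/\ has_deriv (L g) h', continuous h' &
      forall x, `|L g x| <= K * M /\ `|h' x| <= K * M] }.

Lemma transfer_model_ex (R : realType) (T T1 T2 : R -> R) (d : int) (alpha : R) :
  (forall x, T (x + 1) = T x + d%:~R) -> 0 < alpha ->
  (forall x, alpha^-1 <= `|T1 x|) -> has_deriv T T1 -> has_deriv T1 T2 ->
  continuous T2 -> exists L, transfer_model T L.
Proof.
move=> Tlift a0 ex dT dT1 cT2.
have [S ST] := T_inverse Tlift a0 ex dT.
exists (real_transfer T1 d S); split.
- by move=> f pf x; exact: (transferE Tlift a0 ex dT ST pf (has_derivE dT)).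
- move=> c g h; apply/funext => x; rewrite /real_transfer mulr_sumr -big_split /=.
  by apply: eq_bigr => m _; ring.
- by move=> g; exact: (@real_transfer_meas _ _ _ _ d _ a0 ex dT dT1 _ ST).
- by move=> g h; exact: (real_transfer_ae Tlift dT dT1 ST).
- exact: (real_transfer_C1 Tlift a0 ex dT dT1 cT2 ST).
Qed.

(** * The space W^{1,1} of complex functions *)

Section W11_theory.
Variable R : realType.
Local Notation I01 := (`[0, 1]%classic : set R).
Local Notation mu := (@lebesgue_measure R).
Local Notation Re := complex.Re.
Local Notation Im := complex.Im.
Implicit Types (f g h : R -> R) (F G : R -> R[i]) (x y c : R).

Lemma ae_ReIm F G : ae_equal F G <->
  ae_equal (fun x => Re (F x)) (fun x => Re (G x)) /\
  ae_equal (fun x => Im (F x)) (fun x => Im (G x)).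
Proof.
split=> [/ae_equalP n|[h1 h2]].
  by split; apply/ae_equalP; apply: negligibleS n => x /= ne E; apply: ne; rewrite E.
apply: ae_lift2 h1 h2 _ => x; case: (F x) (G x) => a b [a' b'] /= -> -> //.
Qed.

Lemma sobolev_lin k c f g : sobolev k 1%E f -> sobolev k 1%E g ->
  sobolev k 1%E (fun x => c * f x + g x).
Proof.
move=> [Lf Hf] [Lg Hg]; split; first exact: Lp1_lin.
move=> j jk; have [f' [Lf' wf]] := Hf j jk; have [g' [Lg' wg]] := Hg j jk.
exists (fun x => c * f' x + g' x); split; first exact: Lp1_lin.
exact: (is_weak_deriv_lin c Lf Lg Lf' Lg' wf wg).
Qed.

Lemma sobolev_ae k f g : periodic g 1 -> measurable_fun setT g -> ae_equal f g ->
  sobolev k 1%E f -> sobolev k 1%E g.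
Proof.
move=> pg mg fg [Lf Hf]; have Lg := Lp1_ae pg mg fg Lf.
split => // j jk; have [f' [Lf' wf]] := Hf j jk.
by exists f'; split => //; exact: is_weak_deriv_ae Lf Lg fg wf.
Qed.

Lemma C1_sobolev f f' : has_deriv f f' -> continuous f' -> periodic f 1 ->
  sobolev 1 1%E f.
Proof.
move=> df cf' pf; have Lf := continuous_Lp1 (has_deriv_continuous df) pf.
split => // -[|[|//]] _; first by exists f; split => //; exact: is_weak_deriv0.
exists f'; split; last exact: is_weak_deriv_C1.
by apply: continuous_Lp1 => //; exact: has_deriv_periodic df pf.
Qed.

Lemma sobolev_cst c : sobolev 1 1%E (fun=> c : R).
Proof. exact: C1_sobolev (@has_deriv_cst R c) (@cst_continuous1 R 0) (fun=> erefl). Qed.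

Lemma sobolev_weak f : sobolev 1 1%E f ->
  Lp_circle 1%E (weak_deriv 1 f) /\ is_weak_deriv 1 f (weak_deriv 1 f).
Proof. by move=> [_ H]; apply: weak_derivP; exact: H. Qed.

Lemma W11_lin (c : R[i]) F G : W11 F -> W11 G -> W11 (fun x => c * F x + G x).
Proof.
case: c => a b [F1 F2] [G1 G2]; split.
  rewrite (_ : (fun x => _) = fun x => a * Re (F x) + (- b * Im (F x) + Re (G x))).
    by apply: sobolev_lin => //; exact: sobolev_lin.
  by apply/funext => x; case: (F x) (G x) => u v [u' v'] /=; ring.
rewrite (_ : (fun x => _) = fun x => a * Im (F x) + (b * Re (F x) + Im (G x))).
  by apply: sobolev_lin => //; exact: sobolev_lin.
by apply/funext => x; case: (F x) (G x) => u v [u' v'] /=; ring.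
Qed.

Lemma W11_real f : sobolev 1 1%E f -> W11 (fun x => (f x)%:C).
Proof. by move=> sf; split => //=; exact: sobolev_cst. Qed.

Definition conj_fun F : R -> R[i] := fun x => conjc (F x).

Lemma W11_conj F : W11 F -> W11 (conj_fun F).
Proof.
case=> F1 F2; split.
  by rewrite (_ : (fun x => _) = fun x => Re (F x))//; apply/funext => x; rewrite /conj_fun; case: (F x).
rewrite (_ : (fun x => _) = fun x => -1 * Im (F x) + 0); last first.
  by apply/funext => x; rewrite /conj_fun; case: (F x) => a b /=; ring.
exact: (@sobolev_lin 1 (-1) (fun x => Im (F x)) (fun=> 0) F2 (sobolev_cst 0)).
Qed.

Lemma normc_meas (a b : R -> R) : measurable_fun I01 a -> measurable_fun I01 b ->
  measurable_fun I01 (fun x => Normc.normc (a x +i* b x)).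
Proof.
move=> ma mb.
have ms : measurable_fun setT (@Num.sqrt R).
  by apply: continuous_meas; exact: sqrt_continuous.
rewrite (_ : (fun x => _) = @Num.sqrt R \o (fun x => a x ^+ 2 + b x ^+ 2))//.
apply: measurableT_comp => //.
by apply: measurable_funD; exact: measurable_funX.
Qed.

Lemma normc_real (a : R) : Normc.normc (a +i* 0) = `|a|.
Proof. by rewrite /= expr0n addr0 sqrtr_sqr. Qed.

(** The norm is defined with a chosen weak derivative; weak derivatives being
    unique almost everywhere, any other one may be used. *)
Lemma W11_norm_real F f f' : W11 F -> ae_equal F (fun x => (f x)%:C) ->
  Lp_circle 1%E f -> Lp_circle 1%E f' -> is_weak_deriv 1 f f' ->
  W11_norm F = int01 (fun x => `|f x|) + int01 (fun x => `|f' x|).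
Proof.
move=> WF Ff Lf Lf' wf; have [S1 S2] := WF.
have [/= h1 h2] := (ae_ReIm _ _).1 Ff.
have [L1 w1] := sobolev_weak S1; have [L2 w2] := sobolev_weak S2.
have [M1 _] := S1; have [M2 _] := S2.
have nm g : Lp_circle 1%E g -> measurable_fun I01 (fun x => `|g x|).
  by move=> /Lp1P[_ /integrable01_norm/integrable01_meas].
have L0 : Lp_circle 1%E (fun=> 0 : R).
  by apply: continuous_Lp1 => //; exact: cst_continuous1.
have w0 : is_weak_deriv 1 (fun=> 0 : R) (fun=> 0).
  exact: is_weak_deriv_C1 (@has_deriv_cst R 0) (@cst_continuous1 R 0) (fun=> erefl).
have d1 : ae_equal (weak_deriv 1 (fun x => Re (F x))) f'.
  apply: weak_deriv_ae => //; apply: (is_weak_deriv_ae Lf M1 _ wf).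
  exact: ae_equal_sym.
have d2 : ae_equal (weak_deriv 1 (fun x => Im (F x))) (fun=> 0).
  apply: weak_deriv_ae => //; apply: (is_weak_deriv_ae L0 M2 _ w0).
  exact: ae_equal_sym.
rewrite /W11_norm; congr (_ + _).
  rewrite -/(int01 _); apply: ae_int01; last 1 first.
  - by apply: ae_lift2 h1 h2 _ => x; case: (F x) => a b /= -> ->; rewrite expr0n addr0 sqrtr_sqr.
  - rewrite (_ : (fun x => _) = fun x => Normc.normc (Re (F x) +i* Im (F x))).
      by apply: normc_meas; [exact: Lp_meas M1|exact: Lp_meas M2].
    by apply/funext => x; case: (F x).
  - exact: nm.
rewrite -/(int01 _); apply: ae_int01.
- by apply: normc_meas; [exact: Lp_meas L1|exact: Lp_meas L2].
- exact: nm.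
apply: ae_lift2 d1 d2 _ => x E1 E2.
by rewrite /weak_derivC E1 E2 normc_real.
Qed.

(** * Eigenfunctionals *)

(** Eigenfunctionals in which boundedness is replaced by its consequence, the
    invariance under almost everywhere equality: this form is visibly stable under
    complex conjugation. *)
Record eigenform (L : (R -> R[i]) -> R -> R[i]) (lam : R[i])
    (phi : (R -> R[i]) -> R[i]) : Prop := {
  eigenform_lin : forall (c : R[i]) F G, W11 F -> W11 G ->
    phi (fun x => c * F x + G x) = c * phi F + phi G;
  eigenform_ae : forall F G, W11 F -> W11 G -> ae_equal F G -> phi F = phi G;
  eigenform_eigen : forall F, W11 F -> phi (L F) = lam * phi F }.

Lemma normc_eq0 (z : R[i]) : Normc.normc z <= 0 -> z = 0.
Proof.
move=> z0; apply: Normc.eq0_normc; apply/eqP; rewrite eq_le z0 /=.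
by case: (z) => a b /=; exact: sqrtr_ge0.
Qed.

Lemma W11_dual_ae phi F G : W11_dual phi -> W11 F -> W11 G -> ae_equal F G ->
  phi F = phi G.
Proof.
move=> [lin [C HC]] WF WG FG.
have WD := W11_lin (-1) WF WG.
have L0 : Lp_circle 1%E (fun=> 0 : R).
  by apply: continuous_Lp1 => //; exact: cst_continuous1.
have w0 : is_weak_deriv 1 (fun=> 0 : R) (fun=> 0).
  exact: is_weak_deriv_C1 (@has_deriv_cst R 0) (@cst_continuous1 R 0) (fun=> erefl).
have D0 : ae_equal (fun x => -1 * F x + G x) (fun x => (0 : R)%:C).
  by apply: ae_lift FG _ => x E; rewrite E mulN1r addNr.
have := HC _ WD; rewrite (W11_norm_real WD D0 L0 L0 w0).
rewrite (_ : (fun x => `|0|) = fun=> 0 :> R); last by apply/funext => x; rewrite normr0.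
rewrite int01_cst addr0 mulr0 lin// => /normc_eq0/eqP.
by rewrite mulN1r addrC subr_eq0 => /eqP.
Qed.

Lemma eigenfunctional_eigenform L lam phi :
  W11_eigenfunctional L lam phi -> eigenform L lam phi.
Proof.
move=> [dphi Hphi]; split => //; first by case: dphi.
by move=> F G; exact: W11_dual_ae.
Qed.

Section with_model.
Variables (T : R -> R) (L : (R -> R) -> R -> R) (lam : R).
Hypothesis model : transfer_model T L.
Local Notation LT := (transfer T).

Lemma W11_periodic F : W11 F -> periodic F 1.
Proof.
move=> [[[p1 _] _] [[p2 _] _]] x; move: (p1 x) (p2 x).
by case: (F (x + 1)) (F x) => a b [a' b'] /= -> ->.
Qed.

Lemma model_scale c g : L (fun x => c * g x) = fun x => c * L g x.
Proof.
have L0 : L (fun=> 0) = fun=> 0.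
  have := model_lin model (-1) (fun=> 0) (fun=> 0).
  rewrite (_ : (fun x => -1 * 0 + 0) = fun=> 0) => [->|]; last first.
    by apply/funext => x; rewrite mulr0 addr0.
  by apply/funext => x; rewrite mulN1r addNr.
have := model_lin model c g (fun=> 0); rewrite L0.
rewrite (_ : (fun x => c * g x + 0) = fun x => c * g x) => [->|]; last first.
  by apply/funext => x; rewrite addr0.
by apply/funext => x; rewrite addr0.
Qed.

Lemma model_periodic g : periodic g 1 -> periodic (L g) 1.
Proof.
move=> pg x; have pF : periodic (fun x => (g x)%:C) 1 by move=> y; rewrite pg.
have := @transfer_periodic R T (fun x => (g x)%:C) x.
by rewrite !(model_transfer model pF) => /(congr1 (@complex.Re R)).
Qed.

Lemma transfer_conj F : W11 F -> LT (conj_fun F) = conj_fun (LT F).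
Proof.
move=> WF; have pF := W11_periodic WF; have pc := W11_periodic (W11_conj WF).
apply/funext => x; rewrite /conj_fun (model_transfer model pc) (model_transfer model pF) /=.
congr (_ +i* _).
  by congr (L _ x); apply/funext => y; rewrite /conj_fun; case: (F y).
rewrite (_ : (fun y => _) = fun y => -1 * Im (F y)); last first.
  by apply/funext => y; rewrite /conj_fun; case: (F y) => a b /=; rewrite mulN1r.
by rewrite model_scale mulN1r.
Qed.

Lemma W11_ae F G : periodic G 1 -> measurable_fun setT (fun x => Re (G x)) ->
  measurable_fun setT (fun x => Im (G x)) -> ae_equal F G -> W11 F -> W11 G.
Proof.
move=> pG m1 m2 /ae_ReIm[h1 h2] [F1 F2].
split; first by apply: sobolev_ae F1 => // x; rewrite pG.
by apply: sobolev_ae F2 => // x; rewrite pG.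
Qed.

(** L0 F is periodic and measurable, so an almost everywhere equality is enough to
    transport membership in W^{1,1} to it. *)
Lemma transfer_W11 F G : W11 F -> W11 G -> ae_equal G (LT F) -> W11 (LT F).
Proof.
move=> WF WG; have pF := W11_periodic WF.
case: WF => [[L1' _] [L2' _]].
have mL g : Lp_circle 1%E g -> measurable_fun setT (L g).
  by move=> /Lp_measT mg; exact: (model_meas model mg).
move=> /W11_ae; apply => //; first exact: transfer_periodic.
  by under eq_fun do rewrite (model_transfer model pF) /=; exact: mL.
by under eq_fun do rewrite (model_transfer model pF) /=; exact: mL.
Qed.

(** An eigenform vanishes on the range of L - lam, so it is determined by its
    value on the eigenfunction v that spans a complement of that range. *)
Lemma eigenform_range phi v F (c : R[i]) : eigenform LT lam%:C phi -> W11 v -> W11 F ->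
  W11_range LT lam%:C (fun x => F x - c * v x) -> phi F = c * phi v.
Proof.
move=> ef Wv WF [WD [G [WG DG]]].
have WL : W11 (LT G).
  apply: (transfer_W11 WG (W11_lin lam%:C WG WD)).
  by apply: ae_lift DG _ => x E; rewrite E addrC subrK.
have WE := W11_lin (- lam%:C) WG WL.
have : phi (fun x => F x - c * v x) = phi (fun x => - lam%:C * G x + LT G x).
  apply: (eigenform_ae ef) => //.
  by apply: ae_lift DG _ => x E; rewrite E mulNr addrC.
rewrite (eigenform_lin ef)// (eigenform_eigen ef)// mulNr addNr.
have -> : (fun x => F x - c * v x) = (fun x => - c * v x + F x).
  by apply/funext => x; rewrite mulNr addrC.
rewrite (eigenform_lin ef)// mulNr => /eqP; rewrite addrC subr_eq0 => /eqP //.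
Qed.

Definition conj_form (phi : (R -> R[i]) -> R[i]) F : R[i] := conjc (phi (conj_fun F)).

Lemma conj_eigenform phi : eigenform LT lam%:C phi -> eigenform LT lam%:C (conj_form phi).
Proof.
move=> ef; split.
- move=> c F G WF WG; rewrite /conj_form.
  have -> : conj_fun (fun x => c * F x + G x) =
      (fun x => conjc c * conj_fun F x + conj_fun G x).
    by apply/funext => x; rewrite /conj_fun rmorphD rmorphM.
  rewrite (eigenform_lin ef) ?rmorphD ?rmorphM /= ?conjcK//; exact: W11_conj.
- move=> F G WF WG FG; rewrite /conj_form; congr conjc.
  apply: (eigenform_ae ef); try exact: W11_conj.
  by apply: ae_lift FG _ => x E; rewrite /conj_fun E.
- move=> F WF; rewrite /conj_form -transfer_conj//.
  rewrite (eigenform_eigen ef) ?rmorphM//=; last exact: W11_conj.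
  by congr (_ * _); apply/eqP; rewrite eq_complex /= oppr0 !eqxx.
Qed.

(** An eigenform and its conjugate are both determined by their value at v, and
    these two values agree because the value at 1 is 1 for both. *)
Lemma eigenform_real phi : W11_simple_eigenvalue LT lam%:C ->
  eigenform LT lam%:C phi -> phi (fun=> 1) = 1 ->
  forall F, W11 F -> conj_form phi F = phi F.
Proof.
move=> [v [[Wv _] _ _ _ dec]] ef phi1.
have efc := conj_eigenform ef.
have W1 : W11 (fun=> 1 : R[i]) by apply: (W11_real (f := fun=> 1)); exact: sobolev_cst.
have c1 : conj_form phi (fun=> 1) = 1.
  have e1 : conj_fun (fun=> 1) = fun=> 1.
    by apply/funext => x; rewrite /conj_fun rmorph1.
  by rewrite /conj_form e1 phi1 rmorph1.
have [c Hc] := dec _ W1.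
have E1 := eigenform_range ef Wv W1 Hc; have E2 := eigenform_range efc Wv W1 Hc.
rewrite phi1 in E1; rewrite c1 in E2.
have c0 : c != 0 by apply/eqP => c0; move: E1; rewrite c0 mul0r => /eqP; rewrite oner_eq0.
have Ev : conj_form phi v = phi v by apply: (mulfI c0); rewrite -E1 -E2.
move=> F WF; have [a Ha] := dec _ WF.
by rewrite (eigenform_range ef Wv WF Ha) (eigenform_range efc Wv WF Ha) Ev.
Qed.

(** v0 and its conjugate lie on the eigenline, and phi takes the value 1 at both. *)
Lemma eigenfunction_real phi v0 : W11_simple_eigenvalue LT lam%:C ->
  eigenform LT lam%:C phi -> phi (fun=> 1) = 1 ->
  W11_eigenfunction LT lam%:C v0 -> phi v0 = 1 ->
  ae_equal (fun x => Im (v0 x)) (fun=> 0).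
Proof.
move=> simple ef phi1 [Wv0 ev0] phiv0.
have real := eigenform_real simple ef phi1.
have Wc := W11_conj Wv0.
have evc : W11_eigenfunction LT lam%:C (conj_fun v0).
  split => //; rewrite transfer_conj//.
  move: ev0 => /ae_equalP n; apply/ae_equalP; apply: negligibleS n => x /= ne E.
  apply: ne; rewrite /conj_fun E rmorphM /=; congr (_ * _).
  by apply/eqP; rewrite eq_complex /= oppr0 !eqxx.
have phic : phi (conj_fun v0) = 1.
  have := real _ Wv0; rewrite /conj_form phiv0 => /(congr1 (@conjc R)).
  by rewrite conjcK rmorph1.
have ev0' : W11_eigenfunction LT lam%:C v0 by split.
have [v [[Wv _] _ line _ _]] := simple.
have [a Ha] := line _ ev0'; have [b Hb] := line _ evc.
have phis (c : R[i]) F : W11 F -> ae_equal F (fun x => c * v x) -> phi F = c * phi v.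
  move=> WF Fc.
  have W0 : W11 (fun x => (0 : R)%:C) by apply: W11_real; exact: sobolev_cst.
  have phi0 : phi (fun x => (0 : R)%:C) = 0.
    have := eigenform_lin ef (-1) W0 W0.
    rewrite (_ : (fun x => -1 * _ + _) = fun x => (0 : R)%:C) => [->|]; last first.
      by apply/funext => x; rewrite mulN1r addNr.
    by rewrite mulN1r addNr.
  rewrite -[RHS]addr0 -phi0 -(eigenform_lin ef)//.
  apply: (eigenform_ae ef) => //; first exact: W11_lin.
  by apply: ae_lift Fc _ => x E; rewrite E addr0.
have Ea := phis a _ Wv0 Ha; have Eb := phis b _ Wc Hb.
rewrite phiv0 in Ea; rewrite phic in Eb.
have v0' : phi v != 0 by apply/eqP => e; move: Ea; rewrite e mulr0 => /eqP; rewrite oner_eq0.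
have ab : a = b by apply: (mulIf v0'); rewrite -Ea -Eb.
apply: ae_lift2 Ha Hb _ => x E1; rewrite -ab -E1 /conj_fun.
by case: (v0 x) => p q [] /= h; lra.
Qed.

End with_model.
End W11_theory.

(** * The objective as a bounded real functional *)

(** Here a stands for a C^2 representative of v0 / T'. *)
Section objective_theory.
Variables (R : realType) (T T1 : R -> R) (L : (R -> R) -> R -> R).
Variables (phi : (R -> R[i]) -> R[i]) (v0 : R -> R[i]) (a a1 a2 : R -> R).
Local Notation I01 := (`[0, 1]%classic : set R).
Local Notation Re := complex.Re.
Local Notation Im := complex.Im.
Hypothesis model : transfer_model T L.
Hypotheses (T1E : derive1 T = T1) (T1_cont : continuous T1).
Hypotheses (T1_per : periodic T1 1) (T1_ne0 : forall x, T1 x != 0).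
Hypotheses (dphi : W11_dual phi) (Wv0 : W11 v0).
Hypothesis real_phi : forall F, W11 F -> conj_form phi F = phi F.
Hypothesis v0_real : ae_equal (fun x => Im (v0 x)) (fun=> 0).
Hypothesis v0_rep : ae_equal (fun x => Re (v0 x)) (fun x => a x * T1 x).
Hypotheses (da : has_deriv a a1) (da1 : has_deriv a1 a2) (ca2 : continuous a2).
Hypothesis a_per : periodic a 1.
Implicit Types (f g t : R -> R) (x y c : R).

Lemma C1_transfer_sobolev g g' : has_deriv g g' -> continuous g' -> periodic g 1 ->
  sobolev 1 1%E (fun x => - L g x).
Proof.
move=> dg cg' pg.
have pg' := has_deriv_periodic dg pg.
have [M1 [M10 HM1]] := periodic_bounded pg (has_deriv_continuous dg).
have [M2 [M20 HM2]] := periodic_bounded pg' cg'.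
have [K [_ HK]] := model_C1 model.
have [|x|h' [dh ch _]] := HK g g' (M1 + M2) dg cg'.
- by move=> x; apply: le_trans (HM1 x) _; rewrite lerDl.
- by apply: le_trans (HM2 x) _; rewrite lerDr.
apply: C1_sobolev (has_derivN dh) _ _.
  by move=> x; apply: cvgN; exact: ch.
by move=> x; rewrite (model_periodic model).
Qed.

(** The derivative of v0 Tdot / T', where t is a C^2 representative of Tdot with
    derivative t1. *)
Definition flux t t1 x := a1 x * t x + a x * t1 x.

Lemma flux_deriv t t1 t2 : has_deriv t t1 -> has_deriv t1 t2 ->
  has_deriv (flux t t1) (fun x => a2 x * t x + a1 x * t1 x + (a1 x * t1 x + a x * t2 x)).
Proof.
move=> dt dt1; apply: has_derivD; first exact: has_derivM da1 dt.
exact: has_derivM da dt1.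
Qed.

Lemma flux_deriv_continuous t t1 t2 : has_deriv t t1 -> has_deriv t1 t2 -> continuous t2 ->
  continuous (fun x => a2 x * t x + a1 x * t1 x + (a1 x * t1 x + a x * t2 x)).
Proof.
move=> dt dt1 ct2.
have ct := has_deriv_continuous dt; have ct1 := has_deriv_continuous dt1.
have ca := has_deriv_continuous da; have ca1 := has_deriv_continuous da1.
move=> x; apply: cvgD; apply: cvgD; apply: cvgM;
  first [exact: ca2|exact: ct|exact: ca1|exact: ct1|exact: ca|exact: ct2].
Qed.

Lemma flux_periodic t t1 : has_deriv t t1 -> periodic t 1 -> periodic (flux t t1) 1.
Proof.
move=> dt pt x; have pt1 := has_deriv_periodic dt pt; have pa1 := has_deriv_periodic da a_per.
by rewrite /flux pa1 pt a_per pt1.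
Qed.

Section formula.
Variables (Tdot t t1 t2 : R -> R).
Hypotheses (LTdot : Lp_circle 1%E Tdot) (Tdot_t : ae_equal Tdot t).
Hypotheses (dt : has_deriv t t1) (dt1 : has_deriv t1 t2) (ct2 : continuous t2).
Hypothesis pt : periodic t 1.
Let H y := v0 y * (Tdot y / derive1 T y)%:C.

Lemma quotient_meas : measurable_fun setT (fun y => Tdot y / T1 y).
Proof.
apply: measurable_funM; first exact: Lp_measT LTdot.
by apply: continuous_meas => x; apply: cvgV => //; exact: T1_cont.
Qed.

Lemma quotient_periodic : periodic (fun y => Tdot y / T1 y) 1.
Proof. by move=> x; case: LTdot => pT _; rewrite pT T1_per. Qed.

Lemma ReH y : Re (H y) = Re (v0 y) * (Tdot y / T1 y).
Proof. by rewrite /H T1E; case: (v0 y) => p q /=; rewrite mulr0 subr0. Qed.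

Lemma ImH y : Im (H y) = Im (v0 y) * (Tdot y / T1 y).
Proof. by rewrite /H T1E; case: (v0 y) => p q /=; rewrite mulr0 add0r. Qed.

Lemma weak_deriv_ReH : Lp_circle 1%E (weak_deriv 1 (fun y => Re (H y))) /\
  ae_equal (weak_deriv 1 (fun y => Re (H y))) (flux t t1).
Proof.
have [[Lv _] _] := Wv0.
have dat : has_deriv (fun x => a x * t x) (flux t t1) by exact: has_derivM.
have cf := has_deriv_continuous (flux_deriv dt dt1).
have pf := flux_periodic dt pt.
have pat : periodic (fun x => a x * t x) 1 by move=> x; rewrite a_per pt.
have Lf := continuous_Lp1 cf pf.
have Lat := continuous_Lp1 (has_deriv_continuous dat) pat.
have eH : ae_equal (fun x => a x * t x) (fun y => Re (H y)).
  apply: ae_lift2 v0_rep Tdot_t _ => x E1 E2; rewrite ReH E1 E2.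
  by rewrite mulrA mulrAC mulfK.
have LH : Lp_circle 1%E (fun y => Re (H y)).
  apply: Lp1_ae eH Lat.
    by move=> x; rewrite !ReH; case: (Lv) => -> _; rewrite quotient_periodic.
  under eq_fun do rewrite ReH.
  by apply: measurable_funM; [exact: Lp_measT Lv|exact: quotient_meas].
have wH : is_weak_deriv 1 (fun y => Re (H y)) (flux t t1).
  by apply: is_weak_deriv_ae Lat LH eH _; exact: is_weak_deriv_C1.
split; last exact: weak_deriv_ae.
by have [|] := @weak_derivP R 1 (fun y => Re (H y)); first by exists (flux t t1).
Qed.

Lemma weak_deriv_ImH : Lp_circle 1%E (weak_deriv 1 (fun y => Im (H y))) /\
  ae_equal (weak_deriv 1 (fun y => Im (H y))) (fun=> 0).
Proof.
have [_ [Lv _]] := Wv0.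
have L0 : Lp_circle 1%E (fun=> 0 : R).
  by apply: continuous_Lp1 => //; exact: cst_continuous1.
have eH : ae_equal (fun=> 0) (fun y => Im (H y)).
  by apply: ae_lift v0_real _ => x E1; rewrite ImH E1 mul0r.
have LH : Lp_circle 1%E (fun y => Im (H y)).
  apply: Lp1_ae eH L0.
    by move=> x; rewrite !ImH; case: (Lv) => -> _; rewrite quotient_periodic.
  under eq_fun do rewrite ImH.
  by apply: measurable_funM; [exact: Lp_measT Lv|exact: quotient_meas].
have wH : is_weak_deriv 1 (fun y => Im (H y)) (fun=> 0).
  apply: is_weak_deriv_ae L0 LH eH _.
  exact: is_weak_deriv_C1 (@has_deriv_cst R 0) (@cst_continuous1 R 0) (fun=> erefl).
split; last exact: weak_deriv_ae.
by have [|] := @weak_derivP R 1 (fun y => Im (H y)); first by exists (fun=> 0).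
Qed.

Lemma flux_W11 : W11 (fun x => (- L (flux t t1) x)%:C).
Proof.
apply: W11_real; apply: C1_transfer_sobolev (flux_deriv dt dt1) _ _.
  exact: flux_deriv_continuous.
exact: flux_periodic.
Qed.

(** The weak derivative of v0 Tdot / T' is the flux almost everywhere, and neither
    the transfer operator nor phi distinguishes almost everywhere equal
    functions. *)
Lemma objective_formula : objective T phi v0 Tdot = phi (fun x => (- L (flux t t1) x)%:C).
Proof.
have [L1 e1] := weak_deriv_ReH; have [L2 e2] := weak_deriv_ImH.
have WF := flux_W11.
have pD : periodic (weak_derivC 1 H) 1.
  by move=> x; rewrite /weak_derivC; case: L1 => -> _; case: L2 => -> _.
have DE : dot_transfer T Tdot v0 = fun x =>
    (- L (weak_deriv 1 (fun y => Re (H y))) x) +i* (- L (weak_deriv 1 (fun y => Im (H y))) x).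
  by apply/funext => x; rewrite /dot_transfer (model_transfer model pD); simpc.
have L0 : L (fun=> 0) = fun=> 0.
  have := model_scale model 0 (fun=> 0).
  rewrite (_ : (fun x => 0 * 0) = fun=> 0) => [->|]; last by apply/funext => x; rewrite mulr0.
  by apply/funext => x; rewrite mul0r.
have eD : ae_equal (fun x => (- L (flux t t1) x)%:C) (dot_transfer T Tdot v0).
  rewrite DE; apply: ae_lift2 (model_ae model e1) (model_ae model e2) _ => x -> ->.
  by rewrite L0 oppr0.
have WD : W11 (dot_transfer T Tdot v0).
  apply: W11_ae eD WF.
  - by move=> x; rewrite DE (model_periodic model) ?(model_periodic model)//; [case: L2|case: L1].
  - rewrite DE /=; apply: measurableT_comp => //; apply: (model_meas model).
    exact: Lp_measT L1.
  - rewrite DE /=; apply: measurableT_comp => //; apply: (model_meas model).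
    exact: Lp_measT L2.
by rewrite /objective; symmetry; exact: W11_dual_ae.
Qed.

End formula.

(** On the circle the L^1 norm of each derivative is at most its L^2 norm, hence at
    most the H^4 norm; C2_representative adds two of these. *)
Lemma H4_C2_representative f : H4 f -> exists t t1 t2, [/\
  [/\ has_deriv t t1, has_deriv t1 t2, continuous t2 & periodic t 1], ae_equal f t &
  forall x, [/\ `|t x| <= 2 * Num.sqrt (H4_inner f f), `|t1 x| <= 2 * Num.sqrt (H4_inner f f) &
    `|t2 x| <= 2 * Num.sqrt (H4_inner f f)]].
Proof.
move=> Hf; have [Lf _] := Hf.
have [j j3||t [t1 [t2 [D1 D2 D3]]]] := @C2_representative R f (fun j => weak_deriv j f).
- have [Lw ww] := H4_deriv Hf (leq_trans j3 (leqnSn 3)).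
  by split => //; exact: Lp2_Lp1.
- exact: Lp2_Lp1.
have bnd k : (k <= 4)%N -> int01 (fun x => `|weak_deriv k f x|) <= Num.sqrt (H4_inner f f).
  move=> k4; have [/Lp2P[pw mw i2] _] := H4_deriv Hf k4.
  have i1 := sqr_integrable01 mw i2.
  rewrite -[leLHS]ger0_norm; last exact: int01_ge0.
  rewrite -sqrtr_sqr; apply: ler_wsqrtr.
  exact: le_trans (sqr_int01_norm i1 i2) (H4_deriv_le _ k4).
exists t, t1, t2; split => // x; have [B0 B1 B2] := D3 x.
have := bnd 0%N isT; have := bnd 1%N isT; have := bnd 2%N isT; have := bnd 3%N isT.
move=> h3 h2 h1 h0; rewrite mulr_natl mulr2n; split.
- exact: le_trans B0 (lerD h0 h1).
- exact: le_trans B1 (lerD h1 h2).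
- exact: le_trans B2 (lerD h2 h3).
Qed.

(** The argument of phi in objective_formula is a real function. *)
Lemma objective_real f : H4 f -> exists r : R, objective T phi v0 f = r%:C.
Proof.
move=> Hf; have [t [t1 [t2 [[dt dt1 ct2 pt] ft _]]]] := H4_C2_representative Hf.
have [Lf _] := Hf; have L1 := Lp2_Lp1 Lf.
rewrite (objective_formula L1 ft dt dt1 ct2 pt).
have := real_phi (flux_W11 dt dt1 ct2 pt); rewrite /conj_form.
rewrite (_ : conj_fun _ = fun x => (- L (flux t t1) x)%:C); last first.
  by apply/funext => x; apply/eqP; rewrite eq_complex /= oppr0 !eqxx.
move: (phi _) => [p q] [] h; exists p; congr (_ +i* _); lra.
Qed.

Definition real_objective f : R := Re (objective T phi v0 f).

Lemma real_objectiveE f : H4 f -> objective T phi v0 f = (real_objective f)%:C.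
Proof. by move=> Hf; have [r E] := objective_real Hf; rewrite /real_objective E. Qed.

Lemma real_objective_lin c f g : H4 f -> H4 g ->
  real_objective (fun x => c * f x + g x) = c * real_objective f + real_objective g.
Proof.
move=> Hf Hg; have Hfg := H4_lin c Hf Hg.
have [t [t1 [t2 [[dt dt1 ct2 pt] ft _]]]] := H4_C2_representative Hf.
have [s [s1 [s2 [[ds ds1 cs2 ps] gs _]]]] := H4_C2_representative Hg.
have [Lf _] := Hf; have [Lg _] := Hg; have [Lfg _] := Hfg.
have dr := has_derivD (has_derivZ c dt) ds; have dr1 := has_derivD (has_derivZ c dt1) ds1.
have cr2 : continuous (fun x => c * t2 x + s2 x).
  move=> x; apply: cvgD; last exact: cs2.
  by apply: cvgM; [exact: cvg_cst|exact: ct2].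
have pr : periodic (fun x => c * t x + s x) 1 by move=> x; rewrite pt ps.
have fgr : ae_equal (fun x => c * f x + g x) (fun x => c * t x + s x).
  by apply: ae_lift2 ft gs _ => x -> ->.
have E : objective T phi v0 (fun x => c * f x + g x) =
    c%:C * objective T phi v0 f + objective T phi v0 g.
  rewrite (objective_formula (Lp2_Lp1 Lf) ft dt dt1 ct2 pt).
  rewrite (objective_formula (Lp2_Lp1 Lg) gs ds ds1 cs2 ps).
  rewrite (objective_formula (Lp2_Lp1 Lfg) fgr dr dr1 cr2 pr).
  have W1 := flux_W11 dt dt1 ct2 pt; have W2 := flux_W11 ds ds1 cs2 ps.
  case: dphi => lin _; rewrite -lin//; congr phi; apply/funext => x.
  rewrite (_ : flux _ _ = fun x => c * flux t t1 x + flux s s1 x); last first.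
    by apply/funext => y; rewrite /flux; ring.
  rewrite (model_lin model); apply/eqP; rewrite eq_complex /=; apply/andP.
  by split; apply/eqP; ring.
rewrite /real_objective E !real_objectiveE//=.
by rewrite mul0r subr0.
Qed.

Lemma real_objective_bound : exists C, 0 <= C /\
  forall f, H4 f -> real_objective f ^+ 2 <= C * H4_inner f f.
Proof.
have [K [K0 HK]] := model_C1 model.
case: (dphi) => _ [C HC].
have ca := has_deriv_continuous da; have ca1 := has_deriv_continuous da1.
have pa1 := has_deriv_periodic da a_per; have pa2 := has_deriv_periodic da1 pa1.
have [A [A0 HA]] := periodic_bounded a_per ca.
have [A1 [A10 HA1]] := periodic_bounded pa1 ca1.
have [A2 [A20 HA2]] := periodic_bounded pa2 ca2.
pose B := A + A1 + A1 + A2.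
have B0 : 0 <= B by rewrite !addr_ge0.
(* C bounds phi, K bounds the transfer operator on C^1, and 2 B bounds the C^1
   norm of the flux in terms of the H^4 norm; the remaining 2 comes from the two
   terms of the W^{1,1} norm *)
exists ((`|C| * (2 * (K * (B * 2)))) ^+ 2); split; first exact: sqr_ge0.
move=> f Hf; have [t [t1 [t2 [[dt dt1 ct2 pt] ft bt]]]] := H4_C2_representative Hf.
have [Lf _] := Hf.
set N := Num.sqrt (H4_inner f f) in bt.
have N0 : 0 <= N by exact: sqrtr_ge0.
pose F := flux t t1.
have mulb (u w p q : R) : `|u| <= p -> `|w| <= q -> `|u * w| <= p * q.
  by move=> *; rewrite normrM; apply: ler_pM.
have bF x : `|F x| <= B * (2 * N).
  have [b0 b1 b2] := bt x.
  apply: le_trans (ler_normD _ _) _.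
  have h1 := mulb _ _ _ _ (HA1 x) b0; have h2 := mulb _ _ _ _ (HA x) b1.
  apply: le_trans (lerD h1 h2) _; rewrite -mulrDl ler_wpM2r ?mulr_ge0//; rewrite /B; lra.
have dF := flux_deriv dt dt1; have cF := flux_deriv_continuous dt dt1 ct2.
have [|h' [dh ch bh]] := HK F _ (B * (2 * N)) dF cF bF.
  move=> x; have [b0 b1 b2] := bt x.
  have h1 := mulb _ _ _ _ (HA2 x) b0; have h2 := mulb _ _ _ _ (HA1 x) b1.
  have h3 := mulb _ _ _ _ (HA x) b2.
  apply: le_trans (ler_normD _ _) _.
  apply: le_trans (lerD (ler_normD _ _) (ler_normD _ _)) _.
  apply: le_trans (lerD (lerD h1 h2) (lerD h2 h3)) _.
  by rewrite -!mulrDl ler_wpM2r ?mulr_ge0//; rewrite /B; lra.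
have WF := flux_W11 dt dt1 ct2 pt.
have pF := flux_periodic dt pt.
have pLF : periodic (fun x => - L F x) 1 by move=> x; rewrite (model_periodic model).
have dLF := has_derivN dh.
have ch' : continuous (fun x => - h' x) by move=> x; apply: cvgN; exact: ch.
have LLF := continuous_Lp1 (has_deriv_continuous dLF) pLF.
have Lh := continuous_Lp1 ch' (has_deriv_periodic dLF pLF).
have := HC _ WF; rewrite -(objective_formula (Lp2_Lp1 Lf) ft dt dt1 ct2 pt).
rewrite (W11_norm_real WF (ae_equal_refl _) LLF Lh (is_weak_deriv_C1 dLF ch' pLF)).
rewrite real_objectiveE// normc_real => HJ.
have bint g : Lp_circle 1%E g -> (forall x, `|g x| <= K * (B * (2 * N))) ->
    int01 (fun x => `|g x|) <= K * (B * (2 * N)).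
  move=> /Lp1P[_ g1] gb; rewrite -[leRHS]int01_cst.
  by apply: int01_le; [exact: integrable01_norm|exact: integrable01_cst|move=> x _; exact: gb].
have i1 : int01 (fun x => `|- L F x|) <= K * (B * (2 * N)).
  by apply: bint => // x; rewrite normrN; case: (bh x).
have i2 : int01 (fun x => `|- h' x|) <= K * (B * (2 * N)).
  by apply: bint => // x; rewrite normrN; case: (bh x).
have i0 : 0 <= int01 (fun x => `|- L F x|) + int01 (fun x => `|- h' x|).
  by rewrite addr_ge0//; apply: int01_ge0.
have HJ' : `|real_objective f| <= `|C| * (2 * (K * (B * 2))) * N.
  apply: le_trans HJ _; apply: le_trans (ler_wpM2r i0 (ler_norm C)) _.
  rewrite -mulrA ler_wpM2l//; apply: le_trans (lerD i1 i2) _; lra.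
rewrite -(@sqr_sqrtr _ (H4_inner f f)) ?H4_inner_ge0// -/N -exprMn.
rewrite -real_normK ?num_real// ler_sqr ?nnegrE// mulr_ge0// !mulr_ge0//.
Qed.

End objective_theory.

Lemma objective_bounded_linear (R : realType) (T0 : R -> R) (alpha lambda0 : R)
    (phi0 : (R -> R[i]) -> R[i]) (v0 : R -> R[i]) :
  circle_lift T0 -> is_Ck 4 T0 -> 0 < alpha ->
  (forall x, alpha^-1 <= `|derive1 T0 x|) ->
  W11_simple_eigenvalue (transfer T0) lambda0%:C ->
  W11_eigenfunctional (transfer T0) lambda0%:C phi0 ->
  phi0 (fun=> 1) = 1 -> sobolevC 3 1%E v0 ->
  W11_eigenfunction (transfer T0) lambda0%:C v0 -> phi0 v0 = 1 ->
  let J := real_objective T0 phi0 v0 in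
  [/\ forall f, H4 f -> objective T0 phi0 v0 f = (J f)%:C,
      forall c f g, H4 f -> H4 g -> J (fun x => c * f x + g x) = c * J f + J g
    & exists C, 0 <= C /\ forall f, H4 f -> J f ^+ 2 <= C * H4_inner f f].
Proof.
move=> [d Tlift] [dT _] a0 ex simple eig phi1 [sv _] ev0 phiv0 J.
pose T1 := derive1 T0; pose T2 := derive1 T1; pose T3 := derive1 T2.
have d1 : has_deriv T0 T1 by apply: derivable_has_deriv => x; exact: (dT 0%N x).
have d2 : has_deriv T1 T2 by apply: derivable_has_deriv => x; exact: (dT 1%N x).
have d3 : has_deriv T2 T3 by apply: derivable_has_deriv => x; exact: (dT 2%N x).
have d4 : has_deriv T3 (derive1 T3) by apply: derivable_has_deriv => x; exact: (dT 3%N x).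
have cT1 := has_deriv_continuous d2; have cT2 := has_deriv_continuous d3.
have cT3 := has_deriv_continuous d4.
have T10 := T1_neq0 a0 ex.
have pT1 : periodic T1 1 by move=> x; exact: T1_periodic Tlift d1 x.
have [L model] := transfer_model_ex Tlift a0 ex d1 d2 cT2.
have ef := eigenfunctional_eigenform eig; have [dphi _] := eig; have [Wv0 _] := ev0.
have real := eigenform_real model simple ef phi1.
have v0i := eigenfunction_real model simple ef phi1 ev0 phiv0.
have [Lv Hv] := sv.
have [j j3||w [w1 [w2 [[dw dw1 cw2 pw] vw _]]]] :=
  @C2_representative R (fun x => complex.Re (v0 x))
    (fun j => weak_deriv j (fun x => complex.Re (v0 x))).
- by apply: weak_derivP; exact: Hv.
- exact: Lv.
(* w is the C^2 representative of v0, so that w b represents v0 / T0' *)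
pose b x := (T1 x)^-1; pose b1 x := - (T2 x * (b x * b x)).
have db : has_deriv b b1.
  apply: has_deriv_eq (has_derivV T10 d2) _ => x.
  by rewrite /b1 /b mulNr -exprVn expr2.
have db1 := has_derivN (has_derivM d3 (has_derivM db db)).
have cb := has_deriv_continuous db; have cb1 := has_deriv_continuous db1.
pose b2 x := - (T3 x * (b x * b x) + T2 x * (b1 x * b x + b x * b1 x)).
have cb2 : continuous b2.
  have cbb : continuous (fun x => b x * b x) by move=> x; apply: cvgM; exact: cb.
  move=> x; apply: cvgN; apply: cvgD; apply: cvgM.
  - exact: cT3.
  - exact: cbb.
  - exact: cT2.
  - by apply: cvgD; apply: cvgM; first [exact: cb|exact: cb1].
have cw := has_deriv_continuous dw; have cw1 := has_deriv_continuous dw1.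
have da := has_derivM dw db.
have da1 := has_derivD (has_derivM dw1 db) (has_derivM dw db1).
have ca2 : continuous (fun x => w2 x * b x + w1 x * b1 x + (w1 x * b1 x + w x * b2 x)).
  move=> x; apply: cvgD; apply: cvgD; apply: cvgM;
    first [exact: cw2|exact: cb|exact: cw1|exact: cb1|exact: cw|exact: cb2].
have pa : periodic (fun x => w x * b x) 1 by move=> x; rewrite /b pw pT1.
have v0_rep : ae_equal (fun x => complex.Re (v0 x)) (fun x => w x * b x * T1 x).
  by apply: ae_lift vw _ => x ->; rewrite /b mulfVK.
have T1E : derive1 T0 = T1 by [].
split.
- move=> f Hf.
  exact: (real_objectiveE model T1E cT1 pT1 T10 dphi Wv0 real v0i v0_rep da da1 ca2 pa Hf).
- move=> c f g Hf Hg.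
  exact: (real_objective_lin model T1E cT1 pT1 T10 dphi Wv0 real v0i v0_rep da da1 ca2 pa c Hf Hg).
- exact: (real_objective_bound model T1E cT1 pT1 T10 dphi Wv0 real v0i v0_rep da da1 ca2 pa).
Qed.

(** The scalar product of H^4 is degenerate on functions, its null vectors being the
    functions that vanish almost everywhere; uniqueness is therefore up to almost
    everywhere equality. *)
Lemma H4_ball_maximiser_exists_unique (R : realType) (F : (R -> R) -> R[i]) (J : (R -> R) -> R) :
  (forall f, H4 f -> F f = (J f)%:C) ->
  (forall c f g, H4 f -> H4 g -> J (fun x => c * f x + g x) = c * J f + J g) ->
  (exists C, 0 <= C /\ forall f, H4 f -> J f ^+ 2 <= C * H4_inner f f) ->
  (exists f, H4 f /\ F f <> 0) ->
  exists f, H4_ball_maximiser F f /\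
    forall g, H4_ball_maximiser F g -> ae_equal g f.
Proof.
move=> JE Jlin Jbound Fne.
have subE (f g : R -> R^o) : f - g = (fun x => -1 * g x + f x).
  by apply/funext => x; rewrite mulN1r addrC.
have maxE f : H4_ball_maximiser F f <->
    ball_maximiser (@H4 R : (R -> R^o) -> Prop) (@H4_inner R) J f.
  split=> -[Hf nf max]; split.
  - exact: Hf.
  - by move: nf; rewrite H4_norm_le1.
  - move=> g Hg ng; have := max g Hg; rewrite H4_norm_le1 => /(_ ng).
    by rewrite (JE _ Hf) (JE _ Hg) lecR.
  - exact: Hf.
  - by rewrite H4_norm_le1.
  - move=> g Hg; rewrite H4_norm_le1 => ng; rewrite (JE _ Hf) (JE _ Hg) lecR; exact: max.
have Jne : exists f, H4 f /\ J f <> 0.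
  have [f [Hf Ff]] := Fne; exists f; split; first exact: Hf.
  by move=> E; apply: Ff; rewrite (JE _ Hf) E.
have [||||||||x [xmax xuniq]] := @hilbert_ball_maximiser R (R -> R^o) (@H4 R) (@H4_inner R) J.
- by move=> c f g; exact: H4_lin.
- by move=> f g _ _; exact: H4_inner_sym.
- by move=> c f g h; exact: H4_inner_lin.
- by move=> f _; exact: H4_inner_ge0.
- by move=> c f g; exact: Jlin.
- move=> u Hu cu; have [|f [Hf cf]] := H4_complete Hu.
    by move=> n m nm; have := cu n m nm; rewrite subE.
  exists f; split; first exact: Hf.
  by move=> n; rewrite subE; exact: cf.
- exact: Jbound.
- exact: Jne.
exists x; split; first exact/maxE.
move=> y /maxE ymax; have [Hx _ _] := xmax; have [Hy _ _] := ymax.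
have := xuniq y ymax; rewrite subE => E0.
have := H4_inner_eq0 (H4_lin (-1) Hx Hy) E0.
by move=> h; apply: ae_lift h _ => z; lra.
Qed.

Theorem proposition9 (R : realType) (T0 : R -> R) (alpha lambda0 : R)
    (phi0 : (R -> R[i]) -> R[i]) (v0 : R -> R[i])
    (T0_circle : circle_lift T0)
    (A0 : is_Ck 4 T0)
    (alpha_gt0 : 0 < alpha) (alpha_lt1 : alpha < 1)
    (A1 : forall x : R, alpha^-1 <= `|derive1 T0 x|)
    (lambda0_gt0 : 0 < lambda0) (lambda0_gt : alpha < lambda0)
    (lambda0_simple : W11_simple_eigenvalue (transfer T0) lambda0%:C)
    (phi0_eigen : W11_eigenfunctional (transfer T0) lambda0%:C phi0)
    (phi0_1 : phi0 (fun=> 1) = 1)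
    (v0_W31 : sobolevC 3 1%E v0)
    (v0_eigen : W11_eigenfunction (transfer T0) lambda0%:C v0)
    (phi0_v0 : phi0 v0 = 1)
    (J_neq0 : exists Tdot : R -> R,
       H4 Tdot /\ objective T0 phi0 v0 Tdot <> 0) :
  exists Tdot : R -> R,
    H4_ball_maximiser (objective T0 phi0 v0) Tdot /\
    forall Sdot : R -> R, H4_ball_maximiser (objective T0 phi0 v0) Sdot ->
      ae_equal Sdot Tdot.
Proof.
have [FE Jlin Jbound] := objective_bounded_linear T0_circle A0 alpha_gt0 A1 lambda0_simple
  phi0_eigen phi0_1 v0_W31 v0_eigen phi0_v0.
exact: H4_ball_maximiser_exists_unique FE Jlin Jbound J_neq0.
Qed.
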